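(* Let $G$ be a locally compact Abelian group with dual group $\widehat{G}$. Let $q\in(2,\infty)$, $p\in[q',q]$ with $p\neq2$, and $u,v,w\in[1,\infty)$ be such that $$\frac1u+\frac1v\ge1+\frac1w.$$ Then there exists a positive constant $C$ such that, for any $(f,g)\in L^{p',u}(G)\times L^{p,v}(G)$, $$\left\|V_gf\right\|_{L^{q,w}(G\times\widehat{G})}\le C\|f\|_{L^{p',u}(G)}\|g\|_{L^{p,v}(G)}.$$
   Context: $G$ is a locally compact Abelian group (written additively) with a fixed Haar measure $\mu$; $\widehat G$ is its dual group (also written additively) with Haar measure $\mu^*$ normalized so that the Plancherel formula holds; $G\times\widehat G$ carries the Radon product measure of $\mu$ and $\mu^*$. For $x\in G$, $\xi\in\widehat G$, $\langle x,\xi\rangle$ denotes the value of the character $\xi$ at $x$, so $|\langle x,\xi\rangle|=1$. For $q\in[1,\infty]$, $q'$ is the conjugate index, $1/q+1/q'=1$. Lorentz spaces: on a measure space $(X,\lambda)$ (here $X=G$ or $X=G\times\widehat G$), for measurable $f$ let $d_f(\alpha)=\lambda(\{x\in X: |f(x)|>\alpha\})$ for $\alpha\ge 0$, and $f^*(t)=\inf\{\alpha\in(0,\infty): d_f(\alpha)\le t\}$ for $t\ge0$. For $p,q\in(0,\infty]$, $L^{p,q}(X)$ is the space of measurable $f$ with finite quasi-norm $\|f\|_{L^{p,q}(X)}=\{\int_0^\infty[t^{1/p}f^*(t)]^q\frac{dt}{t}\}^{1/q}$ if $q<\infty$, and $\|f\|_{L^{p,\infty}(X)}=\sup_{t>0}t^{1/p}f^*(t)$.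 Fourier transform: $\widehat f(\xi)=\int_G f(x)\overline{\langle x,\xi\rangle}\,d\mu(x)$ for $f\in L^1(G)$. Translation: $T_xg(y)=g(y-x)$. Short-time Fourier transform of $f$ with window $g$: for $f,g\in L^2(G)$, $$V_gf(x,\xi)=\int_G f(y)\overline{g(y-x)}\,\overline{\langle y,\xi\rangle}\,d\mu(y),\quad (x,\xi)\in G\times\widehat G,$$ that is, $V_gf(x,\cdot)$ is the Fourier transform of $f\,\overline{T_xg}$; for $f,g$ not in $L^2(G)$, $V_gf$ is understood through the same formula (equivalently, as the extension by density from simple functions, i.e. finite linear combinations of characteristic functions of sets of finite measure). *)

(* Defs.v *)
From HB Require Import structures.
From mathcomp Require Import all_boot all_order all_algebra.
From mathcomp Require Import all_classical all_reals all_analysis.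
From mathcomp Require Import complex.

Set Implicit Arguments.
Unset Strict Implicit.
Unset Printing Implicit Defensive.

Import Order.TTheory GRing.Theory Num.Theory.
Import numFieldNormedType.Exports.
Import ComplexField.Normc.

Local Open Scope classical_set_scope.
Local Open Scope ring_scope.

(* The norm topology of the complex numbers R[i]. *)
HB.instance Definition _ (R : realType) := PseudoPointedMetric.copy R[i] R[i]^o.

(* A topology and an additive group law on the same type, with no             *)
(* compatibility required: enough to speak of Borel sets and of translations. *)
Notation preTopologicalZmodType := PreTopologicalZmodule.type.

HB.instance Definition _ (G H : preTopologicalZmodType) :=
  GRing.Zmodule.on (G * H)%type.

(* T with its Borel sigma-algebra; measurable types have to be pointed, hence 0. *)
Definition borel (T : Type) : Type := T.

HB.instance Definition _ (T : preTopologicalZmodType) :=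
  PreTopologicalZmodule.on (borel T).
HB.instance Definition _ (T : preTopologicalZmodType) :=
  isPointed.Build (borel T) 0.
HB.instance Definition _ (T : preTopologicalZmodType) :=
  Measurable.copy (borel T) (g_sigma_algebraType (@open (borel T))).

(* The dual group: continuous characters with pointwise multiplication (written *)
(* additively) and the compact-open topology. *)
Section characters.
Variables (R : realType) (G : topologicalZmodType).

Record character := Character {
  char_val :> G -> R[i];
  char_continuous : continuous char_val;
  char_norm : forall x, normc (char_val x) = 1;
  charD : forall x y, char_val (x + y) = char_val x * char_val y }.

Lemma character_eq (a b : character) : a =1 b -> a = b.
Proof.
case: a b => a ca na Da [b cb nb Db] /= /funext ab; subst b.
by rewrite (Prop_irrelevance ca cb) (Prop_irrelevance na nb)
  (Prop_irrelevance Da Db).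
Qed.

Lemma char_neq0 (a : character) x : a x != 0.
Proof.
apply/eqP => ax0; have := char_norm a x.
by rewrite ax0 normc0 => /eqP; rewrite eq_sym oner_eq0.
Qed.

Let one_cont : continuous (fun _ : G => 1 : R[i]).
Proof. by move=> x; exact: cvg_cst. Qed.
Let one_norm (x : G) : normc (1 : R[i]) = 1. Proof. exact: normc1. Qed.
Let one_mor (x y : G) : 1 = 1 * 1 :> R[i]. Proof. by rewrite mulr1. Qed.
Definition char_zero := Character one_cont one_norm one_mor.

Section add.
Variables a b : character.
Let mul_cont : continuous (fun x => a x * b x).
Proof.
move=> x; apply: (@cvgM R[i]); exact: char_continuous.
Qed.
Let mul_norm x : normc (a x * b x) = 1.
Proof. by rewrite normcM !char_norm mulr1. Qed.
Let mul_mor x y : a (x + y) * b (x + y) = (a x * b x) * (a y * b y).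
Proof. by rewrite !charD mulrACA. Qed.
Definition char_add := Character mul_cont mul_norm mul_mor.
End add.

Section opp.
Variable a : character.
Let inv_cont : continuous (fun x => (a x)^-1).
Proof.
move=> x; apply: (@cvgV R[i]); [exact: char_neq0 | exact: char_continuous].
Qed.
Let inv_norm x : normc (a x)^-1 = 1.
Proof. by rewrite normcV char_norm invr1. Qed.
Let inv_mor x y : (a (x + y))^-1 = (a x)^-1 * (a y)^-1.
Proof. by rewrite charD invfM. Qed.
Definition char_opp := Character inv_cont inv_norm inv_mor.
End opp.

Let char_addA : associative char_add.
Proof. by move=> a b c; apply: character_eq => x /=; rewrite mulrA. Qed.
Let char_addC : commutative char_add.
Proof. by move=> a b; apply: character_eq => x /=; rewrite mulrC. Qed.
Let char_add0 : left_id char_zero char_add.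
Proof. by move=> a; apply: character_eq => x /=; rewrite mul1r. Qed.
Let char_addN : left_inverse char_zero char_opp char_add.
Proof.
by move=> a; apply: character_eq => x /=; rewrite mulVf// char_neq0.
Qed.

HB.instance Definition _ := gen_eqMixin character.
HB.instance Definition _ := gen_choiceMixin character.
HB.instance Definition _ := GRing.isZmodule.Build character
  char_addA char_addC char_add0 char_addN.
HB.instance Definition _ := Topological.copy character
  (initial_topology (char_val : character -> {compact-open, G -> R[i]})).

End characters.


Local Open Scope ereal_scope.

Section measures.
Variable R : realType.

(* Radon measures on a Hausdorff space: finite on compact sets, outer regular on *)
(* Borel sets, inner regular on open sets. *)
Definition radon_measure (T : preTopologicalZmodType)
    (m : {measure set (borel T) -> \bar R}) : Prop :=
  [/\ forall K : set T, compact K -> m K < +oo,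
      forall A : set (borel T), measurable A ->
        m A = ereal_inf [set m U | U in [set U : set T | open U /\ A `<=` U]] &
      forall U : set T, open U ->
        m U = ereal_sup [set m K | K in [set K : set T | compact K /\ K `<=` U]]].

Definition haar_measure (T : preTopologicalZmodType)
    (m : {measure set (borel T) -> \bar R}) : Prop :=
  [/\ radon_measure m,
      m [set: T] != 0 &
      forall (x : T) (A : set (borel T)), measurable A ->
        m [set (x + a)%R | a in A] = m A].

(* For groups that are not sigma-compact the Borel sets of S * T need not be in *)
(* the product of the Borel sigma-algebras: the Radon product is the Radon      *)
(* measure on S * T representing the iterated integral on C_c(S * T). *)
Definition radon_product (S T : preTopologicalZmodType)
    (mS : {measure set (borel S) -> \bar R})
    (mT : {measure set (borel T) -> \bar R})
    (m : {measure set (borel (S * T)) -> \bar R}) : Prop :=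
  radon_measure m /\
  forall phi : S * T -> R, continuous phi ->
    compact (closure [set z | phi z != 0%R]) ->
    \int[m]_z (phi z)%:E = \int[mS]_x \int[mT]_y (phi (x, y))%:E.

Definition cmeasurable (T : preTopologicalZmodType) (f : T -> R[i]) : Prop :=
  measurable_fun [set: borel T] (f : borel T -> borel R[i]).

Definition cintegral (T : preTopologicalZmodType)
    (m : {measure set (borel T) -> \bar R}) (f : T -> R[i]) : R[i] :=
  Complex (\int[m]_x complex.Re (f x))%R (\int[m]_x complex.Im (f x))%R.

Definition cLnorm (T : preTopologicalZmodType)
    (m : {measure set (borel T) -> \bar R}) (p : \bar R) (f : T -> R[i]) : \bar R :=
  Lnorm m p (fun x => (normc (f x))%:E).

End measures.

Section lorentz.
Variables (R : realType) (T : preTopologicalZmodType).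
Variable m : {measure set (borel T) -> \bar R}.
Implicit Types (f : T -> R[i]) (p q : \bar R).

Definition distribution_fun f (a : R) : \bar R := m [set x | (a < normc (f x))%R].

Definition decreasing_rearrangement f (t : R) : \bar R :=
  ereal_inf [set a%:E | a in [set a : R | (0 < a)%R /\ distribution_fun f a <= t%:E]].

(* Meaningful for 0 < p and 0 < q; [fine p^-1] is 1/p, with 1/+oo = 0. *)
Definition lorentz_norm p q f : \bar R :=
  let w t := (t `^ fine p^-1)%:E * decreasing_rearrangement f t in
  match q with
  | r%:E => (\int[lebesgue_measure]_(t in `]0%R, +oo[) ((w t `^ r) * t^-1%:E)) `^ r^-1
  | +oo => ereal_sup [set w t | t in `]0%R, +oo[]
  | -oo => 0
  end.

Definition lorentz_space p q : set (T -> R[i]) :=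
  [set f | cmeasurable f /\ lorentz_norm p q f < +oo].

End lorentz.

Section fourier.
Variables (R : realType) (G : topologicalZmodType).
Variable mu : {measure set (borel G) -> \bar R}.
Local Open Scope ring_scope.
Local Open Scope complex_scope.

Definition fourier (f : G -> R[i]) (xi : character R G) : R[i] :=
  cintegral mu (fun x => f x * (xi x)^*).

Definition translate (x : G) (g : G -> R[i]) : G -> R[i] := fun y => g (y - x).

Definition stft (g f : G -> R[i]) (z : G * character R G) : R[i] :=
  fourier (fun y => f y * (translate z.1 g y)^*) z.2.

Definition plancherel (nu : {measure set (borel (character R G)) -> \bar R}) : Prop :=
  forall f : G -> R[i], cmeasurable f ->
    (cLnorm mu 1 f < +oo)%E -> (cLnorm mu 2%:E f < +oo)%E ->
    cLnorm nu 2%:E (fourier f) = cLnorm mu 2%:E f.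

End fourier.

(* Main.v *)
Require Import Defs.
From HB Require Import structures.
From mathcomp Require Import all_boot all_order all_algebra.
From mathcomp Require Import all_classical all_reals all_analysis.
From mathcomp Require Import complex measurable_realfun.
From mathcomp Require Import ring lra.

(** Write [T] for the bilinear map sending [(f, g)] to the short-time Fourier
transform of [f] with window [g]. Two estimates are immediate. Plancherel's
formula in the dual variable followed by an integration in [x] bounds the L^2 norm
of [T (f, g)] by the product of the L^2 norms. Trivially,
[T (f, g)] is bounded everywhere by the integral of [|f|] against a translate of
[|g|]. The theorem is the real interpolation of these two bounds. With
[1 / p = 1 / 2 + del] (or its mirror image when [2 < p]), the point
[(1 / p, 1 / q)] lies on the segment from [(1 / 2, 1 / 2)], where the first
estimate lives, to a point of the bottom edge, where the second one does. The
assumption [p != 2] says that this segment is not vertical, so that the spaces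
interpolated between are different; the assumption [q' <= p <= q] says that its end
has a first coordinate between 0 and 1.

The interpolation is carried out by hand. Each function is cut along its
decreasing rearrangement ([lorentz_pieces]): the piece [f_j] is bounded by
[f* (2 ^ j)] and lives on a set of measure at most [2 ^ (j + 1)], and the Lorentz
norm controls the l^u norm of the numbers
[phi_j = 2 ^ (j / p') f* (2 ^ j)] ([lorentz_norm_ge]); similarly for [g] with
[gamma_k]. For a pair of pieces the two estimates read
[phi_j gamma_k 2 ^ (del (j - k))] in L^2 ([stft_L2_compact]) and
[phi_j gamma_k 2 ^ (- lam (j - k))] in sup norm ([stft_le]), up to constants.
Splitting the double sum at a value [N] of [j - k] bounds the rearrangement of
[T (f, g)] at the height [2 ^ (lam q N)], and the resulting samples are the
convolution of a summable sequence with the convolution of [phi] and [gamma]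
([interpolation]). Young's inequality ([young_int]) puts them in l^w under the
assumption on [u], [v] and [w], and [lorentz_norm_le] converts this back into
a bound of the Lorentz norm.

On a general locally compact group Borel sets of a product may escape the
product sigma-algebra, and the Radon product is known only through compactly supported
continuous functions. Two devices deal with this. The transforms of the pieces,
and then [T (f, g)] as their uniform limit, are continuous, so superlevel sets are
open and their measure is a supremum over compact subsets: L^2 bounds are needed
on compact sets only, where cutoff functions built from the Haar measures
([compact_cutoff]) reduce the Radon product to an iterated integral. The exchange
of the two integrations over the group is replaced by a discretization
([integral_shiftI_le_eps]). *)

Set Implicit Arguments.
Unset Strict Implicit.
Unset Printing Implicit Defensive.

Import Order.TTheory GRing.Theory Num.Theory.
Import numFieldNormedType.Exports.
Import ComplexField.Normc.

Local Open Scope classical_set_scope.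
Local Open Scope ring_scope.

(** * Integrals of arbitrary nonnegative functions, complex-valued functions *)

Section nonmeasurable_integral.
Import HBNNSimple.
Local Open Scope ereal_scope.
Context d (T : measurableType d) (R : realType) (mu : {measure set T -> \bar R}).

(** The integral of a nonnegative function is a supremum over the simple
functions below it, hence monotone on arbitrary functions. It serves to compare
iterated integrals, whose inner integral depends on the outer variable in a way
that is not controlled by a product sigma-algebra. *)
Lemma ge0_le_integral_nomeas (D : set T) (f g : T -> \bar R) :
  (forall x, D x -> 0 <= f x) -> (forall x, D x -> f x <= g x) ->
  \int[mu]_(x in D) f x <= \int[mu]_(x in D) g x.
Proof.
move=> f0 fg; rewrite !ge0_integralE//; last first.
  by move=> x Dx; apply: le_trans (fg x Dx); exact: f0.
apply: ereal_sup_le => _ [h hf <-].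
exists h => // x; apply: le_trans (hf x) _.
by rewrite /patch; case: ifPn => //; rewrite inE => /fg.
Qed.

End nonmeasurable_integral.

Section complex_numbers.
Variable R : realType.
Implicit Types z w : R[i].

Lemma normc_Re z : `|complex.Re z| <= normc z.
Proof.
by case: z => a b /=; rewrite -sqrtr_sqr ler_wsqrtr// lerDl sqr_ge0.
Qed.

Lemma normc_Im z : `|complex.Im z| <= normc z.
Proof.
by case: z => a b /=; rewrite -sqrtr_sqr ler_wsqrtr// lerDr sqr_ge0.
Qed.

Lemma normc_le_ReIm z : normc z <= `|complex.Re z| + `|complex.Im z|.
Proof.
case: z => a b /=.
rewrite -[leRHS]ger0_norm ?addr_ge0// -sqrtr_sqr ler_wsqrtr//.
rewrite sqrrD !real_normK ?num_real// addrAC lerDl.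
by rewrite mulrn_wge0// mulr_ge0.
Qed.

Lemma normc_ge0 z : 0 <= normc z.
Proof. by case: z => a b; rewrite /= sqrtr_ge0. Qed.

Lemma normc_normE z : `|z| = (normc z)%:C%C :> R[i].
Proof. by case: z. Qed.

Lemma normc_triangle z w : normc (z + w) <= normc z + normc w.
Proof. by have := ler_normD z w; rewrite !normc_normE -rmorphD lecR. Qed.

Lemma normc_sub z w : normc (z - w) = normc (w - z).
Proof. by have := distrC z w; rewrite !normc_normE => -[]. Qed.

Lemma normc_conj z : normc z^*%C = normc z.
Proof. by case: z => a b /=; rewrite sqrrN. Qed.


(** The norm of [R[i]] takes values in [R[i]]; neighbourhoods are described
here through the real modulus, which is what every estimate below produces. *)
Lemma nbhs_complexP z (A : set R[i]) :
  nbhs z A <-> exists2 e : R, 0 < e & forall w, normc (w - z) < e -> A w.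
Proof.
split.
  move=> /(@nbhs_ballP _ R[i]^o)[/= e e0 zA].
  have /complex_realP[r re] : e \is Num.real by rewrite realE ltW.
  exists r; first by move: e0; rewrite re ltcR.
  move=> w wz; apply: zA; rewrite /ball/= distrC normc_normE re.
  by rewrite ltcR.
move=> [e e0 eA]; apply/(@nbhs_ballP _ R[i]^o); exists (e%:C%C) => /=.
  by rewrite ltcR.
by move=> w; rewrite /ball/= distrC normc_normE ltcR => /eA.
Qed.

Lemma cvg_complexP (T : Type) (F : set_system T) (FF : Filter F)
    (f : T -> R[i]) z :
  f @ F --> z <-> forall e : R, 0 < e -> \forall x \near F, normc (f x - z) < e.
Proof.
split=> [fz e e0|fz A /nbhs_complexP[e e0 eA]].
  have /fz : nbhs z [set w | normc (w - z) < e] by apply/nbhs_complexP; exists e.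
  exact.
by have := fz e e0; apply: filterS => x /eA.
Qed.

Lemma normcB_le z w : `|normc z - normc w| <= normc (z - w).
Proof.
rewrite ler_norml; apply/andP; split.
  have := normc_triangle (w - z) z; rewrite subrK normc_sub; lra.
have := normc_triangle (z - w) w; rewrite subrK; lra.
Qed.

Lemma Re_continuous : continuous (@complex.Re R : R[i] -> R).
Proof.
move=> z; apply/(@cvgrPdist_lt _ _ _ _ (nbhs_filter (z : R[i]))) => e e0; apply/nbhs_complexP; exists e => // w.
by apply: le_lt_trans; rewrite normc_sub -raddfB normc_Re.
Qed.

Lemma Im_continuous : continuous (@complex.Im R : R[i] -> R).
Proof.
move=> z; apply/(@cvgrPdist_lt _ _ _ _ (nbhs_filter (z : R[i]))) => e e0; apply/nbhs_complexP; exists e => // w.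
by apply: le_lt_trans; rewrite normc_sub -raddfB normc_Im.
Qed.

Lemma normc_continuous : continuous (@normc R : R[i] -> R).
Proof.
move=> z; apply/(@cvgrPdist_lt _ _ _ _ (nbhs_filter (z : R[i]))) => e e0; apply/nbhs_complexP; exists e => // w.
by apply: le_lt_trans; rewrite normc_sub normcB_le.
Qed.

End complex_numbers.

Section borel_measurability.
Variable R : realType.

Lemma open_borel (T : preTopologicalZmodType) (A : set T) :
  open A -> measurable (A : set (borel T)).
Proof. by move=> oA; apply: sub_sigma_algebra. Qed.

Lemma closed_borel (T : preTopologicalZmodType) (A : set T) :
  closed A -> measurable (A : set (borel T)).
Proof.
move=> cA; rewrite -[A]setCK; apply: measurableC; apply: open_borel.
exact: closed_openC.
Qed.

Lemma compact_borel (T : preTopologicalZmodType) (A : set T) :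
  hausdorff_space T -> compact A -> measurable (A : set (borel T)).
Proof. by move=> hT cA; apply: closed_borel; exact: compact_closed. Qed.

Lemma continuous_borel (S T : preTopologicalZmodType) (f : S -> T) :
  continuous f -> measurable_fun [set: borel S] (f : borel S -> borel T).
Proof.
move=> cf; apply: (@measurability _ _ _ _ _ _ (@open (borel T))) => //.
move=> _ [B oB <-]; rewrite setTI; apply: open_borel.
by apply: open_comp => // x _; exact: cf.
Qed.

Lemma continuous_borel_real (S : preTopologicalZmodType) (f : S -> R) :
  continuous f -> measurable_fun [set: borel S] (f : borel S -> R).
Proof.
move=> cf; apply: (@measurability _ _ _ _ _ _ (@RGenOInfty.G R)).
  exact: RGenOInfty.measurableE.
move=> _ [_ [x ->] <-]; rewrite setTI; apply: open_borel.
by apply: open_comp => [y _|]; [exact: cf|exact: itv_open_ends_open].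
Qed.

(** [R[i]] is second countable: an open set is the union of the boxes with
rational centre and radius that it contains, and the preimage of a box is
measurable as soon as the real and imaginary parts are. *)
Lemma cmeasurableP (T : preTopologicalZmodType) (f : T -> R[i]) :
  cmeasurable f <->
  measurable_fun [set: borel T] (fun x : borel T => complex.Re (f x)) /\
  measurable_fun [set: borel T] (fun x : borel T => complex.Im (f x)).
Proof.
split.
  move=> mf; split.
    by apply: measurableT_comp mf; exact: continuous_borel_real (@Re_continuous R).
  by apply: measurableT_comp mf; exact: continuous_borel_real (@Im_continuous R).
move=> [mRe mIm].
apply: (@measurability _ _ _ _ _ _ (@open (borel R[i]))) => //.
move=> _ [B oB <-]; rewrite setTI.
pose Q (x : rat * rat * rat) := [set z : R[i] |
  `|complex.Re z - ratr x.1.1| < ratr x.2 /\ `|complex.Im z - ratr x.1.2| < ratr x.2].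
have -> : f @^-1` B = \bigcup_(x in [set x | Q x `<=` B]) (f @^-1` Q x).
  apply/seteqP; split => [t Bt|t [x xB] /=]; last exact: xB.
  have /nbhs_complexP[e e0 eB] : nbhs (f t) B by apply: open_nbhs_nbhs; split.
  have [r] : exists r : rat, ratr r \in `]0, (e / 4)%R[.
    by apply: rat_in_itvoo; rewrite divr_gt0.
  rewrite in_itv/= => /andP[r0 re].
  have [a] : exists a : rat, ratr a \in `](complex.Re (f t) - ratr r), (complex.Re (f t) + ratr r)[.
    by apply: rat_in_itvoo; lra.
  have [b] : exists b : rat, ratr b \in `](complex.Im (f t) - ratr r), (complex.Im (f t) + ratr r)[.
    by apply: rat_in_itvoo; lra.
  rewrite !in_itv/= => /andP[b1 b2] /andP[a1 a2].
  exists (a, b, r); last first.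
    by split => /=; rewrite ltr_norml; apply/andP; split; lra.
  move=> z [/= za zb]; apply: eB.
  apply: le_lt_trans (normc_le_ReIm _) _; rewrite !raddfB/=.
  have h1 : `|complex.Re z - complex.Re (f t)| < e / 2.
    by move: za; rewrite !ltr_norml => /andP[? ?]; apply/andP; split; lra.
  have h2 : `|complex.Im z - complex.Im (f t)| < e / 2.
    by move: zb; rewrite !ltr_norml => /andP[? ?]; apply/andP; split; lra.
  lra.
rewrite bigcup_mkcond; apply: countable_bigcupT_measurable; first exact: countableP.
move=> x; case: ifP => // _.
have -> : f @^-1` Q x =
   (fun t : borel T => `|complex.Re (f t) - ratr x.1.1|) @^-1` `]-oo, ratr x.2[ `&`
   (fun t : borel T => `|complex.Im (f t) - ratr x.1.2|) @^-1` `]-oo, ratr x.2[.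
  by apply/seteqP; split => t /=; rewrite !in_itv/=.
apply: measurableI; rewrite -[X in measurable X]setTI.
- have : measurable_fun [set: borel T] (fun t : borel T => `|complex.Re (f t) - ratr x.1.1|).
    by apply: measurableT_comp => //; exact: measurable_funB.
  by apply; [exact: measurableT|exact: measurable_itv].
- have : measurable_fun [set: borel T] (fun t : borel T => `|complex.Im (f t) - ratr x.1.2|).
    by apply: measurableT_comp => //; exact: measurable_funB.
  by apply; [exact: measurableT|exact: measurable_itv].
Qed.

Lemma cmeasurable_continuous (T : preTopologicalZmodType) (f : T -> R[i]) :
  continuous f -> cmeasurable f.
Proof. exact: continuous_borel. Qed.

Lemma cmeasurableM (T : preTopologicalZmodType) (f g : T -> R[i]) :
  cmeasurable f -> cmeasurable g -> cmeasurable (fun x => f x * g x).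
Proof.
move=> /cmeasurableP[f1 f2] /cmeasurableP[g1 g2]; apply/cmeasurableP; split.
  rewrite (_ : (fun x => _) = (fun x : borel T =>
    complex.Re (f x) * complex.Re (g x) - complex.Im (f x) * complex.Im (g x))).
    by apply: measurable_funB; exact: measurable_funM.
  by apply/funext => x; case: (f x) (g x) => a b [c d'].
rewrite (_ : (fun x => _) = (fun x : borel T =>
  complex.Re (f x) * complex.Im (g x) + complex.Im (f x) * complex.Re (g x))).
  by apply: measurable_funD; exact: measurable_funM.
by apply/funext => x; case: (f x) (g x) => a b [c d'].
Qed.

Lemma cmeasurable_conj (T : preTopologicalZmodType) (f : T -> R[i]) :
  cmeasurable f -> cmeasurable (fun x => ((f x)^*)%C).
Proof.
move=> /cmeasurableP[f1 f2]; apply/cmeasurableP; split.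
  by rewrite (_ : (fun x => _) = (fun x : borel T => complex.Re (f x)))//;
    apply/funext => x; case: (f x).
rewrite (_ : (fun x => _) = (fun x : borel T => - complex.Im (f x))).
  exact: measurable_funN.
by apply/funext => x; case: (f x).
Qed.

Lemma cmeasurable_indic (T : preTopologicalZmodType) (A : set T) :
  measurable (A : set (borel T)) -> cmeasurable (fun x => (\1_A x)%:C%C : R[i]).
Proof.
move=> mA; apply/cmeasurableP; split => //=.
exact: measurable_indic.
Qed.

Lemma measurable_normc (T : preTopologicalZmodType) (f : T -> R[i]) :
  cmeasurable f -> measurable_fun [set: borel T] (fun x : borel T => normc (f x)).
Proof.
move=> mf; apply: (measurableT_comp _ mf).
exact: continuous_borel_real (@normc_continuous R).
Qed.

End borel_measurability.

(** * Translations and Radon measures on abelian groups *)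

Lemma integral_step d (X : measurableType d) (R : realType)
    (mu : {measure set X -> \bar R}) (D : set X) n (r : nat -> R) (E : nat -> set X) :
  measurable D -> (forall i, 0 <= r i) -> (forall i, measurable (E i)) ->
  (\int[mu]_(x in D) (\sum_(i < n) ((r i)%:E * (\1_(E i) x)%:E)) =
   \sum_(i < n) (r i)%:E * mu (E i `&` D))%E.
Proof.
move=> mD r0 mE; have mi i : measurable_fun D (fun x => (\1_(E i) x : R)%:E).
  by apply/measurable_EFinP; exact: measurable_indic.
rewrite ge0_integral_sum//.
- by apply: eq_bigr => i _; rewrite ge0_integralZl_EFin// integral_indic.
- by move=> i; exact: measurable_funeM.
- by move=> i x _; rewrite mule_ge0// lee_fin.
Qed.

Section radon_groups.
Variables (R : realType) (T : topologicalZmodType).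
Variable m : {measure set (borel T) -> \bar R}.
Hypothesis hT : hausdorff_space T.
Hypothesis mR : radon_measure m.
Hypothesis mI : forall (x : T) (A : set (borel T)), measurable A ->
  m [set (x + a)%R | a in A] = m A.
Implicit Types (A B K U : set T) (x y z : T).

Definition shift x A : set T := [set y | A (y - x)].

Lemma shift_image x A : shift x A = [set (x + a)%R | a in A].
Proof.
apply/seteqP; split => [y Ay|_ [a Aa <-]].
  by exists (y - x) => //; rewrite addrC subrK.
by rewrite /shift/= [x + a]addrC addrK.
Qed.

Lemma subr_continuous x : continuous (fun y : T => y - x).
Proof.
move=> y; apply: (@continuous_comp _ _ _ (fun y => (y, x)) (fun x : T * T => x.1 - x.2)).
  by apply: cvg_pair => /=; [exact: cvg_id|exact: cvg_cst].
exact: sub_continuous.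
Qed.

Lemma measurable_shift x A :
  measurable (A : set (borel T)) -> measurable (shift x A : set (borel T)).
Proof.
move=> mA; have mf := continuous_borel (@subr_continuous x).
by have := mf measurableT _ mA; rewrite setTI.
Qed.

Lemma measure_shift x A : measurable (A : set (borel T)) -> m (shift x A) = m A.
Proof. by move=> mA; rewrite shift_image mI. Qed.

Lemma open_shift x U : open U -> open (shift x U).
Proof. by move=> oU; apply: open_comp => // y _; exact: subr_continuous. Qed.

Lemma near_compact_add K U : compact K -> open U -> K `<=` U ->
  \forall x \near (0 : T), forall k, K k -> U (k + x).
Proof.
move=> /compact_near_coveringP cK oU KU.
have := cK T (nbhs (0 : T)) (fun x k => U (k + x)) _.
apply=> k Kk.
have : U (k + 0) by rewrite addr0; exact: KU.
move=> Uk; have /= := @add_continuous T (k, 0).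
by apply; apply: open_nbhs_nbhs; split.
Qed.

Lemma radon_outer_lt A (c : \bar R) : measurable (A : set (borel T)) ->
  (m A < c)%E -> exists U, [/\ open U, A `<=` U & (m U < c)%E].
Proof.
move=> mA Ac; have [_ /(_ A mA) mO _] := mR.
by move: Ac; rewrite mO => /ereal_inf_lt[_ [U [oU AU] <-]] UA; exists U.
Qed.

Lemma radon_outer A (e : R) : measurable (A : set (borel T)) -> (m A < +oo)%E ->
  0 < e -> exists U, [/\ open U, A `<=` U & (m (U `\` A) < e%:E)%E].
Proof.
move=> mA Afin e0; have Af : m A \is a fin_num by rewrite ge0_fin_numE.
have [|U [oU AU UA]] := @radon_outer_lt A (m A + e%:E) mA.
  by rewrite lteDl// lte_fin.
have mU := @open_borel _ _ oU.
exists U; split => //.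
rewrite measureD//; last by apply: lt_trans UA _; rewrite -(fineK Af) -EFinD ltry.
by rewrite setIidr// lteBlDl.
Qed.

Lemma radon_inner_open U (e : R) : open U -> (m U < +oo)%E ->
  0 < e -> exists K, [/\ compact K, K `<=` U & (m (U `\` K) < e%:E)%E].
Proof.
move=> oU Ufin e0; have [_ _ /(_ U oU) mO] := mR.
have Uf : m U \is a fin_num by rewrite ge0_fin_numE.
have : (m U - e%:E < m U)%E by rewrite lteBlDr// lteDl// lte_fin.
rewrite {2}mO => /ereal_sup_gt[_ [K [cK KU] <-]] UK.
have mK := @compact_borel _ _ hT cK.
have mU := @open_borel _ _ oU.
exists K; split => //.
rewrite measureD// setIidr// lteBlDl; last first.
  by rewrite ge0_fin_numE//; apply: le_lt_trans Ufin; apply: le_measure => //; rewrite inE.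
by rewrite -lteBlDr.
Qed.

(** Inside an open [U] containing [A], take a compact [K] of almost full
measure and remove from it a small open neighbourhood [W] of [U `\` A]: what is
left of [K] is compact and contained in [A]. *)
Lemma radon_inner A (e : R) : measurable (A : set (borel T)) -> (m A < +oo)%E ->
  0 < e -> exists K, [/\ compact K, K `<=` A & (m (A `\` K) < e%:E)%E].
Proof.
move=> mA Afin e0; have e20 : 0 < e / 2 by rewrite divr_gt0.
have [U [oU AU UA]] := radon_outer mA Afin e20.
have mU := @open_borel _ _ oU.
have Ufin : (m U < +oo)%E.
  rewrite -(setDUK AU) measureU//; [|exact: measurableD|by rewrite setDIK].
  by rewrite lte_add_pinfty//; apply: lt_trans UA _; rewrite ltry.
have [K [cK KU UK]] := radon_inner_open oU Ufin e20.
have mK := @compact_borel _ _ hT cK.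
have mUA : measurable ((U `\` A) : set (borel T)) by exact: measurableD.
have [W [oW UAW We]] := radon_outer_lt mUA UA.
have mW := @open_borel _ _ oW.
have cKW : compact (K `\` W).
  by rewrite setDE; apply: compact_closedI => //; exact: open_closedC.
exists (K `\` W); split => //.
  by move=> x [Kx nWx]; apply: contrapT => nAx; apply/nWx/UAW; split => //; exact: KU.
apply: (@le_lt_trans _ _ (m ((U `\` K) `|` W))).
  apply: le_measure; rewrite ?inE.
  - by apply: measurableD => //; exact: measurableD.
  - by apply: measurableU => //; exact: measurableD.
  - move=> x [Ax nKW]; have [Kx|nKx] := pselect (K x).
      by right; apply: contrapT => nWx; exact: nKW.
    by left; split => //; exact: AU.
apply: le_lt_trans (measureU2 _ _ _) _ => //; first exact: measurableD.
by rewrite [e in e%:E](_ : _ = e / 2 + e / 2) ?EFinD ?lteD//; lra.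
Qed.

(** By compactness [K] stays inside a given open neighbourhood under small
translations, and outer regularity makes that neighbourhood almost as small as
[K]. *)
Lemma near_shiftD_compact K (e : R) : compact K -> 0 < e ->
  \forall x \near (0 : T), (m (shift x K `\` K) < e%:E)%E.
Proof.
move=> cK e0; have mK := @compact_borel _ _ hT cK.
have [Kfin _ _] := mR.
have [U [oU KU UK]] := radon_outer mK (Kfin _ cK) e0.
have := near_compact_add cK oU KU; apply: filterS => x Kx.
apply: le_lt_trans UK; apply: le_measure; rewrite ?inE.
- by apply: measurableD => //; exact: measurable_shift.
- by apply: measurableD => //; exact: open_borel.
- by move=> y [/Kx]; rewrite subrK => Uy nKy.
Qed.

Lemma near_shiftD A (e : R) : measurable (A : set (borel T)) -> (m A < +oo)%E ->
  0 < e -> \forall x \near (0 : T), (m (shift x A `\` A) < e%:E)%E.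
Proof.
move=> mA Afin e0; have e20 : 0 < e / 2 by rewrite divr_gt0.
have [K [cK KA AK]] := radon_inner mA Afin e20.
have mK := @compact_borel _ _ hT cK.
have := near_shiftD_compact cK e20; apply: filterS => x Kx.
have mAK : measurable (A `\` K : set (borel T)) by exact: measurableD.
have mKx : measurable (shift x K `\` K : set (borel T)).
  by apply: measurableD => //; exact: measurable_shift.
apply: (@le_lt_trans _ _ (m ((shift x K `\` K) `|` shift x (A `\` K)))).
  apply: le_measure; rewrite ?inE.
  - by apply: measurableD => //; exact: measurable_shift.
  - by apply: measurableU => //; exact: measurable_shift.
  - move=> y [Ay nAy]; have [Ky|nKy] := pselect (K (y - x)); [left|right].
      by split=> // /KA.
    by split.
apply: le_lt_trans (measureU2 _ _ _) _ => //; first exact: measurable_shift.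
have hs : (m (shift x (A `\` K)) < (e / 2)%:E)%E by rewrite measure_shift.
have -> : e = e / 2 + e / 2 by lra.
by rewrite EFinD; exact: lteD.
Qed.

(** Translation is continuous for the measure of symmetric differences. The
second half follows from the first since [A `\` (A + x)] is the translate by [x]
of [(A - x) `\` A]. *)
Lemma near_shift_symdiff A (e : R) : measurable (A : set (borel T)) -> (m A < +oo)%E ->
  0 < e -> \forall x \near (0 : T),
    (m (shift x A `\` A) < e%:E)%E /\ (m (A `\` shift x A) < e%:E)%E.
Proof.
move=> mA Afin e0; have h := near_shiftD mA Afin e0.
have hN : \forall x \near (0 : T), (m (shift (- x)%R A `\` A) < e%:E)%E.
  by have := @opp_continuous T 0; rewrite /continuous_at oppr0 => /(_ _ h).
near=> x; split; first by near: x.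
have -> : A `\` shift x A = shift x (shift (- x) A `\` A).
  by apply/seteqP; split => y; rewrite /shift/= opprK subrK.
rewrite measure_shift; first by near: x.
by apply: measurableD => //; exact: measurable_shift.
Unshelve. all: by end_near. Qed.

Hypothesis m0 : m [set: borel T] != 0%E.

Lemma compact_pos : exists2 K, compact K & (0 < m K)%E.
Proof.
have [_ _ /(_ setT openT) mO] := mR.
have : (0 < m [set: borel T])%E by rewrite lt0e m0 measure_ge0.
by rewrite mO => /ereal_sup_gt[_ [K [cK _] <-]] K0; exists K.
Qed.

Lemma compact_add K L : compact K -> compact L ->
  compact [set z | exists x y, [/\ K x, L y & z = x + y]].
Proof.
move=> cK cL.
have -> : [set z | exists x y, [/\ K x, L y & z = x + y]] =
  (fun x : T * T => x.1 + x.2) @` (K `*` L).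
  apply/seteqP; split => [z [x [y [Kx Ly ->]]]|z [[x y] [/= Kx Ly] <-]].
    by exists (x, y).
  by exists x, y.
apply: continuous_compact; last exact: compact_setX.
by apply: continuous_subspaceT; exact: add_continuous.
Qed.

Lemma compact_sub K L : compact K -> compact L ->
  compact [set z | exists x y, [/\ K x, L y & z = x - y]].
Proof.
move=> cK cL.
have -> : [set z | exists x y, [/\ K x, L y & z = x - y]] =
  (fun x : T * T => x.1 - x.2) @` (K `*` L).
  apply/seteqP; split => [z [x [y [Kx Ly ->]]]|z [[x y] [/= Kx Ly] <-]].
    by exists (x, y).
  by exists x, y.
apply: continuous_compact; last exact: compact_setX.
by apply: continuous_subspaceT; exact: sub_continuous.
Qed.

Lemma near_subr (P : T -> Prop) x : (\forall y \near (0 : T), P y) ->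
  \forall y \near x, P (y - x).
Proof. by move=> h; have := @subr_continuous x x; rewrite /continuous_at subrr => /(_ _ h). Qed.

Lemma shiftB x y A : shift y (shift x A) = shift (x + y) A.
Proof. have e z : z - (x + y) = z - y - x by rewrite opprD addrCA addrC.
by apply/seteqP; split => z /=; rewrite /shift/mkset/= e. Qed.

Lemma near_shift_symdiff_at A (e : R) x : measurable (A : set (borel T)) ->
  (m A < +oo)%E -> 0 < e -> \forall y \near x,
    (m (shift y A `\` shift x A) < e%:E)%E /\ (m (shift x A `\` shift y A) < e%:E)%E.
Proof.
move=> mA Afin e0; have := near_subr x (near_shift_symdiff mA Afin e0).
apply: filterS => y.
have mS z : measurable (shift z A `\` A : set (borel T)).
  by apply: measurableD => //; exact: measurable_shift.
have mS' z : measurable (A `\` shift z A : set (borel T)).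
  by apply: measurableD => //; exact: measurable_shift.
rewrite -(measure_shift x (mS _)) -(measure_shift x (mS' _)).
have sD (P Q : set T) : shift x (P `\` Q) = shift x P `\` shift x Q by [].
by rewrite !sD !shiftB subrK.
Qed.

Lemma shiftI_continuous A B : measurable (A : set (borel T)) ->
  measurable (B : set (borel T)) -> (m B < +oo)%E ->
  continuous (fun x => fine (m (shift x B `&` A)) : R).
Proof.
move=> mA mB Bfin x; apply/cvgrPdist_le => e e0.
have mS z := measurable_shift z mB.
have fin z : m (shift z B `&` A) \is a fin_num.
  rewrite ge0_fin_numE//; apply: le_lt_trans Bfin; rewrite -(measure_shift z mB).
  by apply: le_measure; rewrite ?inE//; exact: measurableI.
have key y z : (m (shift y B `\` shift z B) < e%:E)%E ->
    fine (m (shift y B `&` A)) <= fine (m (shift z B `&` A)) + e.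
  move=> yz; rewrite -lee_fin EFinD !fineK//.
  apply: (@le_trans _ _ (m ((shift z B `&` A) `|` (shift y B `\` shift z B)))).
    apply: le_measure; rewrite ?inE.
    - exact: measurableI.
    - by apply: measurableU; [exact: measurableI|exact: measurableD].
    - move=> t [Bt At]; have [Zt|nZt] := pselect (shift z B t); first by left.
      by right.
  apply: le_trans (measureU2 _ _ _) _; [exact: measurableI|exact: measurableD|].
  by rewrite leeD2l// ltW.
have := near_shift_symdiff_at x mB Bfin e0; apply: filterS => y [h1 h2].
have := key _ _ h1; have := key _ _ h2; rewrite ler_norml => ? ?.
by apply/andP; split; lra.
Qed.

(** The measure itself provides the cutoff functions: if [K0] is compact of
positive measure, then [x |-> m ((x + K0) `&` (K + K0)) / m K0] is continuous,
equals 1 on [K] and vanishes outside the compact set [K + K0 - K0]. This applies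
to the group and to its dual alike. *)
Lemma compact_cutoff K : compact K -> exists a : T -> R,
  [/\ continuous a, forall x, 0 <= a x <= 1, forall x, K x -> a x = 1 &
    exists2 L, compact L & forall x, ~ L x -> a x = 0].
Proof.
move=> cK; have [K0 cK0 K0pos] := compact_pos.
have [Rfin _ _] := mR.
have mK0 := @compact_borel _ _ hT cK0.
pose D := [set z | exists x y, [/\ K x, K0 y & z = x + y]].
have cD : compact D by exact: compact_add.
have mD := @compact_borel _ _ hT cD.
have mS z := measurable_shift z mK0.
have K0fin := Rfin _ cK0.
have K0f : m K0 \is a fin_num by rewrite ge0_fin_numE.
have c0 : 0 < fine (m K0) by rewrite fine_gt0// K0pos.
have fin z : m (shift z K0 `&` D) \is a fin_num.
  rewrite ge0_fin_numE//; apply: le_lt_trans K0fin; rewrite -(measure_shift z mK0).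
  by apply: le_measure; rewrite ?inE//; exact: measurableI.
exists (fun x => fine (m (shift x K0 `&` D)) / fine (m K0)); split.
- move=> x; apply: cvgM; last exact: cvg_cst.
  exact: shiftI_continuous.
- move=> x; rewrite divr_ge0 ?fine_ge0//= ler_pdivrMr// mul1r fine_le//.
  rewrite -[in leRHS](measure_shift x mK0).
  by apply: le_measure; rewrite ?inE//; exact: measurableI.
- move=> x Kx; rewrite setIidl ?measure_shift ?divff ?gt_eqF//.
  by move=> y K0y; exists x, (y - x); split => //; rewrite addrC subrK.
exists [set z | exists x y, [/\ D x, K0 y & z = x - y]]; first exact: compact_sub.
move=> x nx; rewrite (_ : shift x K0 `&` D = set0) ?measure0 ?mul0r//.
apply/seteqP; split => // y [K0y Dy]; apply: nx; exists y, (y - x); split => //.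
by rewrite opprB addrC subrK.
Qed.

Lemma compact_translate_partition K (V : set T) : compact K -> open V -> V 0 ->
  exists n (s : nat -> T) (E : nat -> set T),
  [/\ forall i, measurable (E i : set (borel T)),
      forall i x, E i x -> V (x - s i), trivIset setT E,
      forall i, E i `<=` K & K `<=` \bigcup_(i < n) E i].
Proof.
move=> cK oV V0; have mK := @compact_borel _ _ hT cK.
have : @cover_compact T K.
  by have := congr1 (fun P : set T -> Prop => P K) (@compact_cover (borel T)) => /= <-.
move=> /(_ T K (fun x => shift x V)) [x _|x Kx|D' D'K KD].
- exact: open_shift.
- by exists x => //; rewrite /shift/= subrr.
pose l := finmap.enum_fset D'.
pose F i : set T := K `&` shift (nth 0 l i) V.
have mF i : measurable (F i : set (borel T)).
  by apply: measurableI => //; apply: open_borel; exact: open_shift.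
exists (size l), (nth 0 l), (seqDU F); split.
- by move=> i; apply: measurableD => //; apply: bigsetU_measurable => j _; exact: mF.
- by move=> i x [[_ ?] _].
- exact: trivIset_seqDU.
- by move=> i x [[]].
move=> x Kx; have [y /= yD yx] := KD _ Kx.
rewrite bigcup_mkord -bigsetU_seqDU -bigcup_mkord.
exists (index y l) => /=; first by rewrite index_mem.
by split => //; rewrite nth_index.
Qed.

(** Both sides are iterated integrals of [1_A (y + x) 1_B (y)], taken in the
two possible orders. This function of two variables need not be measurable for the
product of the Borel sigma-algebras, so the variable [x] is discretized: [K] is
cut into finitely many cells [E i] lying in translates [s i + V] of a small open
set. On such a cell [A] can be replaced by a slightly larger open set [U] frozen at [s i], and the
finite sum over the cells commutes with the integral over [B]. For fixed [z], the
cells with [z + s i] in [U] lie in [W - z], where [W] is a neighbourhood of the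
compact core of [A] of almost the same measure; this bounds the total measure of
those cells by [m W]. *)
Lemma integral_shiftI_le_eps K A B (e : R) : compact K ->
  measurable (A : set (borel T)) -> measurable (B : set (borel T)) ->
  (m A < +oo)%E -> (m B < +oo)%E -> 0 < e ->
  (\int[m]_(x in (K : set (borel T))) m (shift x B `&` A) <=
   (m A + e%:E) * m B + e%:E * m K)%E.
Proof.
move=> cK mA mB Afin Bfin e0; have mK := @compact_borel _ _ hT cK.
have [A' [cA' A'A AA']] := radon_inner mA Afin e0.
have mA' := @compact_borel _ _ hT cA'.
have A'lt : (m A' < m A + e%:E)%E.
  apply: (@le_lt_trans _ _ (m A)); first by apply: le_measure; rewrite ?inE.
  by rewrite lteDl ?lte_fin// ge0_fin_numE.
have [W [oW A'W WA]] := radon_outer_lt mA' A'lt.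
have mW := @open_borel _ _ oW.
have nW := near_compact_add cA' oW A'W.
have := @sub_continuous T (0, 0); rewrite /continuous_at/= subrr => /(_ _ nW).
move=> -[[P1 P2] /= [P10 P20] PW].
pose V := interior (P1 `&` P2).
have oV : open V by exact: open_interior.
have V0 : V 0 by apply: nbhs_singleton; apply: nbhs_interior; exact: filterI.
have VP v : V v -> P1 v /\ P2 v by move=> /interior_subset.
pose U := [set u | exists2 v, V v & A' (u + v)].
have oU : open U.
  have -> : U = \bigcup_(a in A') ((fun u => a - u) @^-1` V).
    apply/seteqP; split => [u [v Vv A'uv]|u [a A'a Vau]].
      by exists (u + v) => //=; rewrite addrC addKr.
    by exists (a - u) => //; rewrite addrC subrK.
  apply: bigcup_open => a _; apply: open_comp => // u _.
  apply: (@continuous_comp _ _ _ (fun u => (a, u)) (fun x : T * T => x.1 - x.2)).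
    by apply: cvg_pair => /=; [exact: cvg_cst|exact: cvg_id].
  exact: sub_continuous.
have mU := @open_borel _ _ oU.
have [n [s [E [mE EV tE EK KE]]]] := compact_translate_partition cK oV V0.
pose S i := shift (- s i) U.
have mS i : measurable (S i : set (borel T)) by exact: measurable_shift.
pose c i := m (S i `&` B).
have cB i : (c i <= m B)%E by apply: le_measure; rewrite ?inE//; exact: measurableI.
have cf i : c i \is a fin_num by rewrite ge0_fin_numE//; exact: le_lt_trans Bfin.
pose r i := fine (c i) + e.
have r0 i : 0 <= r i by apply: addr_ge0; [apply: fine_ge0; exact: measure_ge0|exact: ltW].
have Efin i : m (E i) \is a fin_num.
  rewrite ge0_fin_numE//; have [Kfin _ _] := mR; apply: le_lt_trans (Kfin _ cK).
  by apply: le_measure; rewrite ?inE//; exact: EK.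
(* Freeze x at the centre s i of its cell: A moves inside the open set U. *)
have step x : K x -> (m (shift x B `&` A) <=
    \sum_(i < n) ((r i)%:E * (\1_(E i) x)%:E))%E.
  move=> /KE[i /= ni Ex]; rewrite (bigD1 (Ordinal ni))//= indicE mem_set// mule1.
  apply: (@le_trans _ _ (r i)%:E); last first.
    by rewrite leeDl// sume_ge0// => j _; rewrite mule_ge0 ?lee_fin.
  have mSB := measurable_shift x mB.
  apply: (@le_trans _ _ (m ((shift x B `&` A') `|` (A `\` A')))).
    apply: le_measure; rewrite ?inE.
    - exact: measurableI.
    - by apply: measurableU; [exact: measurableI|exact: measurableD].
    - move=> t [Bt At]; have [A't|nA't] := pselect (A' t); first by left.
      by right.
  suff hm : (m (shift x B `&` A') <= c i)%E.
    apply: le_trans (measureU2 _ _ _) _; [exact: measurableI|exact: measurableD|].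
    by rewrite /r EFinD fineK//; apply: leeD => //; exact: ltW.
  have -> : shift x B `&` A' = shift x (B `&` shift (- x) A').
    by apply/seteqP; split => y [By A'y]; split; move: A'y => //=;
      rewrite /shift/mkset/= opprK subrK.
  have mB' : measurable (B `&` shift (- x) A' : set (borel T)).
    by apply: measurableI => //; exact: measurable_shift.
  rewrite measure_shift//; apply: le_measure; rewrite ?inE//.
    exact: measurableI.
  move=> z [Bz]; rewrite /S /shift/mkset/= !opprK => A'z; split => //.
  by exists (x - s i); [exact: EV|rewrite addrACA subrr addr0].
apply: (@le_trans _ _ (\int[m]_(x in (K : set (borel T)))
    (\sum_(i < n) ((r i)%:E * (\1_(E i) x)%:E)))%E).
  by apply: ge0_le_integral_nomeas => x Kx; [exact: measure_ge0|exact: step].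
rewrite integral_step//.
have -> : (\sum_(i < n) (r i)%:E * m (E i `&` K) =
    \sum_(i < n) (fine (m (E i)))%:E * m (S i `&` B) + e%:E * \sum_(i < n) m (E i))%E.
  rewrite ge0_sume_distrr//= -big_split/=; apply: eq_bigr => i _.
  rewrite setIidl; last exact: EK.
  rewrite fineK// /r EFinD fineK// ge0_muleDl//; last by rewrite lee_fin ltW.
  by rewrite muleC.
apply: leeD; last first.
  apply: lee_wpmul2l; first by rewrite lee_fin ltW.
  rewrite -measure_bigsetU//; apply: le_measure; rewrite ?inE//.
    by apply: bigsetU_measurable.
  by rewrite -bigcup_mkord => x [i _ /EK].
rewrite -(@integral_step _ _ _ m B n (fun i => fine (m (E i))) S)//.
apply: (@le_trans _ _ (\int[m]_(x in (B : set (borel T))) cst (m W) x)%E); last first.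
  by rewrite integral_cst// lee_wpmul2r// ltW.
apply: ge0_le_integral_nomeas => [z _|z Bz].
  by apply: sume_ge0 => i _; rewrite mule_ge0 ?lee_fin//; apply: fine_ge0; exact: measure_ge0.
pose G i := if z \in S i then E i else set0.
have mG i : measurable (G i : set (borel T)) by rewrite /G; case: ifP.
have tG : trivIset setT G.
  move=> i j _ _ [x []]; rewrite /G.
  by case: ifP => // _ Ei; case: ifP => // _ Ej; apply: tE => //; exists x.
have -> : (\sum_(i < n) ((fine (m (E i)))%:E * (\1_(S i) z)%:E) = \sum_(i < n) m (G i))%E.
  apply: eq_bigr => i _; rewrite fineK// indicE /G; case: ifP => _.
    by rewrite mule1.
  by rewrite mule0 measure0.
rewrite -measure_bigsetU// -(measure_shift (- z) mW).
apply: le_measure; rewrite ?inE//.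
- exact: bigsetU_measurable.
- exact: measurable_shift.
rewrite -bigcup_mkord => x [i _]; rewrite /G; case: ifPn => // /set_mem.
rewrite /S /shift/mkset/= !opprK => -[v Vv A'v] /EV Vx.
have := PW (x - s i, v) => /=.
move=> /(_ (conj (VP _ Vx).1 (VP _ Vv).2)) /(_ _ A'v).
by rewrite addrACA subrr addr0 addrACA subrr addr0 addrC.
Qed.

Lemma integral_shiftI_le K A B : compact K ->
  measurable (A : set (borel T)) -> measurable (B : set (borel T)) ->
  (m A < +oo)%E -> (m B < +oo)%E ->
  (\int[m]_(x in (K : set (borel T))) m (shift x B `&` A) <= m A * m B)%E.
Proof.
move=> cK mA mB Afin Bfin; apply/lee_addgt0Pr => d d0.
have [Kfin _ _] := mR; have {Kfin} := Kfin _ cK.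
have := fun e => @integral_shiftI_le_eps K A B e cK mA mB Afin Bfin.
have fA : m A \is a fin_num by rewrite ge0_fin_numE.
have fB : m B \is a fin_num by rewrite ge0_fin_numE.
move=> + Kfin; have fK : m K \is a fin_num by rewrite ge0_fin_numE.
rewrite -(fineK fA) -(fineK fB) -(fineK fK).
have a0 : 0 <= fine (m A) by exact: fine_ge0.
have b0 : 0 <= fine (m B) by exact: fine_ge0.
have k0 : 0 <= fine (m K) by exact: fine_ge0.
move: (fine (m A)) (fine (m B)) (fine (m K)) a0 b0 k0 => a b k a0 b0 k0.
have s0 : 0 < b + k + 1 by lra.
move=> /(_ (d / (b + k + 1)) (divr_gt0 d0 s0)) => h; apply: le_trans h _.
rewrite -!(EFinD, EFinM) lee_fin.
have -> : (a + d / (b + k + 1)) * b + d / (b + k + 1) * k =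
  a * b + d * ((b + k) / (b + k + 1)) by field; rewrite gt_eqF.
rewrite lerD2l; apply: ler_piMr; first exact: ltW.
rewrite ler_pdivrMr// mul1r; lra.
Qed.

End radon_groups.

(** * The dual group as a topological group *)

Section dual_group.
Variables (R : realType) (G : topologicalZmodType).
Implicit Types (a b : character R G).

Lemma char_addE a b x : (a + b) x = a x * b x. Proof. by []. Qed.
Lemma char_oppE a x : (- a) x = (a x)^-1. Proof. by []. Qed.

(** Characters are continuous, so the compact-open topology on them is that
of uniform convergence on compact sets. From this the group operations are
continuous, and the results on groups with a Radon measure apply to the dual. *)
Lemma nbhs_characterP a (A : set (character R G)) :
  nbhs a A <-> exists K (e : R), [/\ compact K, 0 < e &
    forall b, (forall x, K x -> normc (b x - a x) < e) -> A b].
Proof.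
pose B (p : set G * R) := [set g : G -> R[i] | forall x, p.1 x -> normc (g x - a x) < p.2].
pose D := [set p : set G * R | compact p.1 /\ 0 < p.2].
pose F : set_system (G -> R[i]) := filter_from D B.
have FF : Filter F.
  apply: filter_from_filter.
    by exists (set0, 1); split => //; exact: compact0.
  move=> [K e] [K' e'] [/= cK e0] [/= cK' e'0].
  exists (K `|` K', Num.min e e').
    by split => /=; [exact: compactU|rewrite lt_min e0].
  move=> g /= h; split => x /= Kx.
    by have := h x (or_introl Kx); rewrite lt_min => /andP[].
  by have := h x (or_intror Kx); rewrite lt_min => /andP[].
split.
  rewrite nbhsE => -[B0 +]; case; case=> O oO OB Ba BA.
  have Oa : O (a : G -> R[i]) by have := Ba; rewrite -OB.
  have OA b : O (b : G -> R[i]) -> A b by move=> Ob; apply: BA; rewrite -OB.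
  have Fa : {compact-open, F --> (a : G -> R[i])}.
    apply/compact_open_cvgP => K U cK oU aKU.
    have : \forall e \near (0 : R)^'+, K `<=` [set x | forall w, normc (w - a x) < e -> U w].
      have /compact_near_coveringP := cK; apply => x Kx.
      have /nbhs_complexP[e e0 eU] : nbhs (a x) U.
        by apply: open_nbhs_nbhs; split => //; apply: aKU; exists x.
      have e20 : 0 < e / 2 by rewrite divr_gt0.
      have ax : \forall y \near x, normc (a y - a x) < e / 2.
        by have /cvg_complexP := @char_continuous _ _ a x; apply.
      near=> y r => /= w wy; apply: eU.
      have -> : w - a x = (w - a y) + (a y - a x) by rewrite addrA subrK.
      apply: le_lt_trans (normc_triangle _ _) _.
      have -> : e = e / 2 + e / 2 by lra.
      rewrite ltrD//; last by near: y.
      apply: lt_trans wy _; near: r.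
      exact: nbhs_right_lt.
    move=> h; have [e [e0 eK]] := filter_ex (filterI (nbhs_right_gt (0 : R)) h).
    exists (K, e) => // g /= gK _ [x Kx <-].
    by apply: (eK x Kx); exact: gK.
  have [|[K e] [/= cK e0] KO] := Fa O.
    by apply: open_nbhs_nbhs; split.
  by exists K, e; split => // b bK; apply: OA; exact: KO.
move=> [K [e [cK e0 KA]]].
pose val (b : character R G) : G -> R[i] := b.
have cv : {compact-open, (val @ nbhs a) --> (a : G -> R[i])}.
  exact: (@initial_continuous (character R G) {compact-open, G -> R[i]}).
have [+ _] := @compact_open_fam_compactP G R[i] a (val @ nbhs a) (@char_continuous _ _ a) _.
move=> /(_ cv) fcv; have /fam_cvgP/(_ K cK) KF := fcv.
have entE : entourage [set p : R[i] * R[i] | normc (p.2 - p.1) < e].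
  have eC0 : 0 < (e%:C)%C :> R[i] by rewrite ltcR.
  apply: (filterS _ (@entourage_ball _ R[i]^o (PosNum eC0))) => -[z w] /=.
  by rewrite /ball/= distrC normc_normE ltcR.
have : nbhs (a : {uniform` K -> R[i]}) [set g | forall x, K x -> normc (g x - a x) < e].
  apply/uniform_nbhs; exists [set p : R[i] * R[i] | normc (p.2 - p.1) < e].
  by split.
move=> /KF h; have {}h : nbhs a (val @^-1` [set g | forall x, K x -> normc (g x - a x) < e]).
  exact: h.
by apply: filterS h => b /= /KA.
Unshelve. all: by end_near. Qed.

Lemma char_sub_continuous :
  continuous (fun x : character R G * character R G => x.1 - x.2).
Proof.
move=> [a b] A /nbhs_characterP[K [e [cK e0 KA]]].
have e20 : 0 < e / 2 by rewrite divr_gt0.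
exists ([set c : character R G | forall x, K x -> normc (c x - a x) < e / 2],
        [set c : character R G | forall x, K x -> normc (c x - b x) < e / 2]).
  by split; apply/nbhs_characterP; exists K, (e / 2).
move=> [c d] /= [ca db]; apply: KA => x Kx.
rewrite !char_addE !char_oppE.
have nb (f : character R G) : f x != 0 by exact: char_neq0.
have -> : c x * (d x)^-1 - a x * (b x)^-1 =
    (c x - a x) * (d x)^-1 + a x * (b x)^-1 * (d x)^-1 * (b x - d x).
  by field; rewrite !nb.
apply: le_lt_trans (normc_triangle _ _) _.
rewrite !normcM !normcV !char_norm invr1 !mulr1 mul1r [normc (b x - d x)]normc_sub.
by have := ca x Kx; have := db x Kx; lra.
Qed.

HB.instance Definition _ :=
  PreTopologicalNmodule_isTopologicalZmodule.Build (character R G) char_sub_continuous.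

Lemma character_hausdorff : hausdorff_space (character R G).
Proof.
move=> a b ab; apply: character_eq => x; apply/eqP; apply: contraT => nab.
have e0 : 0 < normc (a x - b x) / 2.
  rewrite divr_gt0// lt_neqAle normc_ge0 andbT eq_sym; apply/eqP.
  by move=> /eq0_normc /eqP; rewrite subr_eq0 (negbTE nab).
have nb (c : character R G) : nbhs c [set d : character R G | forall y, [set x] y -> normc (d y - c y) < normc (a x - b x) / 2].
  by apply/nbhs_characterP; exists [set x], (normc (a x - b x) / 2); split => //; exact: compact_set1.
have [c [ca cb]] := ab _ _ (nb a) (nb b).
have {}ca := ca x erefl; have {}cb := cb x erefl.
have := normc_triangle (a x - c x) (c x - b x).
rewrite addrA subrK [normc (a x - c x)]normc_sub; lra.
Qed.

End dual_group.

(** * Integrals of complex-valued functions *)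

Section complex_integral.
Variables (R : realType) (T : preTopologicalZmodType).
Variable mu : {measure set (borel T) -> \bar R}.
Implicit Types h k : T -> R[i].

Definition cintegrable h :=
  cmeasurable h /\ (\int[mu]_x (normc (h x))%:E < +oo)%E.

Lemma cintegrable_ReIm h : cintegrable h ->
  mu.-integrable setT (fun x : borel T => (complex.Re (h x))%:E) /\
  mu.-integrable setT (fun x : borel T => (complex.Im (h x))%:E).
Proof.
move=> [mh hfin]; have /cmeasurableP[mRe mIm] := mh.
have ih : mu.-integrable setT (fun x : borel T => (normc (h x))%:E).
  apply/integrableP; split; first by apply/measurable_EFinP; exact: measurable_normc.
  by under eq_integral do rewrite /= ger0_norm ?normc_ge0//.
split; apply: le_integrable ih => //.
- exact/measurable_EFinP.
- by move=> x _ /=; rewrite lee_fin [leRHS]ger0_norm ?normc_ge0 ?normc_Re.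
- exact/measurable_EFinP.
- by move=> x _ /=; rewrite lee_fin [leRHS]ger0_norm ?normc_ge0 ?normc_Im.
Qed.

(** The factor 2 comes from bounding the real and imaginary parts
separately. *)
Lemma normc_cintegral_le h (c : R) : cmeasurable h ->
  (\int[mu]_x (normc (h x))%:E <= c%:E)%E -> normc (cintegral mu h) <= 2 * c.
Proof.
move=> mh hc; have ih : cintegrable h by split => //; apply: le_lt_trans hc _; rewrite ltry.
have [iRe iIm] := cintegrable_ReIm ih.
have /cmeasurableP[mRe mIm] := mh.
apply: le_trans (normc_le_ReIm _) _ => /=.
have aux (u : T -> R) : measurable_fun [set: borel T] (u : borel T -> R) ->
    mu.-integrable setT (fun x : borel T => (u x)%:E) ->
    (forall x, `|u x| <= normc (h x)) ->
    (`|\int[mu]_x u x|)%R <= c.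
  move=> mu' iu uh; apply: le_trans (le_normr_Rintegral _ _) _ => //.
  rewrite -lee_fin; apply: le_trans hc.
  rewrite /Rintegral fineK; last first.
    apply: integrable_fin_num => //; have := integrable_abse iu.
    by apply: eq_integrable.
  by apply: ge0_le_integral_nomeas => x _; rewrite lee_fin.
have h1 := aux _ mRe iRe (fun x => normc_Re (h x)).
have h2 := aux _ mIm iIm (fun x => normc_Im (h x)).
lra.
Qed.

Lemma cmeasurableB h k : cmeasurable h -> cmeasurable k ->
  cmeasurable (fun x => h x - k x).
Proof.
move=> /cmeasurableP[h1 h2] /cmeasurableP[k1 k2]; apply/cmeasurableP; split.
  under [X in measurable_fun _ X]eq_fun do rewrite raddfB/=.
  exact: measurable_funB.
under [X in measurable_fun _ X]eq_fun do rewrite raddfB/=.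
exact: measurable_funB.
Qed.

Lemma cmeasurableD h k : cmeasurable h -> cmeasurable k ->
  cmeasurable (fun x => h x + k x).
Proof.
move=> /cmeasurableP[h1 h2] /cmeasurableP[k1 k2]; apply/cmeasurableP; split.
  under [X in measurable_fun _ X]eq_fun do rewrite raddfD/=.
  exact: measurable_funD.
under [X in measurable_fun _ X]eq_fun do rewrite raddfD/=.
exact: measurable_funD.
Qed.

Lemma cintegralB h k : cintegrable h -> cintegrable k ->
  cintegral mu (fun x => h x - k x) = cintegral mu h - cintegral mu k.
Proof.
move=> /cintegrable_ReIm[hRe hIm] /cintegrable_ReIm[kRe kIm].
apply/eqP; rewrite eq_complex/=; apply/andP; split; apply/eqP.
  rewrite -RintegralB//; apply: eq_Rintegral => x _; first by rewrite raddfB.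
rewrite -RintegralB//; apply: eq_Rintegral => x _; by rewrite raddfB.
Qed.

Lemma cintegralD h k : cintegrable h -> cintegrable k ->
  cintegral mu (fun x => h x + k x) = cintegral mu h + cintegral mu k.
Proof.
move=> /cintegrable_ReIm[hRe hIm] /cintegrable_ReIm[kRe kIm].
apply/eqP; rewrite eq_complex/=; apply/andP; split; apply/eqP.
  rewrite -RintegralD//; apply: eq_Rintegral => x _; first by rewrite raddfD.
rewrite -RintegralD//; apply: eq_Rintegral => x _; by rewrite raddfD.
Qed.

Lemma cintegrableD h k : cintegrable h -> cintegrable k ->
  cintegrable (fun x => h x + k x).
Proof.
move=> [mh ih] [mk ik]; split; first exact: cmeasurableD.
apply: (@le_lt_trans _ _ (\int[mu]_x ((normc (h x))%:E + (normc (k x))%:E))%E).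
  by apply: ge0_le_integral_nomeas => x _; rewrite ?lee_fin ?normc_ge0 ?normc_triangle.
rewrite ge0_integralD//.
- by rewrite lte_add_pinfty.
- by move=> x _; rewrite lee_fin normc_ge0.
- by apply/measurable_EFinP; exact: measurable_normc.
- by move=> x _; rewrite lee_fin normc_ge0.
- by apply/measurable_EFinP; exact: measurable_normc.
Qed.

Lemma cintegrable0 : cintegrable (fun=> 0).
Proof.
split; last by under eq_integral do rewrite normc0; rewrite integral0.
by apply/cmeasurableP; split => /=; exact: measurable_cst.
Qed.

Lemma cintegral0 : cintegral mu (fun=> 0) = 0.
Proof.
by rewrite /cintegral/= /Rintegral integral0.
Qed.

Lemma cintegral_sum (I : Type) (s : seq I) (h : I -> T -> R[i]) :
  (forall i, cintegrable (h i)) ->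
  cintegrable (fun x => \sum_(i <- s) h i x) /\
  cintegral mu (fun x => \sum_(i <- s) h i x) = \sum_(i <- s) cintegral mu (h i).
Proof.
move=> ih; elim: s => [|i s [IH1 IH2]].
  under [X in cintegrable X]eq_fun do rewrite big_nil.
  under [X in cintegral _ X]eq_fun do rewrite big_nil.
  by rewrite big_nil cintegral0; split => //; exact: cintegrable0.
under [X in cintegrable X]eq_fun do rewrite big_cons.
under [X in cintegral _ X]eq_fun do rewrite big_cons.
by rewrite big_cons cintegralD// IH2; split => //; exact: cintegrableD.
Qed.

End complex_integral.

(** * Short-time Fourier transform of bounded functions with finite-measure support *)

Section stft_pieces.
Variables (R : realType) (G : topologicalZmodType).
Variable mu : {measure set (borel G) -> \bar R}.
Hypothesis hG : hausdorff_space G.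
Hypothesis mu_haar : haar_measure mu.
Implicit Types (f g : G -> R[i]) (A B : set G) (M N : R).

Let mu_radon : radon_measure mu. Proof. by have [] := mu_haar. Qed.
Let mu_inv (x : G) (A : set (borel G)) : measurable A ->
  mu [set (x + a)%R | a in A] = mu A.
Proof. by have [_ _] := mu_haar; apply. Qed.

(** Bounded by [M] and supported in the set [A] of finite measure: the shape of
the pieces into which [f] and [g] will be cut. *)
Record finbdd f M A : Prop := FinBdd {
  fb_meas : cmeasurable f;
  fb_set : measurable (A : set (borel G));
  fb_fin : (mu A < +oo)%E;
  fb_ge0 : 0 <= M;
  fb_le : forall y, normc (f y) <= M * \1_A y }.

Definition windowed f g (x : G) : G -> R[i] :=
  fun y => f y * ((translate x g y)^*)%C.

Definition modulated f g (z : G * character R G) : G -> R[i] :=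
  fun y => windowed f g z.1 y * ((z.2 y)^*)%C.

Lemma stftE f g z : stft mu g f z = cintegral mu (modulated f g z).
Proof. by []. Qed.

Lemma cmeasurable_translate g x : cmeasurable g -> cmeasurable (translate x g).
Proof.
move=> mg.
have mx := continuous_borel (@subr_continuous _ x : continuous (fun y : G => y - x)).
exact: (measurableT_comp (mg : measurable_fun setT (g : borel G -> borel R[i])) mx).
Qed.

Lemma cmeasurable_windowed f g x : cmeasurable f -> cmeasurable g ->
  cmeasurable (windowed f g x).
Proof.
move=> mf mg; apply: cmeasurableM => //; apply: cmeasurable_conj.
exact: cmeasurable_translate.
Qed.

Lemma cmeasurable_modulated f g z : cmeasurable f -> cmeasurable g ->
  cmeasurable (modulated f g z).
Proof.
move=> mf mg; apply: cmeasurableM; first exact: cmeasurable_windowed.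
apply: cmeasurable_conj; apply: cmeasurable_continuous.
exact: char_continuous.
Qed.

Lemma normc_modulated f g z y :
  normc (modulated f g z y) = normc (windowed f g z.1 y).
Proof. by rewrite /modulated normcM normc_conj char_norm mulr1. Qed.

Lemma normc_windowed f g x y :
  normc (windowed f g x y) = normc (f y) * normc (g (y - x)).
Proof. by rewrite /windowed normcM normc_conj. Qed.

Lemma windowed_le f g M N A B x y : finbdd f M A -> finbdd g N B ->
  normc (windowed f g x y) <= M * N * \1_(shift x B `&` A) y.
Proof.
move=> fA gB; rewrite normc_windowed.
apply: (@le_trans _ _ ((M * \1_A y) * (N * \1_B (y - x)))).
  by apply: ler_pM; rewrite ?normc_ge0 ?(fb_le fA) ?(fb_le gB).
rewrite indicI/= mulrACA.
have -> : \1_(shift x B) y = \1_B (y - x) :> R by rewrite !indicE; congr (_%:R); apply/idP/idP => /set_mem h; apply/mem_set.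
by rewrite [\1_A y * _]mulrC.
Qed.

Lemma finbdd_windowed f g M N A B x : finbdd f M A -> finbdd g N B ->
  finbdd (windowed f g x) (M * N) (shift x B `&` A).
Proof.
move=> fA gB; split.
- exact: cmeasurable_windowed (fb_meas fA) (fb_meas gB).
- by apply: measurableI; [apply: measurable_shift; exact: fb_set gB|exact: fb_set fA].
- apply: le_lt_trans (fb_fin fA); apply: le_measure; rewrite ?inE//.
    by apply: measurableI; [apply: measurable_shift; exact: fb_set gB|exact: fb_set fA].
  exact: fb_set fA.
- by rewrite mulr_ge0 ?(fb_ge0 fA) ?(fb_ge0 gB).
- by move=> y; exact: windowed_le.
Qed.

Lemma finbdd_int f M A : finbdd f M A ->
  (\int[mu]_y (normc (f y))%:E <= M%:E * mu A)%E.
Proof.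
move=> fA; apply: (@le_trans _ _ (\int[mu]_y (M%:E * (\1_A y)%:E))%E).
  apply: ge0_le_integral_nomeas => y _; first by rewrite lee_fin normc_ge0.
  by rewrite -EFinM lee_fin; exact: (fb_le fA).
rewrite ge0_integralZl_EFin// ?(fb_ge0 fA)//.
  by rewrite integral_indic// ?setIT; [|exact: fb_set fA].
apply/measurable_EFinP; apply: measurable_indic; exact: fb_set fA.
Qed.

Lemma finbdd_integrable f M A : finbdd f M A -> cintegrable mu f.
Proof.
move=> fA; split; first exact: fb_meas fA.
apply: le_lt_trans (finbdd_int fA) _.
by rewrite lte_mul_pinfty// ?lee_fin ?(fb_ge0 fA) ?(fb_fin fA).
Qed.

(** The integrand is bounded by [M * N] and vanishes outside
[(x + B) `&` A]. *)
Lemma stft_le f g M N A B z : finbdd f M A -> finbdd g N B ->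
  ((normc (stft mu g f z))%:E <= 2%:E * (M * N)%:E * Order.min (mu A) (mu B))%E.
Proof.
move=> fA gB; have fg := finbdd_windowed z.1 fA gB.
have MN := fb_ge0 fg.
have mA := fb_set fA; have mB := fb_set gB.
have mAB := fb_set fg.
pose c := mu (shift z.1 B `&` A).
have cfin : c \is a fin_num by rewrite ge0_fin_numE; [exact: (fb_fin fg)|exact: measure_ge0].
have h : normc (stft mu g f z) <= 2 * (M * N * fine c).
  rewrite stftE; apply: normc_cintegral_le.
    exact: cmeasurable_modulated (fb_meas fA) (fb_meas gB).
  rewrite EFinM fineK//; under eq_integral do rewrite normc_modulated.
  exact: finbdd_int.
apply: (@le_trans _ _ (2%:E * (M * N)%:E * c)%E).
  by rewrite -(fineK cfin) -!EFinM lee_fin -mulrA.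
apply: lee_wpmul2l; first by rewrite -EFinM lee_fin mulr_ge0.
rewrite le_min; apply/andP; split.
  by apply: le_measure; rewrite ?inE.
rewrite -(measure_shift mu_inv z.1 mB).
by apply: le_measure; rewrite ?inE//; exact: measurable_shift.
Qed.


Lemma near_bigsetU_small (Z : nat -> G -> set G) (x0 : G) :
  (forall i x, measurable (Z i x : set (borel G))) ->
  forall n, (forall i, (i < n)%N -> forall e : R, 0 < e ->
    \forall x \near x0, (mu (Z i x) < e%:E)%E) ->
  forall e : R, 0 < e ->
  \forall x \near x0, (mu (\big[setU/set0]_(i < n) Z i x) < e%:E)%E.
Proof.
move=> mZ; elim=> [|n IH] Zs e e0.
  by apply: nearW => x; rewrite big_ord0 measure0 lte_fin.
have e20 : 0 < e / 2 by rewrite divr_gt0.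
have h1 : \forall x \near x0, (mu (\big[setU/set0]_(i < n) Z i x) < (e / 2)%:E)%E.
  by apply: IH => // i ni; apply: Zs; exact: ltnW.
have h2 := Zs n (ltnSn n) _ e20.
near=> x; rewrite big_ord_recr/=.
apply: le_lt_trans (measureU2 _ _ _) _ => //; first exact: bigsetU_measurable.
have -> : e = e / 2 + e / 2 by lra.
by rewrite EFinD; apply: lteD; [near: x; exact: h1|near: x; exact: h2].
Unshelve. all: by end_near. Qed.

(** Translation is continuous in measure. Cut the range of [h] into cells
of length [e]; off the small set of the points [y] for which [y - x] and [y - x0]
lie in the preimages of different cells, the values of [h] differ by at most
[e]. *)
Lemma translate_in_measure_real (h : G -> R) N B (x0 : G) (e : R) :
  measurable_fun [set: borel G] (h : borel G -> R) ->
  measurable (B : set (borel G)) -> (mu B < +oo)%E -> 0 <= N ->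
  (forall y, `|h y| <= N * \1_B y) -> 0 < e ->
  \forall x \near x0, exists Z : set G, [/\ measurable (Z : set (borel G)),
    (mu Z < e%:E)%E & forall y, ~ Z y -> `|h (y - x) - h (y - x0)| <= e].
Proof.
move=> mh mB Bfin N0 hB e0.
pose n := (Num.truncn (2 * N / e)).+1.
pose E i : set G := B `&` (h @^-1` `[(- N + i%:R * e)%R, (- N + i.+1%:R * e)%R[).
have mE i : measurable (E i : set (borel G)).
  apply: measurableI => //; have := mh measurableT _ (measurable_itv `[(- N + i%:R * e)%R, (- N + i.+1%:R * e)%R[).
  by rewrite setTI.
have Efin i : (mu (E i) < +oo)%E.
  by apply: le_lt_trans Bfin; apply: le_measure; rewrite ?inE//; exact: subIsetl.
have EB y : B y -> exists2 i, (i < n)%N & E i y.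
  move=> By; have := hB y; rewrite indicE mem_set// mulr1 ler_norml => /andP[h1 h2].
  have t0 : 0 <= (h y + N) / e by apply: divr_ge0; [lra|exact: ltW].
  have /andP[t1 t2] := truncn_itv t0.
  exists (Num.truncn ((h y + N) / e)).
    rewrite /n ltnS; apply: le_truncn; rewrite ler_pM2r ?invr_gt0//; lra.
  split => //=; rewrite in_itv/=; apply/andP; split.
    by move: t1; rewrite ler_pdivlMr//; lra.
  by move: t2; rewrite ltr_pdivrMr//; lra.
pose Z i x := shift x0 (E i) `\` shift x (E i).
have mZ i x : measurable (Z i x : set (borel G)).
  by apply: measurableD; exact: measurable_shift.
have e20 : 0 < e / 2 by rewrite divr_gt0.
have ZS : \forall x \near x0, (mu (\big[setU/set0]_(i < n) Z i x) < (e / 2)%:E)%E.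
  apply: near_bigsetU_small => // i _ d d0.
  have := near_shift_symdiff_at hG mu_radon mu_inv x0 (mE i) (Efin i) d0.
  by apply: filterS => x [].
have ZB : \forall x \near x0, (mu (shift x B `\` shift x0 B) < (e / 2)%:E)%E.
  have := near_shift_symdiff_at hG mu_radon mu_inv x0 mB Bfin e20.
  by apply: filterS => x [].
near=> x.
exists ((\big[setU/set0]_(i < n) Z i x) `|` (shift x B `\` shift x0 B)).
have mU : measurable (\big[setU/set0]_(i < n) Z i x : set (borel G)).
  exact: bigsetU_measurable.
have mSB : measurable (shift x B `\` shift x0 B : set (borel G)).
  by apply: measurableD; exact: measurable_shift.
split.
- exact: measurableU.
- apply: le_lt_trans (measureU2 _ _ _) _ => //.
  have -> : e = e / 2 + e / 2 by lra.
  by rewrite EFinD; apply: lteD; [near: x; exact: ZS|near: x; exact: ZB].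
move=> y /not_orP[nZ nB].
have [B0|nB0] := pselect (B (y - x0)); last first.
  have nBx : ~ B (y - x) by move=> Bx; apply: nB.
  have h0 t : ~ B t -> h t = 0.
    move=> nBt; have := hB t; rewrite indicE memNset// mulr0 normr_le0.
    by move/eqP.
  by rewrite !h0// subrr normr0 ltW.
have [i ni E0] := EB _ B0.
have [_ E1] : E i (y - x).
  apply: contrapT => nE; apply: nZ; rewrite -(bigcup_mkord n (fun i => Z i x)).
  by exists i.
have [_ E2] := E0.
move: E1 E2; rewrite /= !in_itv/= => /andP[a1 a2] /andP[b1 b2].
move: a1 a2 b1 b2; rewrite -[i.+1]addn1 natrD mulrDl mul1r => a1 a2 b1 b2.
by rewrite ler_norml; apply/andP; split; lra.
Unshelve. all: by end_near. Qed.

Lemma translate_in_measure g N B (x0 : G) (e : R) : finbdd g N B -> 0 < e ->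
  \forall x \near x0, exists Z : set G, [/\ measurable (Z : set (borel G)),
    (mu Z < e%:E)%E & forall y, ~ Z y -> normc (g (y - x) - g (y - x0)) <= e].
Proof.
move=> gB e0; have e20 : 0 < e / 2 by rewrite divr_gt0.
have /cmeasurableP[mRe mIm] := fb_meas gB.
have h1 := @translate_in_measure_real _ N B x0 _ mRe (fb_set gB) (fb_fin gB) (fb_ge0 gB)
  (fun y => le_trans (normc_Re _) (fb_le gB y)) e20.
have h2 := @translate_in_measure_real _ N B x0 _ mIm (fb_set gB) (fb_fin gB) (fb_ge0 gB)
  (fun y => le_trans (normc_Im _) (fb_le gB y)) e20.
apply: filterS2 h1 h2 => x [Z1 [mZ1 Z1e Z1h]] [Z2 [mZ2 Z2e Z2h]].
exists (Z1 `|` Z2); split.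
- exact: measurableU.
- apply: le_lt_trans (measureU2 _ _ _) _ => //.
  have -> : e = e / 2 + e / 2 by lra.
  by rewrite EFinD; apply: lteD.
move=> y /not_orP[/Z1h b1 /Z2h b2].
apply: le_trans (normc_le_ReIm _) _; rewrite !raddfB/=; lra.
Qed.

(** A character close to [xi0] is uniformly close to it on a compact subset
of [A] that carries almost all its measure. *)
Lemma char_in_measure A (xi0 : character R G) (e : R) :
  measurable (A : set (borel G)) -> (mu A < +oo)%E -> 0 < e ->
  nbhs xi0 [set xi : character R G | exists Z : set G, [/\ measurable (Z : set (borel G)),
    (mu Z < e%:E)%E & forall y, A y -> ~ Z y -> normc (xi y - xi0 y) <= e]].
Proof.
move=> mA Afin e0; have [K [cK KA AK]] := radon_inner hG mu_radon mA Afin e0.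
apply/nbhs_characterP; exists K, e; split => // xi xiK.
exists (A `\` K); split => //.
  by apply: measurableD => //; exact: compact_borel.
move=> y Ay nAK; apply/ltW/xiK; apply: contrapT => nKy; exact: nAK.
Qed.

(** Near a given point the integrands differ by at most [M * (1 + N) * e]
off a set of small measure and by at most [2 * M * N] on it. *)
Lemma stft_continuous f g M N A B : finbdd f M A -> finbdd g N B ->
  continuous (stft mu g f : G * character R G -> R[i]).
Proof.
move=> fA gB [x0 xi0]; apply/cvg_complexP => eps eps0.
have mA := fb_set fA; have M0 := fb_ge0 fA; have N0 := fb_ge0 gB.
have fAfin : mu A \is a fin_num by rewrite ge0_fin_numE; [exact: (fb_fin fA)|].
pose a := fine (mu A).
have a0 : 0 <= a by exact: fine_ge0.
(* The final estimate is at most (c - 1) * e < eps. *)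
pose c := 2 * (M * (1 + N) * a + 2 * (M * N) * 2) + 1.
have c0 : 0 < c.
  by rewrite ltr_wpDl// mulr_ge0// addr_ge0// ?mulr_ge0// addr_ge0.
pose e := eps / c.
have e0 : 0 < e by rewrite divr_gt0.
have h1 := translate_in_measure x0 gB e0.
have h2 := char_in_measure xi0 mA (fb_fin fA) e0.
exists (([set x | exists Z : set G, [/\ measurable (Z : set (borel G)),
    (mu Z < e%:E)%E & forall y, ~ Z y -> normc (g (y - x) - g (y - x0)) <= e]]),
  ([set xi : character R G | exists Z : set G, [/\ measurable (Z : set (borel G)),
    (mu Z < e%:E)%E & forall y, A y -> ~ Z y -> normc (xi y - xi0 y) <= e]])) => //.
move=> [x xi] [/= [Z1 [mZ1 Z1e gZ]] [Z2 [mZ2 Z2e xiZ]]].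
have mf := fb_meas fA; have mg := fb_meas gB.
pose k := modulated f g (x, xi); pose k0 := modulated f g (x0, xi0).
have int z : cintegrable mu (modulated f g z).
  split; first exact: cmeasurable_modulated.
  under eq_integral do rewrite normc_modulated.
  by have [] := finbdd_integrable (finbdd_windowed z.1 fA gB).
have mZ : measurable (Z1 `|` Z2 : set (borel G)) by exact: measurableU.
change (normc (stft mu g f (x, xi) - stft mu g f (x0, xi0)) < eps).
rewrite !stftE -cintegralB//.
apply: (@le_lt_trans _ _ (2 * ((M * (1 + N) * e) * a + 2 * (M * N) * (2 * e)))); last first.
  have -> : 2 * ((M * (1 + N) * e) * a + 2 * (M * N) * (2 * e)) = (c - 1) * e.
    by rewrite /c; ring.
  have ce : c * e = eps by rewrite /e mulrC divfK ?gt_eqF.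
  by rewrite mulrBl mul1r ce ltrBlDr ltrDl.
apply: normc_cintegral_le; first by apply: cmeasurableB; exact: cmeasurable_modulated.
have c1 : 0 <= M * (1 + N) * e.
  by apply: mulr_ge0; [apply: mulr_ge0 => //; exact: addr_ge0|exact: ltW].
have c2 : 0 <= 2 * (M * N) by rewrite !mulr_ge0.
have pt y : normc (modulated f g (x, xi) y - modulated f g (x0, xi0) y) <=
    (M * (1 + N) * e) * \1_A y + 2 * (M * N) * \1_(Z1 `|` Z2) y.
  have [Ay|nAy] := pselect (A y); last first.
    have f0 : f y = 0.
      apply: eq0_normc; apply/eqP; rewrite eq_le normc_ge0 andbT.
      by have := fb_le fA y; rewrite indicE memNset// mulr0.
    rewrite /modulated /windowed f0 !mul0r subr0 normc0.
    by apply: addr_ge0; apply: mulr_ge0 => //; rewrite indicE ler0n.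
  rewrite [\1_A y]indicE mem_set// mulr1.
  have fM : normc (f y) <= M by have := fb_le fA y; rewrite indicE mem_set// mulr1.
  have gN t : normc (g t) <= N.
    by apply: le_trans (fb_le gB t) _; apply: ler_piMr => //; rewrite indicE; case: (_ \in _).
  have [Zy|nZy] := pselect ((Z1 `|` Z2) y).
    rewrite indicE mem_set// mulr1.
    have bd z : normc (modulated f g z y) <= M * N.
      rewrite normc_modulated normc_windowed; apply: ler_pM; rewrite ?normc_ge0//.
    have := normc_triangle (modulated f g (x, xi) y) (- modulated f g (x0, xi0) y).
    rewrite -[- _ y]sub0r normc_sub subr0.
    have := bd (x, xi); have := bd (x0, xi0).
    lra.
  rewrite [\1_(_ `|` _) y]indicE memNset// mulr0 addr0.
  move: nZy => /not_orP[/gZ g1 nZ2]; have x1 := xiZ _ Ay nZ2.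
  have -> : modulated f g (x, xi) y - modulated f g (x0, xi0) y =
    f y * (((g (y - x) - g (y - x0))^*)%C * ((xi y)^*)%C
           + ((g (y - x0))^*)%C * ((xi y - xi0 y)^*)%C).
    by rewrite /modulated /windowed /translate/= !rmorphB/=; ring.
  rewrite normcM -mulrA; apply: ler_pM; rewrite ?normc_ge0//.
  apply: le_trans (normc_triangle _ _) _.
  rewrite !normcM !normc_conj char_norm mulr1 mulrDl mul1r; apply: lerD => //.
  by apply: ler_pM; rewrite ?normc_ge0.
apply: (@le_trans _ _ (\int[mu]_y (((M * (1 + N) * e))%:E * (\1_A y)%:E +
    (2 * (M * N))%:E * (\1_(Z1 `|` Z2) y)%:E))%E).
  apply: ge0_le_integral_nomeas => y _; first by rewrite lee_fin normc_ge0.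
  by rewrite -!EFinM -EFinD lee_fin.
have mi (P : set G) : measurable (P : set (borel G)) ->
    measurable_fun [set: borel G] (fun y : borel G => (\1_P y : R)%:E).
  by move=> mP; apply/measurable_EFinP; exact: measurable_indic.
rewrite ge0_integralD//; last 4 first.
- by move=> y _; rewrite mule_ge0// lee_fin.
- by apply: measurable_funeM; exact: mi.
- by move=> y _; rewrite mule_ge0// lee_fin.
- by apply: measurable_funeM; exact: mi.
rewrite !ge0_integralZl_EFin//; [|exact: mi|exact: mi].
rewrite !integral_indic// !setIT EFinD; apply: leeD.
  by rewrite [leRHS]EFinM fineK.
rewrite [leRHS]EFinM; apply: lee_wpmul2l; first by rewrite lee_fin.
apply: le_trans (measureU2 _ _ _) _ => //.
have -> : 2 * e = e + e by lra.
by rewrite EFinD; apply: leeD; exact: ltW.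
Qed.

End stft_pieces.

(** * Square-integrability over compact sets *)

Section stft_L2.
Variables (R : realType) (G : topologicalZmodType).
Variable mu : {measure set (borel G) -> \bar R}.
Variable mu_dual : {measure set (borel (character R G)) -> \bar R}.
Variable mu_prod : {measure set (borel (G * character R G)%type) -> \bar R}.
Hypothesis hG : hausdorff_space G.
Hypothesis mu_haar : haar_measure mu.
Hypothesis mu_dual_haar : haar_measure mu_dual.
Hypothesis mu_plancherel : plancherel mu mu_dual.
Hypothesis mu_radon_prod : radon_product mu mu_dual mu_prod.

Lemma hausdorff_pair (S T : topologicalType) :
  hausdorff_space S -> hausdorff_space T -> hausdorff_space (S * T)%type.
Proof.
move=> hS hT [a b] [c d] h.
have nA (A : set S) (x : S) (y : T) : nbhs x A -> nbhs (x, y) (A `*` setT).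
  move=> xA; exists (A, setT) => //=; first by split => //; exact: filterT.
have nB (B : set T) (x : S) (y : T) : nbhs y B -> nbhs (x, y) (setT `*` B).
  move=> yB; exists (setT, B) => //=; first by split => //; exact: filterT.
congr pair.
  apply: hS => A B aA cB.
  have [[x y] [[Ax _] [Bx _]]] := h _ _ (nA A a b aA) (nA B c d cB).
  by exists x.
apply: hT => A B aA cB.
have [[x y] [[_ Ay] [_ By]]] := h _ _ (nB A a b aA) (nB B c d cB).
by exists y.
Qed.

Lemma Lnorm2_sqr d (T : measurableType d) (nu : {measure set T -> \bar R}) (h : T -> R) :
  (forall x, 0 <= h x) ->
  ((Lnorm nu 2%:E (EFin \o h)) `^ 2 = \int[nu]_x ((h x) ^+ 2)%:E)%E.
Proof.
move=> h0; rewrite unlock /Lnorm/=.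
rewrite -poweRrM mulVf// poweRe1.
  by apply: eq_integral => x _; rewrite /= ger0_norm// powR_mulrn.
by apply: integral_ge0 => x _; rewrite lee_fin powR_ge0.
Qed.

Lemma fourier_L2 h M A : finbdd mu h M A ->
  (\int[mu_dual]_xi ((normc (fourier mu h xi)) ^+ 2)%:E <= (M ^+ 2)%:E * mu A)%E.
Proof.
move=> hA; have M0 := fb_ge0 hA; have mA := fb_set hA; have mh := fb_meas hA.
have b2 : (\int[mu]_y ((normc (h y)) ^+ 2)%:E <= (M ^+ 2)%:E * mu A)%E.
  apply: (@le_trans _ _ (\int[mu]_y ((M ^+ 2)%:E * (\1_A y)%:E))%E).
    apply: ge0_le_integral_nomeas => y _; first by rewrite lee_fin sqr_ge0.
    rewrite -EFinM lee_fin.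
    have -> : M ^+ 2 * \1_A y = (M * \1_A y) ^+ 2.
      by rewrite exprMn indicE; case: (_ \in _); rewrite ?expr1n ?expr0n.
    by rewrite lerXn2r ?nnegrE ?normc_ge0 ?mulr_ge0 ?(fb_le hA)// indicE ler0n.
  rewrite ge0_integralZl_EFin// ?sqr_ge0//.
    by rewrite integral_indic// setIT.
  by apply/measurable_EFinP; exact: measurable_indic.
have pow : (\int[mu]_y ((normc (h y)) ^+ 2)%:E < +oo)%E.
  apply: le_lt_trans b2 _.
  by rewrite lte_mul_pinfty// ?lee_fin ?sqr_ge0// (fb_fin hA).
have := mu_plancherel mh; rewrite /cLnorm.
have n0 (z : R[i]) := normc_ge0 z.
have e1 := @Lnorm2_sqr _ _ mu (fun x => normc (h x)) (fun x => n0 (h x)).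
have e2 := @Lnorm2_sqr _ _ mu_dual (fun x => normc (fourier mu h x)) (fun x => n0 _).
rewrite -e2 => pl; apply: le_trans b2; rewrite -e1 pl//.
  rewrite Lnorm1; have [_] := finbdd_integrable hA.
  by under eq_integral do rewrite /= ger0_norm ?normc_ge0//.
by apply: (@lty_poweRy _ _ 2) => //; rewrite e1.
Qed.

(** For each [x], Plancherel's formula turns the integral over the dual group
of the square of the transform into that of [f * T_x g], at most
[(M * N) ^+ 2 * mu ((x + B) `&` A)]; integrating over [x] yields the bound. The
Radon product is an iterated integral only on continuous functions with compact
support, so the square is first multiplied by a product of two cutoff functions
equal to 1 on [C]. A bound that is uniform in the compact set [C] is all that the
interpolation argument asks for. *)
Lemma stft_L2_compact f g M N A B (C : set (G * character R G)) :
  finbdd mu f M A -> finbdd mu g N B -> compact C ->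
  (\int[mu_prod]_(z in (C : set (borel (G * character R G)%type)))
     ((normc (stft mu g f z)) ^+ 2)%:E <= ((M * N) ^+ 2)%:E * (mu A * mu B))%E.
Proof.
move=> fA gB cC.
have [mu_radon mu_n0 mu_inv] := mu_haar.
have [nu_radon nu_n0 nu_inv] := mu_dual_haar.
have hD := @character_hausdorff R G.
have cC1 : compact (fst @` C).
  by apply: continuous_compact => //; apply: continuous_subspaceT => z; exact: cvg_fst.
have cC2 : compact (snd @` C).
  by apply: continuous_compact => //; apply: continuous_subspaceT => z; exact: cvg_snd.
have [a [ca a01 aC [K cK aK]]] := compact_cutoff hG mu_radon mu_inv mu_n0 cC1.
have [b [cb b01 bC [L cL bL]]] := compact_cutoff hD nu_radon nu_inv nu_n0 cC2.
have mK := compact_borel hG cK.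
pose F z := (normc (stft mu g f z)) ^+ 2.
have F0 z : 0 <= F z by exact: sqr_ge0.
have cF : continuous F.
  move=> z; rewrite /F; apply: (@continuous_comp _ _ _ (fun z => normc (stft mu g f z)) (fun x : R => x ^+ 2)).
    apply: (@continuous_comp _ _ _ (stft mu g f) (@normc R)).
      exact: (stft_continuous hG mu_haar fA gB).
    exact: normc_continuous.
  exact: exprn_continuous.
pose phi (z : G * character R G) := a z.1 * b z.2 * F z.
have phi0 z : 0 <= phi z.
  have /andP[a0 _] := a01 z.1; have /andP[b0 _] := b01 z.2.
  by apply: mulr_ge0 => //; exact: mulr_ge0.
have cphi : continuous phi.
  move=> z; apply: cvgM; last exact: cF.
  apply: cvgM.
    apply: (@continuous_comp _ _ _ fst a); [exact: cvg_fst|exact: ca].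
  apply: (@continuous_comp _ _ _ snd b); [exact: cvg_snd|exact: cb].
have sphi : compact (closure [set z | phi z != 0]).
  apply: (@subclosed_compact _ _ (K `*` L)); first exact: closed_closure.
    exact: compact_setX.
  have cKL : closed (K `*` L).
    by apply: compact_closed; [exact: (hausdorff_pair hG hD)|exact: compact_setX].
  rewrite [X in _ `<=` X](closure_id _).1//; apply: closureS => z /= nz.
  split; apply: contrapT => nKL; move/eqP: nz; apply; rewrite /phi.
    by rewrite aK// !mul0r.
  by rewrite bL// mulr0 mul0r.
have [_ /(_ phi cphi sphi) phiE] := mu_radon_prod.
apply: (@le_trans _ _ (\int[mu_prod]_z (phi z)%:E)%E).
  rewrite integral_mkcond; apply: ge0_le_integral_nomeas => z _.
    by rewrite /patch; case: ifP => // _; rewrite lee_fin; exact: F0.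
  rewrite /patch; case: ifPn => [/set_mem Cz|_]; last by rewrite lee_fin.
  rewrite lee_fin /phi aC; last by exists z.
  by rewrite bC ?mul1r//; exists z.
rewrite phiE.
apply: (@le_trans _ _ (\int[mu]_(x in (K : set (borel G)))
    (((M * N) ^+ 2)%:E * (fine (mu (shift x B `&` A)))%:E))%E).
  rewrite [leRHS]integral_mkcond; apply: ge0_le_integral_nomeas => x _.
    by apply: integral_ge0 => xi _; rewrite lee_fin.
  rewrite /patch; case: ifPn => [/set_mem Kx|/negP nKx]; last first.
    rewrite integral0_eq// => xi _; rewrite /phi/= aK ?mul0r// => Kx.
    by apply: nKx; exact: mem_set.
  have fg := finbdd_windowed x fA gB.
  rewrite fineK; last by rewrite ge0_fin_numE; [exact: (fb_fin fg)|exact: measure_ge0].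
  apply: le_trans (fourier_L2 fg).
  apply: ge0_le_integral_nomeas => xi _; rewrite lee_fin// /phi/= -[leRHS]mul1r.
  apply: ler_wpM2r => //.
  have /andP[a0 a1] := a01 x; have /andP[b0 b1] := b01 xi.
  exact: mulr_ile1.
have mA := fb_set fA; have mB := fb_set gB.
have cs := shiftI_continuous hG mu_radon mu_inv mA mB (fb_fin gB).
rewrite ge0_integralZl_EFin ?sqr_ge0//; last first.
  apply: measurable_funTS; apply/measurable_EFinP.
  exact: continuous_borel_real cs.
apply: lee_wpmul2l; first by rewrite lee_fin sqr_ge0.
apply: le_trans (integral_shiftI_le hG mu_radon mu_inv cK mA mB (fb_fin fA) (fb_fin gB)).
apply: ge0_le_integral_nomeas => x _.
  by rewrite lee_fin; apply: fine_ge0; exact: measure_ge0.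
have fg := finbdd_windowed x fA gB.
by rewrite fineK// ge0_fin_numE; [exact: (fb_fin fg)|exact: measure_ge0].
Qed.

End stft_L2.

(** * Sums over countable types and Young's inequality *)

Section esum_complements.
Local Open Scope ereal_scope.
Variable R : realType.

Lemma esumZl (I : choiceType) (P : set I) (a : I -> \bar R) (c : R) :
  (0 <= c)%R -> (forall i, P i -> 0 <= a i) ->
  \esum_(i in P) (c%:E * a i) = c%:E * \esum_(i in P) a i.
Proof.
have le1 (b : I -> \bar R) (d : R) : (0 <= d)%R -> (forall i, P i -> 0 <= b i) ->
    \esum_(i in P) (d%:E * b i) <= d%:E * \esum_(i in P) b i.
  move=> d0 b0; apply: ge_ereal_sup => _ [X [fX XP] <-].
  rewrite !fsbig_finite//= big_seq -ge0_sume_distrr; last first.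
    by move=> i; rewrite in_fset_set// inE => /XP /b0.
  rewrite -big_seq; apply: lee_wpmul2l => //; apply: ereal_sup_ubound; exists X => //.
  by rewrite fsbig_finite.
rewrite le_eqVlt => /orP[/eqP <-|c0] a0.
  by rewrite mul0e esum1// => i _; rewrite mul0e.
apply/eqP; rewrite eq_le le1 ?(ltW c0)//=.
rewrite -lee_pdivlMl//.
have := le1 (fun i => c%:E * a i) c^-1%R; rewrite invr_ge0 ltW// => /(_ isT).
under eq_esum do rewrite muleA -EFinM mulVf ?gt_eqF// mul1e.
by apply=> i Pi; apply: mule_ge0; [rewrite lee_fin ltW|exact: a0].
Qed.

Lemma esum_swap (I J : choiceType) (a : I -> J -> \bar R) :
  (forall i j, 0 <= a i j) ->
  \esum_(i in [set: I]) \esum_(j in [set: J]) a i j =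
  \esum_(j in [set: J]) \esum_(i in [set: I]) a i j.
Proof.
move=> a0; rewrite !esum_esum//.
rewrite (@reindex_esum _ _ _ [set: J * I] _ (fun x => (x.2, x.1)))//.
  by rewrite (_ : _ `*`` _ = setT)//; apply/seteqP; split.
split; first by move=> x _.
  by move=> [x y] [x' y'] _ _ /= [-> ->].
by move=> [x y] _; exists (y, x).
Qed.

(** A sum over a countable type is a series along the enumeration of that
type; this gives access to the theorems on the integration of series. *)
Lemma esum_count (I : countType) (P : set I) (a : I -> \bar R) :
  (forall i, P i -> 0 <= a i) ->
  \esum_(i in P) a i =
  \sum_(n <oo) (oapp (fun i => if i \in P then a i else 0) 0 (pickle_inv n)).
Proof.
move=> a0.
pose b n := oapp (fun i => if i \in P then a i else 0) 0 (pickle_inv n) : \bar R.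
have b0 n : 0 <= b n.
  by rewrite /b; case: pickle_inv => //= i; case: ifPn => // /set_mem /a0.
rewrite (nneseries_esumT b0).
rewrite (esumID (pickle @` P)) // [X in _ + X]esum1 ?adde0; last first.
  move=> n [_ nP]; rewrite /b; case e : (pickle_inv n) => [i|//] /=.
  case: ifPn => // /set_mem iP; exfalso; apply: nP; exists i => //.
  by have := @pickle_invK I n; rewrite /obind/oapp e.
rewrite setTI esum_image; last by move=> i j _ _; exact: (pcan_inj pickleK).
by apply: eq_esum => i iP; rewrite /b pickleK_inv/= mem_set.
Qed.

Lemma integral_esum d (T : measurableType d) (mu : {measure set T -> \bar R})
    (D : set T) (I : countType) (P : set I) (h : I -> T -> \bar R) :
  measurable D -> (forall i, measurable_fun D (h i)) ->
  (forall i x, 0 <= h i x) ->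
  \int[mu]_(x in D) (\esum_(i in P) h i x) = \esum_(i in P) \int[mu]_(x in D) h i x.
Proof.
move=> mD mh h0; rewrite esum_count//; last by move=> i _; exact: integral_ge0.
under eq_integral do rewrite esum_count//.
rewrite integral_nneseries//.
- apply: eq_eseriesr => n _; case: (@pickle_inv I n) => [i|] /=; last exact: integral0.
  by case: (i \in P) => //; exact: integral0.
- move=> n; case: (@pickle_inv I n) => [i|] /=; last exact: measurable_cst.
  by case: (i \in P) => //; exact: measurable_cst.
- by move=> n x _ /=; case: (@pickle_inv I n) => [i|] //=; case: ifP.
Qed.

Lemma esum_positive_weights (I : countType) : exists d : I -> R,
  (forall i, 0 < d i)%R /\ \esum_(i in [set: I]) (d i)%:E <= 1.
Proof.
exists (fun i => 1 / (2 ^ (pickle i).+1)%:R)%R; split.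
  by move=> i; rewrite divr_gt0// ltr0n expn_gt0.
rewrite esum_count.
2: by move=> i _; rewrite lee_fin divr_ge0.
apply: le_trans (epsilon_trick0 xpredT (ler01 : 0 <= 1 :> R)%R).
apply: lee_nneseries => [n _ _|n _].
  by case: (@pickle_inv I n) => //= i; case: ifP => // _; rewrite lee_fin divr_ge0.
case e : (@pickle_inv I n) => [i|] /=; last by rewrite lee_fin divr_ge0.
have := @pickle_invK I n; rewrite /obind/oapp e => <-.
by rewrite mem_set.
Qed.

End esum_complements.

Section young_inequality.
Variable R : realType.
Implicit Types (a b c u v w x : R) (f g : int -> R).

(** The exponential lies above its tangent at the weighted mean of the
logarithms; average the three tangent inequalities. *)
Lemma amgm3 al be ga a b c : 0 <= al -> 0 <= be -> 0 <= ga -> al + be + ga = 1 ->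
  0 <= a -> 0 <= b -> 0 <= c ->
  a `^ al * b `^ be * c `^ ga <= al * a + be * b + ga * c.
Proof.
move=> al0 be0 ga0 s1.
have pos x y z : 0 < x -> 0 < y -> 0 < z ->
    x `^ al * y `^ be * z `^ ga <= al * x + be * y + ga * z.
  move=> x0 y0 z0; rewrite /powR !gt_eqF// -!expRD.
  set m := _ + _ + _.
  have tangent t : 0 < t -> expR m * (1 + (ln t - m)) <= t.
    move=> t0; have := expR_ge1Dx (ln t - m).
    by rewrite expRB lnK ?posrE// ler_pdivlMr ?expR_gt0// mulrC.
  apply: (@le_trans _ _ (al * (expR m * (1 + (ln x - m))) +
    be * (expR m * (1 + (ln y - m))) + ga * (expR m * (1 + (ln z - m))))).
    have -> : al * (expR m * (1 + (ln x - m))) + be * (expR m * (1 + (ln y - m))) +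
      ga * (expR m * (1 + (ln z - m))) =
      expR m * ((al + be + ga) * (1 - m) + m) by rewrite /m; ring.
    by rewrite s1 mul1r subrK mulr1.
  by rewrite !lerD// ler_wpM2l// tangent.
(* A vanishing base is harmless: either its exponent is positive and the
   product vanishes, or its exponent is zero and the base may be replaced by 1. *)
have red al' x : 0 <= al' -> 0 <= x -> x `^ al' = 0 \/
    exists2 y, 0 < y & x `^ al' = y `^ al' /\ al' * y = al' * x.
  move=> al'0; rewrite le_eqVlt => /orP[/eqP <-|x0]; last by right; exists x.
  have [->|n0] := eqVneq al' 0; last by left; rewrite powR0.
  by right; exists 1 => //; rewrite !powRr0 !mul0r.
move=> a0 b0 c0.
have rhs0 : 0 <= al * a + be * b + ga * c by rewrite !addr_ge0// mulr_ge0.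
have [->|[x x0 [-> <-]]] := red _ _ al0 a0; first by rewrite !mul0r.
have [->|[y y0 [-> <-]]] := red _ _ be0 b0.
  rewrite mulr0 mul0r !addr_ge0 ?mulr_ge0// ltW//.
have [->|[z z0 [-> <-]]] := red _ _ ga0 c0.
  by rewrite mulr0 !addr_ge0 ?mulr_ge0 ?(ltW x0) ?(ltW y0).
exact: pos.
Qed.

(** The three exponents [w^-1], [u^-1 - w^-1] and [v^-1 - w^-1] add up to 1,
and [a * b] is [x `^ w^-1] times the weighted geometric mean of [a^u b^v / x],
[a^u] and [b^v]. *)
Lemma young_term u v w a b x : 1 <= u -> 1 <= v -> 1 <= w ->
  u^-1 + v^-1 = 1 + w^-1 -> 0 <= a -> 0 <= b -> 0 < x ->
  a * b <= x `^ w^-1 * (w^-1 / x * (a `^ u * b `^ v) +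
    (u^-1 - w^-1) * a `^ u + (v^-1 - w^-1) * b `^ v).
Proof.
move=> u1 v1 w1 uvw a0 b0 x0.
have u0 : 0 < u by lra.
have v0 : 0 < v by lra.
have w0 : 0 < w by lra.
have iv1 : v^-1 <= 1 by rewrite invf_le1.
have iu1 : u^-1 <= 1 by rewrite invf_le1.
have is0 : 0 <= u^-1 - w^-1 by lra.
have ir0 : 0 <= v^-1 - w^-1 by lra.
have iw0 : 0 <= w^-1 by rewrite invr_ge0 ltW.
have := @amgm3 w^-1 (u^-1 - w^-1) (v^-1 - w^-1) (a `^ u * b `^ v / x) (a `^ u) (b `^ v).
have -> : w^-1 + (u^-1 - w^-1) + (v^-1 - w^-1) = 1 by lra.
rewrite !divr_ge0 ?mulr_ge0 ?powR_ge0 ?(ltW x0)//.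
move=> /(_ iw0 is0 ir0 erefl isT isT isT) am.
have xw : 0 < x `^ w^-1 by exact: powR_gt0.
have -> : w^-1 / x * (a `^ u * b `^ v) = w^-1 * (a `^ u * b `^ v / x) by ring.
rewrite -ler_pdivrMl//; apply: le_trans am; rewrite le_eqVlt; apply/orP; left; apply/eqP.
have xV : (x^-1) `^ w^-1 = (x `^ w^-1)^-1 by rewrite -powR_inv1 ?ltW// -powRrM mulN1r powRN.
rewrite !powRM ?mulr_ge0 ?powR_ge0 ?invr_ge0 ?(ltW x0)// xV -!powRrM.
have aE : a = a `^ (u * w^-1) * a `^ (u * (u^-1 - w^-1)).
  have e1 : u * w^-1 + u * (u^-1 - w^-1) = 1.
    by rewrite -mulrDr addrC subrK divff ?gt_eqF.
  by rewrite -powRD e1 ?powRr1// oner_eq0.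
have bE : b = b `^ (v * w^-1) * b `^ (v * (v^-1 - w^-1)).
  have e1 : v * w^-1 + v * (v^-1 - w^-1) = 1.
    by rewrite -mulrDr addrC subrK divff ?gt_eqF.
  by rewrite -powRD e1 ?powRr1// oner_eq0.
rewrite {1}aE {1}bE; ring.
Qed.

Local Open Scope ereal_scope.

(** Let [A n] be the convolution of [f^u] and [g^v]; its total mass is at
most 1. Summing the weighted arithmetic-geometric inequality with [x = A n] gives
[c n <= A n ^ (1 / w)] for the convolution [c] of [f] and [g], hence the sum of
[c n ^ w] is at most that of [A n]. *)
Lemma young_int_normalized u v w f g :
  (1 <= u)%R -> (1 <= v)%R -> (1 <= w)%R -> (u^-1 + v^-1 = 1 + w^-1)%R ->
  (forall k, 0 <= f k)%R -> (forall k, 0 <= g k)%R ->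
  \esum_(k in [set: int]) (f k `^ u)%:E <= 1 ->
  \esum_(k in [set: int]) (g k `^ v)%:E <= 1 ->
  \esum_(n in [set: int])
    (\esum_(k in [set: int]) (f (n - k)%R * g k)%:E) `^ w <= 1.
Proof.
move=> u1 v1 w1 uvw f0 g0 fu gv.
have u0 : (0 < u)%R by lra.
have v0 : (0 < v)%R by lra.
have w0 : (0 < w)%R by lra.
have shiftE (h : int -> \bar R) (n : int) :
    \esum_(k in [set: int]) h (n - k)%R = \esum_(k in [set: int]) h k.
  symmetry; apply: (@reindex_esum _ _ _ [set: int] [set: int] (fun k => n - k)%R).
  split => //; first by move=> k l _ _ /addrI /oppr_inj.
  by move=> k _; exists (n - k)%R => //; rewrite opprB addrC subrK.
have shiftE' (h : int -> \bar R) (k : int) :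
    \esum_(n in [set: int]) h (n - k)%R = \esum_(n in [set: int]) h n.
  symmetry; apply: (@reindex_esum _ _ _ [set: int] [set: int] (fun n => n - k)%R).
  split => //; first by move=> n l _ _ /addIr.
  by move=> n _; exists (n + k)%R => //; rewrite addrK.
pose A n := \esum_(k in [set: int]) (f (n - k)%R `^ u * g k `^ v)%:E.
have A0 n : 0 <= A n by apply: esum_ge0 => k _; rewrite lee_fin mulr_ge0 ?powR_ge0.
have A1 : \esum_(n in [set: int]) A n <= 1.
  rewrite /A esum_swap; last by move=> n k; rewrite lee_fin mulr_ge0 ?powR_ge0.
  apply: le_trans gv; apply: le_esum => k _.
  under eq_esum do rewrite mulrC EFinM.
  rewrite esumZl ?powR_ge0//; last by move=> n _; rewrite lee_fin powR_ge0.
  rewrite (shiftE' (fun n => (f n `^ u)%:E)) -[leRHS]mule1.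
  by apply: lee_wpmul2l => //; rewrite lee_fin powR_ge0.
apply: (le_trans _ A1); apply: le_esum => n _.
have [An0|An0] := eqVneq (A n) 0.
  rewrite An0 esum1 ?poweR0r ?gt_eqF// => k _.
  have : (f (n - k)%R `^ u * g k `^ v)%:E <= 0.
    rewrite -An0; apply: esum_ge; exists [set k] => //.
    by rewrite fsbig_set1.
  rewrite lee_fin le_eqVlt ltNge mulr_ge0 ?powR_ge0//= orbF mulf_eq0 !powR_eq0.
  by rewrite (gt_eqF u0) (gt_eqF v0) !andbT => /orP[/eqP ->|/eqP ->]; rewrite ?mul0r ?mulr0.
have Afin : A n \is a fin_num.
  rewrite ge0_fin_numE//; apply: (@le_lt_trans _ _ 1); last exact: ltry.
  apply: le_trans A1; apply: esum_ge; exists [set n] => //.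
  by rewrite fsbig_set1.
pose x := fine (A n).
have x0 : (0 < x)%R by rewrite fine_gt0// lt0e An0 A0/= ltey_eq Afin.
have xE : A n = x%:E by rewrite /x fineK.
have iv1 : (v^-1 <= 1)%R by rewrite invf_le1.
have iu1 : (u^-1 <= 1)%R by rewrite invf_le1.
have is0 : (0 <= u^-1 - w^-1)%R by lra.
have ir0 : (0 <= v^-1 - w^-1)%R by lra.
have iw0 : (0 <= w^-1)%R by rewrite invr_ge0 ltW.
have term k : (f (n - k) * g k <= x `^ w^-1 * (w^-1 / x * (f (n - k) `^ u * g k `^ v) +
    (u^-1 - w^-1) * f (n - k) `^ u + (v^-1 - w^-1) * g k `^ v))%R.
  exact: young_term.
have le1 : \esum_(k in [set: int]) (f (n - k)%R * g k)%:E <= (x `^ w^-1)%:E.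
  apply: (@le_trans _ _ (\esum_(k in [set: int]) ((x `^ w^-1)%:E *
     ((w^-1 / x)%:E * (f (n - k)%R `^ u * g k `^ v)%:E +
     (u^-1 - w^-1)%:E * (f (n - k)%R `^ u)%:E + (v^-1 - w^-1)%:E * (g k `^ v)%:E)))).
    by apply: le_esum => k _; rewrite -!(EFinD, EFinM) lee_fin.
  have p0 k : 0 <= (w^-1 / x)%:E * (f (n - k)%R `^ u * g k `^ v)%:E.
    by rewrite -EFinM lee_fin !mulr_ge0 ?powR_ge0// invr_ge0 ltW.
  have q0 k : 0 <= (u^-1 - w^-1)%:E * (f (n - k)%R `^ u)%:E.
    by rewrite -EFinM lee_fin !mulr_ge0 ?powR_ge0.
  have r0 k : 0 <= (v^-1 - w^-1)%:E * (g k `^ v)%:E.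
    by rewrite -EFinM lee_fin !mulr_ge0 ?powR_ge0.
  rewrite esumZl ?powR_ge0//; last by move=> k _; rewrite !adde_ge0.
  rewrite -[leRHS]mule1; apply: lee_wpmul2l; first by rewrite lee_fin powR_ge0.
  rewrite esumD//; last by move=> k _; rewrite adde_ge0.
  rewrite esumD// !esumZl//; last 4 first.
  - by move=> k _; rewrite lee_fin powR_ge0.
  - by move=> k _; rewrite lee_fin powR_ge0.
  - by rewrite divr_ge0// ltW.
  - by move=> k _; rewrite lee_fin mulr_ge0 ?powR_ge0.
  rewrite -/(A n) xE (shiftE (fun k => (f k `^ u)%:E)).
  apply: (@le_trans _ _ ((w^-1 / x)%:E * x%:E + (u^-1 - w^-1)%:E * 1 + (v^-1 - w^-1)%:E * 1)).
    by apply: leeD; [apply: leeD => //|]; apply: lee_wpmul2l.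
  by rewrite !mule1 -!(EFinD, EFinM) lee_fin divfK ?gt_eqF//; lra.
rewrite xE; apply: (@le_trans _ _ ((x `^ w^-1)%:E `^ w)).
  apply: gt0_ler_poweR => //; first exact: ltW.
    by rewrite in_itv/= leey andbT; apply: esum_ge0 => k _; rewrite lee_fin mulr_ge0.
  by rewrite in_itv/= leey andbT lee_fin powR_ge0.
by rewrite poweR_EFin -powRrM mulVf ?gt_eqF// powRr1// ltW.
Qed.

(** Young's convolution inequality on the integers. Spaces of summable
sequences increase with the exponent, which is why an inequality between the
exponents is enough. *)
Lemma young_int u v w f g X Y :
  (1 <= u)%R -> (1 <= v)%R -> (1 <= w)%R -> (1 + w^-1 <= u^-1 + v^-1)%R ->
  (forall k, 0 <= f k)%R -> (forall k, 0 <= g k)%R -> (0 < X)%R -> (0 < Y)%R ->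
  \esum_(k in [set: int]) (f k `^ u)%:E <= (X `^ u)%:E ->
  \esum_(k in [set: int]) (g k `^ v)%:E <= (Y `^ v)%:E ->
  \esum_(n in [set: int])
    (\esum_(k in [set: int]) (f (n - k)%R * g k)%:E) `^ w <= ((X * Y) `^ w)%:E.
Proof.
move=> u1 v1 w1 uvw f0 g0 X0 Y0 fu gv.
have u0 : (0 < u)%R by lra.
have v0 : (0 < v)%R by lra.
have w0 : (0 < w)%R by lra.
have iv1 : (v^-1 <= 1)%R by rewrite invf_le1.
have iu1 : (u^-1 <= 1)%R by rewrite invf_le1.
have iw0 : (0 < w^-1)%R by rewrite invr_gt0.
(* Enlarge v until the relation between the exponents is an equality: the
   normalized g is bounded by 1, so its v'-sum is at most its v-sum. *)
pose v' := ((1 + w^-1 - u^-1)^-1)%R.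
have v'0 : (0 < 1 + w^-1 - u^-1)%R by lra.
have vv' : (v <= v')%R.
  by rewrite /v' -[leLHS]invrK lef_pV2 ?posrE ?invr_gt0//; lra.
have v'1 : (1 <= v')%R by exact: le_trans vv'.
have norm (h : int -> R) r Z : (0 < r)%R -> (0 < Z)%R -> (forall k, 0 <= h k)%R ->
    \esum_(k in [set: int]) (h k `^ r)%:E <= (Z `^ r)%:E ->
    \esum_(k in [set: int]) ((h k / Z)%R `^ r)%:E <= 1.
  move=> r0 Z0 h0 hr.
  under eq_esum do rewrite powRM ?invr_ge0 ?(ltW Z0)// mulrC EFinM.
  rewrite esumZl ?powR_ge0//; last by move=> k _; rewrite lee_fin powR_ge0.
  apply: (@le_trans _ _ ((Z^-1 `^ r)%:E * (Z `^ r)%:E)).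
    by apply: lee_wpmul2l => //; rewrite lee_fin powR_ge0.
  by rewrite -EFinM -powRM ?invr_ge0 ?(ltW Z0)// mulVf ?gt_eqF// powR1.
have fX := norm _ _ _ u0 X0 f0 fu.
have gY := norm _ _ _ v0 Y0 g0 gv.
have gY' : \esum_(k in [set: int]) ((g k / Y)%R `^ v')%:E <= 1.
  apply: (le_trans _ gY); apply: le_esum => k _; rewrite lee_fin.
  have t0 : (0 <= g k / Y)%R by rewrite divr_ge0// ltW.
  have : ((g k / Y)%R `^ v)%:E <= 1.
    apply: (le_trans _ gY); apply: esum_ge; exists [set k] => //.
    by rewrite fsbig_set1.
  rewrite lee_fin => tv; move: t0 tv; rewrite le_eqVlt => /orP[/eqP <- _|t0 tv].
    by rewrite !powR0 ?gt_eqF//; lra.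
  apply: ger_powR => //; rewrite t0/= leNgt; apply/negP => t1.
  have := gt0_ltr_powR v0; move=> /(_ 1%R (g k / Y)%R).
  rewrite !nnegrE ler01 (ltW t0) powR1 => /(_ isT isT t1); lra.
have fX0 k : (0 <= f k / X)%R by rewrite divr_ge0// ltW.
have gY0 k : (0 <= g k / Y)%R by rewrite divr_ge0// ltW.
have := @young_int_normalized u v' w (fun k => f k / X)%R (fun k => g k / Y)%R
  u1 v'1 w1 _ fX0 gY0 fX gY'.
rewrite /v' invrK => /(_ _)/wrap[]; first by lra.
move=> yn.
have cE n : \esum_(k in [set: int]) (f (n - k)%R * g k)%:E =
   (X * Y)%:E * \esum_(k in [set: int]) ((f (n - k)%R / X) * (g k / Y))%:E.
  rewrite -esumZl ?mulr_ge0 ?ltW//; last by move=> k _; rewrite lee_fin mulr_ge0.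
  apply: eq_esum => k _; rewrite -EFinM; congr (_%:E).
  by field; rewrite !gt_eqF.
pose c' n := \esum_(k in [set: int]) ((f (n - k)%R / X) * (g k / Y))%:E.
have c'0 n : 0 <= c' n by apply: esum_ge0 => k _; rewrite lee_fin mulr_ge0.
have cw n : (\esum_(k in [set: int]) (f (n - k)%R * g k)%:E) `^ w =
    ((X * Y) `^ w)%:E * (c' n) `^ w.
  by rewrite cE poweRM ?poweR_EFin ?lee_fin ?mulr_ge0 ?(ltW X0) ?(ltW Y0)//; exact: c'0.
under eq_esum do rewrite cw.
rewrite esumZl ?powR_ge0//; last by move=> n _; exact: poweR_ge0.
by rewrite -[leRHS]mule1; apply: lee_wpmul2l => //; rewrite lee_fin powR_ge0.
Qed.

End young_inequality.

(** * Discretization of Lorentz norms *)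

Section lorentz_discretization.
Local Open Scope ereal_scope.
Variables (R : realType) (T : preTopologicalZmodType).
Variable m : {measure set (borel T) -> \bar R}.
Implicit Types (f : T -> R[i]) (p q u w rho t a : R).

Let dr f t := decreasing_rearrangement m f t.

Lemma dr_ge0 f t : 0 <= dr f t.
Proof. by apply: le_ereal_inf_tmp => _ [a [a0 _] <-]; rewrite lee_fin ltW. Qed.

Lemma dr_le f t a : (0 < a)%R -> m [set x | (a < normc (f x))%R] <= t%:E ->
  dr f t <= a%:E.
Proof. by move=> a0 fa; apply: ereal_inf_lbound; exists a. Qed.

Lemma dr_nonincreasing f s t : (s <= t)%R -> dr f t <= dr f s.
Proof.
move=> st; apply: le_ereal_inf => _ [a [a0 da] <-]; exists a => //; split => //.
by apply: le_trans da _; rewrite lee_fin.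
Qed.

Lemma lorentz_normE f p u : (0 < p)%R ->
  lorentz_norm m p%:E u%:E f =
  (\int[lebesgue_measure]_(t in `]0%R, +oo[)
    (((t `^ p^-1)%:E * dr f t) `^ u * (t^-1)%:E)) `^ u^-1.
Proof. by move=> p0; rewrite /lorentz_norm inver gt_eqF. Qed.

Lemma le_poweR (x y : \bar R) (r : R) : (0 <= r)%R -> 0 <= x -> x <= y ->
  x `^ r <= y `^ r.
Proof.
move=> r0 x0 xy; apply: gt0_ler_poweR => //; rewrite in_itv/= leey andbT//.
exact: le_trans xy.
Qed.

Lemma integral_step_esum (D : set R) (s : int -> \bar R) (I : int -> set R) :
  measurable D -> (forall n, measurable (I n)) -> (forall n, 0 <= s n) ->
  \int[lebesgue_measure]_(t in D) (\esum_(n in [set: int]) (s n * (\1_(I n) t)%:E)) =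
  \esum_(n in [set: int]) (s n * lebesgue_measure (I n `&` D)).
Proof.
move=> mD mI s0.
have mi n : measurable_fun D (fun t => (\1_(I n) t : R)%:E).
  by apply/measurable_EFinP; exact: measurable_indic.
rewrite (@integral_esum _ _ _ lebesgue_measure D int setT
    (fun n t => s n * (\1_(I n) t)%:E))//.
- apply: eq_esum => n _; rewrite ge0_integralZl ?integral_indic//; [exact: mI|exact: mi].
- by move=> n; apply: measurable_funeM; exact: mi.
- by move=> n t; rewrite mule_ge0.
Qed.

Lemma esum_indic1 (s : int -> \bar R) (I : int -> set R) t N :
  (forall n, 0 <= s n) -> trivIset setT I -> I N t ->
  \esum_(n in [set: int]) (s n * (\1_(I n) t)%:E) = s N.
Proof.
move=> s0 tI INt.
have t0 n : 0 <= s n * (\1_(I n) t : R)%:E by rewrite mule_ge0.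
rewrite (esumID [set N])// setTI esum_set1// indicE mem_set// mule1.
rewrite esum1 ?adde0// => n [_ /= nN]; rewrite indicE memNset ?mule0// => INt'.
by apply: nN; apply: tI => //; exists t.
Qed.

Lemma powR_int_itv rho t : (1 < rho)%R -> (0 < t)%R ->
  exists N : int, (rho `^ N%:~R <= t < rho `^ (N + 1)%:~R)%R.
Proof.
move=> r1 t0; have r0 : (0 < rho)%R by lra.
have l0 : (0 < ln rho)%R by exact: ln_gt0.
exists (Num.floor (ln t / ln rho)).
have := floor_itv (ln t / ln rho)%R.
rewrite ler_pdivlMr// ltr_pdivrMr// => /andP[h1 h2].
rewrite /powR gt_eqF//; apply/andP; split.
  by rewrite -ler_ln ?posrE ?expR_gt0// expRK.
by rewrite -ltr_ln ?posrE ?expR_gt0// expRK.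
Qed.

Lemma powR_int_itv_trivIset rho : (1 < rho)%R ->
  trivIset setT (fun n : int => `[(rho `^ n%:~R)%R, (rho `^ (n + 1)%:~R)%R[%classic).
Proof.
move=> r1 i j _ _ [t []] /=; rewrite !in_itv/= => /andP[i1 i2] /andP[j1 j2].
have mono (k l : int) : (rho `^ k%:~R < rho `^ (l + 1)%:~R)%R -> (k <= l)%R.
  move=> kl; rewrite leNgt; apply/negP => lk; move: kl; apply/negP; rewrite -leNgt.
  by move: lk; rewrite -lezD1 => lk; rewrite ler_powR ?(ltW r1)// ler_int.
apply/eqP; rewrite eq_le; apply/andP; split; apply: mono.
  exact: le_lt_trans j2.
exact: le_lt_trans i2.
Qed.

(** The rearrangement is nonincreasing: on each cell
[[rho ^ n, rho ^ (n + 1)[] it is at most its value at the left endpoint, and the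
rest of the integrand is constant up to a factor depending on [rho]. So the
Lorentz norm is controlled by an l^w norm of samples. *)
Lemma lorentz_norm_le f q w rho (e : int -> R) (E : R) :
  (0 < q)%R -> (0 < w)%R -> (1 < rho)%R -> (forall n, 0 <= e n)%R -> (0 <= E)%R ->
  (forall n : int, ((rho `^ n%:~R) `^ q^-1)%:E * dr f (rho `^ n%:~R) <= (e n)%:E) ->
  \esum_(n in [set: int]) (e n `^ w)%:E <= (E `^ w)%:E ->
  lorentz_norm m q%:E w%:E f <= (rho `^ q^-1 * (rho - 1) `^ w^-1 * E)%:E.
Proof.
move=> q0 w0 r1 e0 E0 eb eE; rewrite lorentz_normE//.
have r0 : (0 < rho)%R by lra.
have tau0 (n : int) : (0 < rho `^ n%:~R)%R by exact: powR_gt0.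
have tauS (n : int) : (rho `^ (n + 1)%:~R = rho * rho `^ n%:~R)%R.
  rewrite intrD powRD; first by rewrite powRr1 1?mulrC// ltW.
  by apply/implyP => _; rewrite gt_eqF.
have tlt (n : int) : (rho `^ n%:~R < rho `^ (n + 1)%:~R)%R by rewrite tauS ltr_pMl.
pose I n := `[(rho `^ n%:~R)%R, (rho `^ (n + 1)%:~R)%R[%classic : set R.
pose s n := ((rho `^ q^-1 * e n) `^ w * (rho `^ n%:~R)^-1)%R.
have s0 n : (0 <= s n)%R by rewrite /s mulr_ge0 ?powR_ge0// invr_ge0 ltW.
have mI n : measurable (I n) by exact: measurable_itv.
have main : \int[lebesgue_measure]_(t in `]0%R, +oo[)
    (((t `^ q^-1)%:E * dr f t) `^ w * (t^-1)%:E) <=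
    ((rho `^ q^-1) `^ w * (rho - 1) * E `^ w)%:E.
  apply: (@le_trans _ _ (\int[lebesgue_measure]_(t in `]0%R, +oo[)
    (\esum_(n in [set: int]) ((s n)%:E * (\1_(I n) t)%:E)))).
    apply: ge0_le_integral_nomeas => t /=; rewrite in_itv/= andbT => t0.
      by rewrite mule_ge0 ?poweR_ge0// lee_fin invr_ge0 ltW.
    have [N /andP[N1 N2]] := powR_int_itv r1 t0.
    have IN : I N t by rewrite /I/= in_itv/= N1 N2.
    rewrite (@esum_indic1 (fun n => (s n)%:E) I t N)//; last first.
      exact: powR_int_itv_trivIset.
    rewrite /s EFinM; apply: lee_pmul.
    - exact: poweR_ge0.
    - by rewrite lee_fin invr_ge0 ltW.
    - rewrite -[leRHS]poweR_EFin; apply: le_poweR; first exact: ltW.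
        by rewrite mule_ge0 ?lee_fin ?powR_ge0 ?dr_ge0.
      apply: (@le_trans _ _ ((rho `^ q^-1)%:E * (((rho `^ N%:~R) `^ q^-1)%:E * dr f (rho `^ N%:~R)))).
        rewrite muleA -EFinM -powRM ?(ltW r0) ?(ltW (tau0 _))//.
        apply: lee_pmul; rewrite ?lee_fin ?powR_ge0 ?dr_ge0//.
          apply: ge0_ler_powR; rewrite ?nnegrE ?invr_ge0 ?(ltW q0) ?(ltW t0)//.
            by rewrite mulr_ge0 ?ltW.
          by rewrite -tauS ltW.
        exact: dr_nonincreasing.
      by rewrite EFinM; apply: lee_wpmul2l; rewrite ?lee_fin ?powR_ge0.
    - by rewrite lee_fin lef_pV2 ?posrE.
  rewrite (@integral_step_esum _ (fun n => (s n)%:E) I)//.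
  rewrite [leRHS](_ : _ = ((rho `^ q^-1) `^ w * (rho - 1))%:E * (E `^ w)%:E); last first.
    by rewrite -EFinM.
  have c0 : (0 <= (rho `^ q^-1) `^ w * (rho - 1))%R.
    by rewrite mulr_ge0 ?powR_ge0//; lra.
  apply: (@le_trans _ _ (\esum_(n in [set: int])
     (((rho `^ q^-1) `^ w * (rho - 1))%:E * (e n `^ w)%:E))); last first.
    rewrite esumZl//; last by move=> n _; rewrite lee_fin powR_ge0.
    by apply: lee_wpmul2l; rewrite ?lee_fin.
  apply: le_esum => n _.
  have -> : I n `&` `]0%R, +oo[ = I n.
    apply/setIidl => t; rewrite /I/= !in_itv/= andbT => /andP[t1 _].
    exact: lt_le_trans t1.
  rewrite /I lebesgue_measure_itv/= lte_fin tlt.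
  rewrite -EFinB -!EFinM lee_fin tauS /s powRM ?powR_ge0//.
  rewrite le_eqVlt; apply/orP; left; apply/eqP; field; rewrite gt_eqF//.
apply: (@le_trans _ _ ((((rho `^ q^-1) `^ w * (rho - 1) * E `^ w)%:E) `^ w^-1)).
  apply: le_poweR => //; first by rewrite invr_ge0 ltW.
  apply: integral_ge0 => t /=; rewrite in_itv/= andbT => t0.
  by rewrite mule_ge0 ?poweR_ge0// lee_fin invr_ge0 ltW.
have c1 : (0 <= (rho `^ q^-1) `^ w)%R by exact: powR_ge0.
have c2 : (0 <= rho - 1)%R by lra.
have c3 : (0 <= E `^ w)%R by exact: powR_ge0.
have powwV (x : R) : (0 <= x)%R -> ((x `^ w) `^ w^-1 = x)%R.
  by move=> x0; rewrite -powRrM mulfV ?gt_eqF// powRr1.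
rewrite poweR_EFin powRM; [|exact: mulr_ge0|exact: c3].
by rewrite (powRM _ c1 c2) (powwV _ E0) powwV ?powR_ge0.
Qed.

(** Converse of the previous bound, sampling at the right endpoints of the
dyadic cells. *)
Lemma lorentz_norm_ge f p u (X : R) :
  (0 < p)%R -> (0 < u)%R -> (0 <= X)%R ->
  lorentz_norm m p%:E u%:E f <= X%:E ->
  \esum_(j in [set: int]) (((2 `^ j%:~R) `^ p^-1)%:E * dr f (2 `^ j%:~R)) `^ u <=
   ((2 `^ u^-1 * 2 `^ p^-1 * X) `^ u)%:E.
Proof.
move=> p0 u0 X0; rewrite lorentz_normE// => fX.
have tau0 (n : int) : (0 < (2 : R) `^ n%:~R)%R by exact: powR_gt0.
have tauS (n : int) : ((2 : R) `^ (n + 1)%:~R = 2 * 2 `^ n%:~R)%R.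
  rewrite intrD powRD; first by rewrite powRr1 1?mulrC// ltW.
  by apply/implyP => _; rewrite gt_eqF.
have tlt (n : int) : ((2 : R) `^ n%:~R < 2 `^ (n + 1)%:~R)%R.
  by rewrite tauS ltr_pMl// ltr1n.
set H := \int[_]_(t in _) _ in fX.
have H0 : 0 <= H.
  apply: integral_ge0 => t /=; rewrite in_itv/= andbT => t0.
  by rewrite mule_ge0 ?poweR_ge0// lee_fin invr_ge0 ltW.
have HX : H <= (X `^ u)%:E.
  have := le_poweR (ltW u0) (poweR_ge0 _ _) fX.
  by rewrite -poweRrM mulVf ?gt_eqF// poweRe1// poweR_EFin.
pose I (j : int) := `[(2 `^ j%:~R)%R, (2 `^ (j + 1)%:~R)%R[%classic : set R.
pose a j := (((2 `^ j%:~R) `^ p^-1)%:E * dr f (2 `^ (j + 1)%:~R)) `^ u.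
have a0 j : 0 <= a j by exact: poweR_ge0.
pose s j := a j * ((2 `^ (j + 1)%:~R)^-1)%:E.
have s0 j : 0 <= s j by rewrite mule_ge0// lee_fin invr_ge0 ltW.
have mI j : measurable (I j) by exact: measurable_itv.
have step : \esum_(j in [set: int]) (2^-1%:E * a j) <= H.
  apply: (@le_trans _ _ (\int[lebesgue_measure]_(t in `]0%R, +oo[)
    (\esum_(n in [set: int]) (s n * (\1_(I n) t)%:E)))).
    rewrite (@integral_step_esum _ s I)//; apply: le_esum => j _.
    have -> : I j `&` `]0%R, +oo[ = I j.
      apply/setIidl => t; rewrite /I/= !in_itv/= andbT => /andP[t1 _].
      exact: lt_le_trans t1.
    rewrite /I lebesgue_measure_itv/= lte_fin tlt.
    rewrite -EFinB /s -muleA -EFinM muleC.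
    rewrite tauS (_ : ((2 * 2 `^ j%:~R)^-1 * (2 * 2 `^ j%:~R - 2 `^ j%:~R) = 2^-1)%R)//.
    by field; rewrite gt_eqF.
  apply: ge0_le_integral_nomeas => t /=; rewrite in_itv/= andbT => t0.
    by apply: esum_ge0 => n _; rewrite mule_ge0.
  have [N /andP[N1 N2]] := @powR_int_itv 2 t (ltr1n _ 2) t0.
  have IN : I N t by rewrite /I/= in_itv/= N1 N2.
  rewrite (@esum_indic1 s I t N)//; last by apply: powR_int_itv_trivIset; rewrite ltr1n.
  rewrite /s; apply: lee_pmul => //.
  - apply: le_poweR; first exact: ltW.
      by rewrite mule_ge0 ?lee_fin ?powR_ge0 ?dr_ge0.
    apply: lee_pmul; rewrite ?lee_fin ?powR_ge0 ?dr_ge0//.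
      by apply: ge0_ler_powR; rewrite ?nnegrE ?invr_ge0 ?(ltW p0) ?(ltW t0) ?(ltW (tau0 _)).
    by apply: dr_nonincreasing; exact: ltW.
  - by rewrite lee_fin lef_pV2 ?posrE// ltW.
have shift : \esum_(j in [set: int]) (((2 `^ j%:~R) `^ p^-1)%:E * dr f (2 `^ j%:~R)) `^ u =
    \esum_(j in [set: int]) (((2 `^ p^-1) `^ u)%:E * a j).
  rewrite (@reindex_esum _ _ _ [set: int] _ (fun j => j + 1)%R); last first.
    split => //; first by move=> k l _ _ /addIr.
    by move=> k _; exists (k - 1)%R => //; rewrite subrK.
  apply: eq_esum => j _.
  rewrite /a -[((_ `^ u)%R)%:E]poweR_EFin -poweRM; last 2 first.
  - by rewrite lee_fin; exact: powR_ge0.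
  - by apply: mule_ge0; [rewrite lee_fin; exact: powR_ge0|exact: dr_ge0].
  by rewrite muleA -EFinM -(powRM _ (ler0n _ 2) (ltW (tau0 j))) -tauS.
rewrite shift; move: step; rewrite !esumZl ?powR_ge0//.
rewrite lee_pdivrMl// => step.
apply: (@le_trans _ _ (((2 `^ p^-1) `^ u)%:E * (2%:E * (X `^ u)%:E))).
  apply: lee_wpmul2l; first by rewrite lee_fin powR_ge0.
  by apply: le_trans step _; apply: lee_wpmul2l.
rewrite -!EFinM lee_fin !powRM ?mulr_ge0 ?powR_ge0// -[((2 `^ u^-1) `^ u)%R]powRrM mulVf ?gt_eqF// powRr1//.
by rewrite mulrA [(_ * 2)%R]mulrC.
Qed.

End lorentz_discretization.

(** * Decomposition along the rearrangement *)

Section lorentz_pieces.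
Variables (R : realType) (T : preTopologicalZmodType).
Variable m : {measure set (borel T) -> \bar R}.
Implicit Types (f : T -> R[i]) (p u : R).

Lemma measurable_level f (a : R) : cmeasurable f ->
  measurable ([set x | a < normc (f x)] : set (borel T)).
Proof.
move=> mf; have := measurable_normc mf measurableT (measurable_itv `]a, +oo[).
by rewrite setTI set_itvoy.
Qed.

(** The infimum defining the rearrangement may not be attained, but every
level [M + 1 / (n + 1)] is admissible, and the level sets increase to that of
[M]. *)
Lemma measure_level_dr f t (M : R) : cmeasurable f -> 0 <= M ->
  decreasing_rearrangement m f t = M%:E ->
  (m [set x | (M < normc (f x))%R] <= t%:E)%E.
Proof.
move=> mf M0 fM.
pose F n : set (borel T) := [set x | M + n.+1%:R^-1 < normc (f x)].
have mF n : measurable (F n) by exact: measurable_level.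
have -> : [set x | M < normc (f x)] = \bigcup_n F n.
  apply/seteqP; split => [x /= Mx|x [n _] /=]; last first.
    by apply: lt_trans; rewrite ltrDl invr_gt0.
  have fM0 : 0 < normc (f x) - M by rewrite subr_gt0.
  have [n _ nF] := near_infty_natSinv_lt (PosNum fM0); exists n => //.
  by rewrite /F/= addrC -ltrBrDr; exact: (nF n (leqnn n)).
have Ft n : (m (F n) <= t%:E)%E.
  have : (decreasing_rearrangement m f t < (M + n.+1%:R^-1)%:E)%E.
    by rewrite fM lte_fin ltrDl invr_gt0.
  move=> /ereal_inf_lt[_ [a [a0 da] <-]]; rewrite lte_fin => aM.
  apply: le_trans da; apply: le_measure; rewrite ?inE//.
    exact: measurable_level.
  by move=> x /=; apply: lt_trans.
have cvgF : (m (F n) @[n --> \oo] --> m (\bigcup_n F n))%E.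
  apply: nondecreasing_cvg_mu => //; first exact: bigcupT_measurable.
  move=> k l kl; apply/subsetPset => x /=; apply: le_lt_trans.
  by rewrite lerD2l lef_pV2 ?posrE// ler_nat ltnS.
rewrite -(cvg_lim _ cvgF)//; apply: lime_le; first by apply/cvg_ex; eexists; exact: cvgF.
exact: nearW.
Qed.

(** Cut [f] along its rearrangement: with [M j] the value at [2 ^ j], the
piece [D j] is the set where [M (j + 1) < |f| <= M j]. There [f] is bounded by
[M j], and the measure is at most [2 ^ (j + 1)], so each piece has all its
Lebesgue norms under control. [Nul] is the set where [f] exceeds every [M j]; its
measure is at most [2 ^ j] for every [j]. Off it, a point missed by all pieces
has [|f| <= M j] for every [j], and [M j] tends to 0 at infinity because the
samples are summable. *)
Lemma lorentz_pieces f p u (X : R) : 0 < p -> 0 < u -> 0 <= X ->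
  cmeasurable f -> (lorentz_norm m p%:E u%:E f <= X%:E)%E ->
  exists (M : int -> R) (D : int -> set T) (Nul : set T),
  [/\ (forall j, 0 <= M j), (forall j, measurable (D j : set (borel T))),
      (forall j, m (D j) <= (2 `^ (j + 1)%:~R)%:E)%E, trivIset setT D &
      (forall j y, D j y -> normc (f y) <= M j)] /\
  [/\ measurable (Nul : set (borel T)), m Nul = 0%E,
      (forall y, ~ Nul y -> f y != 0 -> exists j, D j y) &
      (\esum_(j in [set: int]) (((2 `^ j%:~R) `^ p^-1 * M j) `^ u)%:E <=
       ((2 `^ u^-1 * 2 `^ p^-1 * X) `^ u)%:E)%E].
Proof.
move=> p0 u0 X0 mf fX.
have ge := lorentz_norm_ge p0 u0 X0 fX.
set K := (2 `^ u^-1 * 2 `^ p^-1 * X) in ge *.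
have K0 : 0 <= K by rewrite !mulr_ge0 ?powR_ge0.
pose dr t := decreasing_rearrangement m f t.
have tau0 (n : int) : (0 < (2 : R) `^ n%:~R)%R by exact: powR_gt0.
have term j : ((((2 `^ j%:~R) `^ p^-1)%:E * dr (2 `^ j%:~R)%R) `^ u <= (K `^ u)%:E)%E.
  apply: (le_trans _ ge); apply: esum_ge; exists [set j] => //.
  by rewrite fsbig_set1.
have drfin j : dr (2 `^ j%:~R)%R \is a fin_num.
  rewrite ge0_fin_numE; last exact: dr_ge0.
  have : (((2 `^ j%:~R) `^ p^-1)%:E * dr (2 `^ j%:~R)%R < +oo)%E.
    apply: (@lty_poweRy _ _ u); first by rewrite gt_eqF.
    exact: le_lt_trans (term j) (ltry _).
  have := dr_ge0 m f (2 `^ j%:~R); rewrite -/(dr _).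
  case: (dr _) => [r _ _|_|//]; first exact: ltry.
  by rewrite gt0_muley// lte_fin powR_gt0.
pose M j := fine (dr (2 `^ j%:~R)%R).
have ME j : dr (2 `^ j%:~R)%R = (M j)%:E by rewrite fineK.
have M0 j : 0 <= M j by apply: fine_ge0; exact: dr_ge0.
have Mni j k : (j <= k) -> M k <= M j.
  move=> jk; rewrite -lee_fin -!ME; apply: dr_nonincreasing.
  by apply: ler_powR; rewrite ?ler_int// ler1n.
pose E j : set T := [set y | M j < normc (f y)].
have mE j : measurable (E j : set (borel T)) by exact: measurable_level.
have Esub j k : j <= k -> E j `<=` E k.
  by move=> /Mni MM y; apply: le_lt_trans.
have Et j : (m (E j) <= (2 `^ j%:~R)%:E)%E by exact: measure_level_dr.
pose D j := E (j + 1) `\` E j.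
pose Nul : set T := \bigcap_n E (- (Posz n)).
have mN : measurable (Nul : set (borel T)) by exact: bigcapT_measurable.
have NulE j : Nul `<=` E j.
  move=> y /(_ `|j|%N I); apply: Esub; rewrite lerNl.
  by rewrite abszE; have := ler_norm (- j); rewrite normrN.
have sums : (\esum_(j in [set: int]) (((2 `^ j%:~R) `^ p^-1 * M j) `^ u)%:E <= (K `^ u)%:E)%E.
  apply: le_trans ge; apply: le_esum => j _.
  by rewrite -/(dr _) ME -EFinM poweR_EFin.
exists M, D, Nul; split; split => //.
- by move=> j; exact: measurableD.
- move=> j; apply: le_trans (Et _); apply: le_measure; rewrite ?inE//.
    exact: measurableD.
  exact: subDsetl.
- move=> i j _ _ [y [[Ei nEi] [Ej nEj]]].
  apply/eqP; rewrite eq_le; apply/andP; split; rewrite leNgt; apply/negP;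
    rewrite -lezD1 => ij.
    by apply: nEi; exact: Esub Ej.
  by apply: nEj; exact: Esub Ei.
- by move=> j y [_ /negP]; rewrite -leNgt.
- apply/eqP; rewrite eq_le measure_ge0 andbT; apply/lee_addgt0Pr => e e0.
  rewrite add0e; have [N /andP[N1 _]] := @powR_int_itv _ 2 e (ltr1n _ 2) e0.
  apply: (@le_trans _ _ (m (E N))); first by apply: le_measure; rewrite ?inE.
  by apply: le_trans (Et N) _; rewrite lee_fin.
move=> y nN fy.
have [a nEa] : exists a, ~ E a y.
  apply: contrapT => h; apply: nN => n _; apply: contrapT => nE; apply: h.
  by exists (- Posz n).
have c0 : 0 < normc (f y).
  rewrite lt_neqAle normc_ge0 andbT eq_sym; apply: contra fy => /eqP.
  by move=> /eq0_normc ->.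
have [b Eb] : exists b, E b y.
  have t0 : 0 < (K / normc (f y)) `^ p + 1 by rewrite ltr_wpDl// powR_ge0.
  have [N /andP[_ N2]] := @powR_int_itv _ 2 _ (ltr1n _ 2) t0.
  exists (N + 1); rewrite /E/= ltNge; apply/negP => yM.
  have := term (N + 1); rewrite ME -EFinM poweR_EFin lee_fin => tK.
  have {}tK : (2 `^ (N + 1)%:~R) `^ p^-1 * M (N + 1) <= K.
    rewrite leNgt; apply/negP => KM; move: tK; apply/negP; rewrite -ltNge.
    by apply: gt0_ltr_powR; rewrite ?nnegrE// mulr_ge0 ?powR_ge0.
  have h1 : (2 `^ (N + 1)%:~R) `^ p^-1 <= K / normc (f y).
    rewrite ler_pdivlMr//; apply: le_trans tK.
    by apply: ler_wpM2l => //; exact: powR_ge0.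
  have h2 : ((2 `^ (N + 1)%:~R) `^ p^-1) `^ p <= (K / normc (f y)) `^ p.
    apply: ge0_ler_powR; rewrite ?nnegrE ?powR_ge0 ?(ltW p0)//.
    by rewrite divr_ge0// ltW.
  move: h2; rewrite -powRrM mulVf ?gt_eqF// powRr1 ?powR_ge0//; lra.
have ab : a <= b.
  by rewrite leNgt; apply/negP => /ltW /Esub ba; apply: nEa; exact: ba.
have [n bE] : exists n : nat, b = a + n%:Z.
  have ba : 0 <= b - a by rewrite subr_ge0.
  by exists `|b - a|%N; rewrite (gez0_abs ba) addrCA subrr addr0.
move: Eb; rewrite bE; elim: n {bE} => [|n IH]; first by rewrite addr0.
have [/IH//|nE] := pselect (E (a + n%:Z) y) => E1.
exists (a + n%:Z); split; last exact: nE.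
by rewrite -addrA -PoszD addn1.
Qed.

End lorentz_pieces.

(** * Real interpolation on sequences *)

Section interpolation.
Variable R : realType.

Lemma powR2_gt1 (s : R) : 0 < s -> 1 < 2 `^ s :> R.
Proof.
move=> s0; have := gt0_ltr_powR s0; move=> /(_ 1 2); rewrite !nnegrE powR1.
by apply => //; rewrite ltr1n.
Qed.

Lemma powR2D (x y : R) : 2 `^ (x + y) = 2 `^ x * 2 `^ y :> R.
Proof. by apply: powRD; apply/implyP => _; rewrite pnatr_eq0. Qed.

(** A weak-type form of Minkowski's inequality: if [T i] has L^2 norm at most
[W i] on [C], then [sum T i >= a] holds on a set of measure at most
[(sum W i / a) ^ 2]. Instead of the norm of an infinite sum, the weighted square
sum [sum T i ^ 2 / V i] is integrated term by term. The weights [V i] are the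
[W i] made positive at the cost of [eta]. *)
Lemma weak_sum d (Z : measurableType d) (m : {measure set Z -> \bar R})
    (I : countType) (P : set I) (T : I -> Z -> R) (W : I -> R) (C : set Z) (L eta a : R) :
  measurable C -> (forall i, measurable_fun setT (T i)) -> (forall i z, 0 <= T i z) ->
  (forall i, 0 <= W i) -> (forall i, \int[m]_(z in C) (T i z ^+ 2)%:E <= (W i ^+ 2)%:E)%E ->
  (\esum_(i in P) (W i)%:E <= L%:E)%E -> 0 <= L -> 0 < eta -> 0 < a ->
  (forall z, C z -> a%:E <= \esum_(i in P) (T i z)%:E)%E ->
  (m C <= (((L + eta) / a) ^+ 2)%:E)%E.
Proof.
move=> mC mT T0 W0 TW WL L0 eta0 a0 aT.
have [d' [d0 d1]] := @esum_positive_weights R I.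
pose V i := W i + eta * d' i.
have V0 i : 0 < V i by rewrite ltr_wpDl// mulr_gt0.
pose L' := L + eta.
have L'0 : 0 < L' by rewrite ltr_wpDl.
have VL : (\esum_(i in P) (V i)%:E <= L'%:E)%E.
  under eq_esum do rewrite EFinD.
  rewrite esumD; last 2 first.
  - by move=> i _; rewrite lee_fin.
  - by move=> i _; rewrite lee_fin mulr_ge0 ?ltW.
  rewrite EFinD; apply: leeD => //; under eq_esum do rewrite EFinM.
  rewrite esumZl ?(ltW eta0)//; last by move=> i _; rewrite lee_fin ltW.
  rewrite -[leRHS]mule1; apply: lee_wpmul2l; first by rewrite lee_fin ltW.
  apply: le_trans d1; rewrite [leRHS](esumID P); last by move=> i _; rewrite lee_fin ltW.
  by rewrite setTI leeDl//; apply: esum_ge0 => i _; rewrite lee_fin ltW.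
pose Q z := (\esum_(i in P) ((T i z) ^+ 2 / V i)%:E)%E.
have Q0 z : (0 <= Q z)%E.
  by apply: esum_ge0 => i _; rewrite lee_fin divr_ge0 ?sqr_ge0// ltW.
(* 2 s T <= s^2 V + T^2 / V, summed over P with the optimal s = a / L'. *)
have low z : C z -> ((a ^+ 2 / L')%:E <= Q z)%E.
  move=> Cz; pose s := a / L'.
  have s0 : 0 < s by rewrite divr_gt0.
  have pt i : 2 * s * T i z <= s ^+ 2 * V i + T i z ^+ 2 / V i.
    have : 0 <= (s * V i - T i z) ^+ 2 / V i by rewrite divr_ge0 ?sqr_ge0// ltW.
    have -> : (s * V i - T i z) ^+ 2 / V i = s ^+ 2 * V i - 2 * s * T i z + T i z ^+ 2 / V i.
      by field; rewrite gt_eqF.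
    lra.
  have s20 : 0 <= 2 * s by apply: mulr_ge0 => //; exact: ltW.
  have h1 : ((2 * s)%:E * a%:E <= (s ^+ 2)%:E * L'%:E + Q z)%E.
    apply: (@le_trans _ _ ((2 * s)%:E * \esum_(i in P) (T i z)%:E)%E).
      by apply: lee_wpmul2l; [rewrite lee_fin|exact: aT].
    rewrite -esumZl//; last by move=> i _; rewrite lee_fin.
    apply: (@le_trans _ _ (\esum_(i in P) ((s ^+ 2)%:E * (V i)%:E + ((T i z) ^+ 2 / V i)%:E))%E).
      by apply: le_esum => i _; rewrite -!EFinM -EFinD lee_fin.
    rewrite esumD; last 2 first.
    - by move=> i _; rewrite -EFinM lee_fin mulr_ge0 ?sqr_ge0// ltW.
    - by move=> i _; rewrite lee_fin divr_ge0 ?sqr_ge0// ltW.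
    apply: leeD => //; rewrite esumZl ?sqr_ge0//; last by move=> i _; rewrite lee_fin ltW.
    by apply: lee_wpmul2l; rewrite ?lee_fin ?sqr_ge0.
  move: (Q0 z) h1; case: (Q z) => [r _|_ _|//]; last by rewrite leey.
  rewrite -!EFinM -EFinD !lee_fin.
  have -> : 2 * s * a = 2 * (a ^+ 2 / L') by rewrite /s; ring.
  have -> : s ^+ 2 * L' = a ^+ 2 / L' by rewrite /s; field; rewrite gt_eqF.
  lra.
have h : ((a ^+ 2 / L')%:E * m C <= L'%:E)%E.
  rewrite -integral_cst//.
  apply: (@le_trans _ _ (\int[m]_(z in C) Q z)%E).
    apply: ge0_le_integral_nomeas => z Cz; last exact: low.
    by rewrite lee_fin divr_ge0 ?sqr_ge0// ltW.
  rewrite /Q (@integral_esum _ _ _ m C I P (fun i z => ((T i z) ^+ 2 / V i)%:E))//; last 2 first.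
  - move=> i; apply: measurable_funTS; apply/measurable_EFinP.
    by apply: measurable_funM => //; exact: measurable_funX.
  - by move=> i z; rewrite lee_fin divr_ge0 ?sqr_ge0// ltW.
  apply: le_trans VL; apply: le_esum => i _.
  under eq_integral do rewrite mulrC EFinM.
  rewrite ge0_integralZl_EFin//; last 3 first.
  - by move=> z _; rewrite lee_fin sqr_ge0.
  - apply: measurable_funTS; apply/measurable_EFinP; exact: measurable_funX.
  - by rewrite invr_ge0 ltW.
  apply: (@le_trans _ _ (((V i)^-1)%:E * (W i ^+ 2)%:E)%E).
    by apply: lee_wpmul2l; rewrite ?lee_fin ?invr_ge0 ?(ltW (V0 i)).
  rewrite -EFinM lee_fin ler_pdivrMl//.
  have WV : W i <= V i by rewrite lerDl mulr_ge0// ltW.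
  by rewrite -expr2 lerXn2r ?nnegrE// (le_trans _ WV).
move: h; rewrite -lee_pdivlMl ?divr_gt0 ?exprn_gt0// => h; apply: le_trans h _.
rewrite -EFinM lee_fin /L' le_eqVlt; apply/orP; left; apply/eqP.
by field; rewrite !gt_eqF.
Qed.

(** Two-sided geometric sequence: what remains of the sup bound (for
[i < 0]) and of the L^2 bound (for [0 <= i]) at distance [i] from the splitting
index. *)
Definition kernel (del lam : R) (i : int) : R :=
  if 0 <= i then 2 `^ (- (del * i%:~R)) else 2 `^ (lam * i%:~R).

Lemma kernel_ge0 del lam i : 0 <= kernel del lam i.
Proof. by rewrite /kernel; case: ifP; rewrite powR_ge0. Qed.

Lemma geometric_esum (s : R) : 0 < s ->
  (\esum_(n in [set: nat]) (2 `^ (- (s * n%:R)))%:E <= ((1 - 2 `^ (- s))^-1)%:E)%E.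
Proof.
move=> s0; set r := 2 `^ (- s).
have r0 : 0 < r by exact: powR_gt0.
have r1 : r < 1.
  by rewrite /r powRN invf_lt1 ?powR_gt0//; exact: powR2_gt1.
have rE n : 2 `^ (- (s * n%:R)) = r ^+ n.
  by rewrite /r -powR_mulrn ?powR_ge0// -powRrM mulNr.
under eq_esum do rewrite rE.
rewrite -nneseries_esumT; last by move=> n; rewrite lee_fin exprn_ge0// ltW.
apply: lime_le; first by apply: is_cvg_nneseries => n _ _; rewrite lee_fin exprn_ge0// ltW.
apply: nearW => n; rewrite sumEFin lee_fin.
rewrite -div1r ler_pdivlMr ?subr_gt0// big_mkord mulrC -opprB mulNr -subrX1 opprB.
by rewrite gerBl exprn_ge0// ltW.
Qed.

Lemma kernel_summable del lam : 0 < del -> 0 < lam ->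
  exists2 k1 : R, 0 < k1 & (\esum_(i in [set: int]) (kernel del lam i)%:E <= k1%:E)%E.
Proof.
move=> del0 lam0.
have pos (s : R) : 0 < s -> 0 < (1 - 2 `^ (- s))^-1.
  move=> s0; rewrite invr_gt0 subr_gt0 powRN invf_lt1 ?powR_gt0//.
  exact: powR2_gt1.
exists ((1 - 2 `^ (- del))^-1 + (1 - 2 `^ (- lam))^-1); first by rewrite addr_gt0 ?pos.
have k0 i : (0 <= (kernel del lam i)%:E)%E by rewrite lee_fin kernel_ge0.
rewrite (esumID [set i : int | 0 <= i])// !setTI EFinD; apply: leeD.
  apply: le_trans (geometric_esum del0).
  have -> : [set i : int | 0 <= i] = Posz @` [set: nat].
    apply/seteqP; split => [[n|n] //= _|_ [n _ <-]//]; first by exists n.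
  rewrite esum_image; last by move=> i j _ _ [].
  by apply: le_esum => n _; rewrite /kernel.
apply: le_trans (geometric_esum lam0).
have -> : ~` [set i : int | 0 <= i] = Negz @` [set: nat].
  by apply/seteqP; split => [[n|n] //= _|_ [n _ <-]//]; exists n.
rewrite esum_image; last by move=> i j _ _ [].
apply: le_esum => n _; rewrite /kernel/= lee_fin; apply: ler_powR; first by rewrite ler1n.
rewrite NegzE mulrNz mulrN lerN2 ler_pM2l//= ler_nat//.
Qed.

Lemma esum_pairs (h : int * int -> \bar R) : (forall x, 0 <= h x)%E ->
  (\esum_(x in [set: int * int]) h x =
   \esum_(n in [set: int]) \esum_(k in [set: int]) h ((n - k)%R, k))%E.
Proof.
move=> h0; rewrite esum_esum//.
rewrite (@reindex_esum _ _ _ [set: int * int] _ (fun x => (x.1 - x.2, x.2))).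
  by rewrite (_ : _ `*`` _ = setT)//; apply/seteqP; split.
split; first by move=> x _.
  by move=> [n k] [n' k'] _ _ /= [nk ek]; move: nk; rewrite ek => /addIr ->.
by move=> [j k] _; exists (j + k, k) => //=; rewrite addrK.
Qed.

(** Two applications of Young's inequality, to [f * g] and then to its
convolution with the summable kernel. *)
Lemma kernel_convolution (f g : int -> R) (u v w del lam X Y k1 : R) :
  1 <= u -> 1 <= v -> 1 <= w -> 1 + w^-1 <= u^-1 + v^-1 ->
  (forall k, 0 <= f k) -> (forall k, 0 <= g k) -> 0 < X -> 0 < Y ->
  (\esum_(k in [set: int]) (f k `^ u)%:E <= (X `^ u)%:E)%E ->
  (\esum_(k in [set: int]) (g k `^ v)%:E <= (Y `^ v)%:E)%E ->
  0 < k1 -> (\esum_(i in [set: int]) (kernel del lam i)%:E <= k1%:E)%E ->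
  exists er : int -> R, [/\ forall N, 0 <= er N,
    forall N, ((er N)%:E = \esum_(x in [set: int * int])
      (kernel del lam (N - (x.1 + x.2))%R * (f x.1 * g x.2))%:E)%E &
    (\esum_(N in [set: int]) (er N `^ w)%:E <= ((k1 * (X * Y)) `^ w)%:E)%E].
Proof.
move=> u1 v1 w1 uvw f0 g0 X0 Y0 fX gY k10 kk.
have w0 : 0 < w by lra.
(* First convolution: c = f * g lies in l^w. *)
have cw := young_int u1 v1 w1 uvw f0 g0 X0 Y0 fX gY.
pose c n := (\esum_(k in [set: int]) (f (n - k)%R * g k)%:E)%E.
have c0 n : (0 <= c n)%E by apply: esum_ge0 => k _; rewrite lee_fin mulr_ge0.
have finw (h : int -> \bar R) (E : R) n : (forall n, 0 <= h n)%E ->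
    (\esum_(n in [set: int]) (h n `^ w) <= E%:E)%E -> h n \is a fin_num.
  move=> h0 hE; rewrite ge0_fin_numE//; apply: (@lty_poweRy _ _ w); first by rewrite gt_eqF.
  apply: (@le_lt_trans _ _ E%:E); last exact: ltry.
  apply: le_trans hE; apply: esum_ge; exists [set n] => //.
  by rewrite fsbig_set1.
have cfin n : c n \is a fin_num by exact: (finw c _ n c0 cw).
pose cr n := fine (c n).
have crE n : (cr n)%:E = c n by rewrite fineK.
have cr0 n : 0 <= cr n by exact: fine_ge0.
have XY0 : 0 < X * Y by rewrite mulr_gt0.
have crw : (\esum_(n in [set: int]) (cr n `^ w)%:E <= ((X * Y) `^ w)%:E)%E.
  by apply: le_trans cw; apply: le_esum => n _; rewrite -poweR_EFin crE.
(* Second convolution, with the summable kernel: e = kernel * c lies in l^w. *)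
have kk1 : (\esum_(i in [set: int]) (kernel del lam i `^ 1)%:E <= (k1 `^ 1)%:E)%E.
  rewrite powRr1 ?(ltW k10)//; apply: le_trans kk; apply: le_esum => i _.
  by rewrite powRr1// kernel_ge0.
have uw : 1 + w^-1 <= 1^-1 + w^-1 by rewrite invr1.
have ew := young_int (lexx 1) w1 w1 uw (kernel_ge0 del lam) cr0 k10 XY0 kk1 crw.
pose e N := (\esum_(n in [set: int]) (kernel del lam (N - n)%R * cr n)%:E)%E.
have e0 N : (0 <= e N)%E by apply: esum_ge0 => n _; rewrite lee_fin mulr_ge0 ?kernel_ge0.
have efin N : e N \is a fin_num by exact: (finw e _ N e0 ew).
pose er N := fine (e N).
have erE N : (er N)%:E = e N by rewrite fineK.
have er0 N : 0 <= er N by exact: fine_ge0.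
have ePairs N : e N = (\esum_(x in [set: int * int])
    (kernel del lam (N - (x.1 + x.2))%R * (f x.1 * g x.2))%:E)%E.
  rewrite esum_pairs; last by move=> x; rewrite lee_fin !mulr_ge0 ?kernel_ge0.
  apply: eq_esum => n _ /=; rewrite EFinM crE /c -esumZl ?kernel_ge0//; last first.
    by move=> k _; rewrite lee_fin mulr_ge0.
  by apply: eq_esum => k _; rewrite subrK EFinM.
exists er; split => //; first by move=> N; rewrite erE ePairs.
by apply: le_trans ew; apply: le_esum => n _; rewrite -poweR_EFin erE.
Qed.

(** Real interpolation between an L^2 and a sup bound, written on the
sequences themselves. Put [x = (j, k)] and [n = j + k]. At the height
[tau = 2 ^ (lam q N)] split the family at [n = N]: the terms with [n <= N] are
controlled in L^2 through [weak_sum], the others in sup norm. After multiplication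
by [tau ^ (1 / q)] the two contributions have the same form, that of a convolution
of [f * g] with a kernel decaying geometrically on both sides of [N]; this is how
[lam], [del] and the height are tied together. Hence the samples
[tau ^ (1 / q) F* (tau)] form a sequence in l^w. *)
Lemma interpolation (Z : preTopologicalZmodType) (m : {measure set (borel Z) -> \bar R})
    (F : Z -> R[i]) (T : int * int -> Z -> R) (f g : int -> R)
    (q u v w lam del K X Y k1 : R) :
  hausdorff_space Z -> radon_measure m -> continuous F ->
  (forall x, measurable_fun [set: borel Z] (T x : borel Z -> R)) ->
  (forall x z, 0 <= T x z) ->
  (forall z, (normc (F z))%:E <= \esum_(x in [set: int * int]) (T x z)%:E)%E ->
  (forall x z, T x z <= K * (f x.1 * g x.2) * 2 `^ (- (lam * (x.1 + x.2)%:~R))) ->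
  (forall x (C : set Z), compact C ->
    \int[m]_(z in (C : set (borel Z))) (T x z ^+ 2)%:E <=
    ((K * (f x.1 * g x.2) * 2 `^ (del * (x.1 + x.2)%:~R)) ^+ 2)%:E)%E ->
  2 < q -> 0 < lam -> del = lam * (q - 2) / 2 -> 0 < K ->
  1 <= u -> 1 <= v -> 1 <= w -> 1 + w^-1 <= u^-1 + v^-1 ->
  (forall k, 0 <= f k) -> (forall k, 0 <= g k) -> 0 < X -> 0 < Y ->
  (\esum_(k in [set: int]) (f k `^ u)%:E <= (X `^ u)%:E)%E ->
  (\esum_(k in [set: int]) (g k `^ v)%:E <= (Y `^ v)%:E)%E ->
  0 < k1 -> (\esum_(i in [set: int]) (kernel del lam i)%:E <= k1%:E)%E ->
  (lorentz_norm m q%:E w%:E F <=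
   ((2 `^ (lam * q)) `^ q^-1 * (2 `^ (lam * q) - 1) `^ w^-1 * (K * (k1 * (X * Y))))%:E)%E.
Proof.
move=> hZ mR cF mT T0 FT Tsup TL2 q2 lam0 delE K0 u1 v1 w1 uvw f0 g0 X0 Y0 fX gY k10 kk.
have q0 : 0 < q by lra.
have w0 : 0 < w by lra.
have rho1 : 1 < 2 `^ (lam * q) :> R by apply: powR2_gt1; exact: mulr_gt0.
set rho : R := 2 `^ (lam * q) in rho1 *.
have [er [er0 ePairs ew]] := kernel_convolution u1 v1 w1 uvw f0 g0 X0 Y0 fX gY k10 kk.
apply: (@lorentz_norm_le _ _ m F q w rho (fun n => K * er n)) => //.
- by move=> n; rewrite mulr_ge0// ltW.
- by rewrite !mulr_ge0 ?ltW.
- move=> N.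
  pose P := [set x : int * int | x.1 + x.2 <= N].
  pose h (x : int * int) := kernel del lam (N - (x.1 + x.2)) * (f x.1 * g x.2).
  have h0 x : 0 <= h x by rewrite /h !mulr_ge0 ?kernel_ge0.
  have S12 : ((er N)%:E = \esum_(x in P) (h x)%:E + \esum_(x in ~` P) (h x)%:E)%E.
    by rewrite ePairs (esumID P) ?setTI// => x _; rewrite lee_fin h0.
  have S1p : (0 <= \esum_(x in P) (h x)%:E)%E by apply: esum_ge0 => x _; rewrite lee_fin.
  have S2p : (0 <= \esum_(x in ~` P) (h x)%:E)%E by apply: esum_ge0 => x _; rewrite lee_fin.
  have S1fin : \esum_(x in P) (h x)%:E \is a fin_num.
    by rewrite ge0_fin_numE//; apply: (@le_lt_trans _ _ (er N)%:E); rewrite ?ltry// S12 leeDl.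
  have S2fin : \esum_(x in ~` P) (h x)%:E \is a fin_num.
    by rewrite ge0_fin_numE//; apply: (@le_lt_trans _ _ (er N)%:E); rewrite ?ltry// S12 leeDr.
  pose s1 := fine (\esum_(x in P) (h x)%:E); pose s2 := fine (\esum_(x in ~` P) (h x)%:E).
  have s10 : 0 <= s1 by exact: fine_ge0.
  have s20 : 0 <= s2 by exact: fine_ge0.
  have s1E : (s1%:E = \esum_(x in P) (h x)%:E)%E by rewrite fineK.
  have s2E : (s2%:E = \esum_(x in ~` P) (h x)%:E)%E by rewrite fineK.
  have ers : er N = s1 + s2 by apply: EFin_inj; rewrite S12 EFinD s1E s2E.
  pose a1 : R := 2 `^ (lam * N%:~R); pose a2 : R := 2 `^ (del * N%:~R).
  have a10 : 0 < a1 by exact: powR_gt0.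
  have a20 : 0 < a2 by exact: powR_gt0.
  have tauE : rho `^ N%:~R = (a1 * a2) ^+ 2.
    rewrite /rho -powRrM expr2 /a1 /a2 -!powR2D; congr (2 `^ _).
    by rewrite delE; field.
  have tauq : (rho `^ N%:~R) `^ q^-1 = a1.
    rewrite /rho /a1 -!powRrM; congr (_ `^ _).
    by field; rewrite gt_eqF.
  pose L := K * a2 * s1; pose b := K * a1^-1 * s2.
  have L0 : 0 <= L by rewrite !mulr_ge0// ltW.
  have b0 : 0 <= b by rewrite !mulr_ge0// ?invr_ge0 ltW.
  have PW : (\esum_(x in P) (K * (f x.1 * g x.2) * 2 `^ (del * (x.1 + x.2)%:~R))%:E <= L%:E)%E.
    have Ka2 : 0 <= K * a2 by apply: mulr_ge0; exact: ltW.
    rewrite /L EFinM s1E -esumZl//; last by move=> x _; rewrite lee_fin.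
    apply: le_esum => x /= xN; rewrite -EFinM lee_fin /h /kernel subr_ge0 xN.
    have -> : a2 = 2 `^ (del * (N - (x.1 + x.2))%:~R) * 2 `^ (del * (x.1 + x.2)%:~R).
      by rewrite -powR2D -mulrDr -intrD subrK.
    rewrite powRN; set p1 := 2 `^ _; have p10 : 0 < p1 by exact: powR_gt0.
    by rewrite le_eqVlt; apply/orP; left; apply/eqP; field; rewrite gt_eqF.
  have PT z : (\esum_(x in ~` P) (T x z)%:E <= b%:E)%E.
    have Ka1 : 0 <= K * a1^-1 by apply: mulr_ge0; rewrite ?invr_ge0; exact: ltW.
    rewrite /b EFinM s2E -esumZl//; last by move=> x _; rewrite lee_fin.
    apply: le_esum => x /= /negP/negbTE xN; rewrite -EFinM lee_fin.
    apply: le_trans (Tsup x z) _; rewrite /h /kernel subr_ge0 xN.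
    have -> : a1^-1 = 2 `^ (- (lam * N%:~R)) by rewrite powRN.
    have -> : 2 `^ (- (lam * (x.1 + x.2)%:~R)) = 2 `^ (- (lam * N%:~R)) * 2 `^ (lam * (N - (x.1 + x.2))%:~R) :> R.
      by rewrite -powR2D intrB; congr (_ `^ _); ring.
    by rewrite le_eqVlt; apply/orP; left; apply/eqP; ring.
  have bound eta : 0 < eta ->
      (decreasing_rearrangement m F (rho `^ N%:~R) <= ((L + eta) / (a1 * a2) + b)%:E)%E.
    move=> eta0; set a' := (L + eta) / (a1 * a2).
    have a'0 : 0 < a' by rewrite divr_gt0 ?mulr_gt0// ltr_wpDl.
    apply: dr_le; first by rewrite ltr_wpDr.
    have oU : open [set z | a' + b < normc (F z)].
      have -> : [set z | a' + b < normc (F z)] = (fun z => normc (F z)) @^-1` [set r | a' + b < r] by [].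
      apply: open_comp; last exact: open_gt.
      move=> z _; apply: (@continuous_comp _ _ _ F (@normc R)); first exact: cF.
      exact: normc_continuous.
    have [_ _ /(_ _ oU) ->] := mR.
    apply: ge_ereal_sup => _ [C [cC CU] <-].
    have mC := @compact_borel _ _ hZ cC.
    have -> : rho `^ N%:~R = ((L + eta) / a') ^+ 2.
      rewrite tauE /a'; congr (_ ^+ 2); field.
      by rewrite !gt_eqF// ltr_wpDl.
    apply: (@weak_sum _ _ m _ P T (fun x => K * (f x.1 * g x.2) * 2 `^ (del * (x.1 + x.2)%:~R)) C L eta a') => //.
    - by move=> x; rewrite !mulr_ge0 ?powR_ge0// ltW.
    - by move=> x; exact: TL2.
    - move=> z /CU /= az; have := FT z; rewrite (esumID P) ?setTI; last by move=> x _; rewrite lee_fin.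
      move=> Fz; have := le_trans Fz (leeD2l _ (PT z)).
      have : (0 <= \esum_(x in P) (T x z)%:E)%E by apply: esum_ge0 => x _; rewrite lee_fin.
      case: (\esum_(x in P) (T x z)%:E) => [r _|_ _|//]; last by rewrite leey.
      rewrite -EFinD !lee_fin => Fr.
      by rewrite -(lerD2r b); apply: le_trans Fr; exact: ltW.
  rewrite tauq; apply/lee_addgt0Pr => eps eps0.
  have := bound (eps * a2) (mulr_gt0 eps0 a20).
  move=> hb; apply: (@le_trans _ _ (a1%:E * ((L + eps * a2) / (a1 * a2) + b)%:E)%E).
    by apply: lee_wpmul2l => //; rewrite lee_fin ltW.
  rewrite -EFinM -EFinD lee_fin ers /L /b le_eqVlt; apply/orP; left; apply/eqP.
  by field; rewrite !gt_eqF.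
under eq_esum do rewrite powRM ?(ltW K0)// EFinM.
rewrite esumZl ?powR_ge0//; last by move=> n _; rewrite lee_fin powR_ge0.
rewrite powRM ?(ltW K0) ?mulr_ge0 ?(ltW k10) ?(ltW X0) ?(ltW Y0)// EFinM.
by apply: lee_wpmul2l; first by rewrite lee_fin powR_ge0.
Qed.

End interpolation.

(** * The transform as the sum of the transforms of the pieces *)

Section stft_sum.
Variables (R : realType) (G : topologicalZmodType).
Variable mu : {measure set (borel G) -> \bar R}.
Hypothesis hG : hausdorff_space G.
Hypothesis mu_haar : haar_measure mu.
Implicit Types (f g : G -> R[i]).

Lemma esum_tail (I : choiceType) (a : I -> \bar R) (e : R) :
  (forall i, 0 <= a i)%E -> (\esum_(i in [set: I]) a i < +oo)%E -> 0 < e ->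
  exists2 X : seq I, uniq X & (\esum_(i in ~` [set` X]) a i <= e%:E)%E.
Proof.
move=> a0 afin e0.
have af : \esum_(i in [set: I]) a i \is a fin_num.
  by rewrite ge0_fin_numE//; apply: esum_ge0.
have : (\esum_(i in [set: I]) a i - e%:E < \esum_(i in [set: I]) a i)%E.
  by rewrite lteBlDr// lteDl// lte_fin.
rewrite [X in (_ < X)%E]/esum => /ereal_sup_gt[_ [Y [fY _] <-]] Ye.
exists (finmap.enum_fset (fset_set Y)); first exact: finmap.fset_uniq.
have -> : [set` finmap.enum_fset (fset_set Y)] = Y.
  by apply/seteqP; split => i /=; rewrite in_fset_set// ?inE.
have := @esumID _ _ Y setT a (fun i _ => a0 i); rewrite setTI.
have -> : (\esum_(i in Y) a i = \sum_(i \in Y) a i)%E by rewrite esum_fset.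
move=> aE.
have Yfin : (\sum_(i \in Y) a i)%E \is a fin_num.
  rewrite ge0_fin_numE; last first.
    by rewrite fsbig_finite//=; apply: sume_ge0 => i _.
  apply: le_lt_trans afin; rewrite aE leeDl//; exact: esum_ge0.
move: Ye; rewrite aE lteBlDr// lteD2lE// setTI; exact: ltW.
Qed.

Lemma modulated_null f g z y : f y = 0 \/ g (y - z.1) = 0 -> modulated f g z y = 0.
Proof.
rewrite /modulated /windowed /translate => -[->|->]; first by rewrite !mul0r.
by rewrite rmorph0 mulr0 mul0r.
Qed.

Definition piece f (A : set G) : G -> R[i] := fun y => f y * (\1_A y)%:C%C.

Lemma piece_in f A y : A y -> piece f A y = f y.
Proof. by move=> Ay; rewrite /piece indicE mem_set// mulr1. Qed.

Lemma piece_out f A y : ~ A y -> piece f A y = 0.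
Proof. by move=> Ay; rewrite /piece indicE memNset// mulr0. Qed.

Lemma finbdd_piece f A M : cmeasurable f -> measurable (A : set (borel G)) ->
  (mu A < +oo)%E -> 0 <= M -> (forall y, A y -> normc (f y) <= M) ->
  finbdd mu (piece f A) M A.
Proof.
move=> mf mA Afin M0 fM; split => //.
  by apply: cmeasurableM => //; exact: cmeasurable_indic.
move=> y; have [Ay|nAy] := pselect (A y).
  by rewrite piece_in// indicE mem_set// mulr1 fM.
by rewrite piece_out// normc0 mulr_ge0// indicE ler0n.
Qed.

Variables (f g : G -> R[i]) (D E : int -> set G) (M N : int -> R) (Nf Ng : set G).
Hypothesis mf : cmeasurable f.
Hypothesis mg : cmeasurable g.
Hypothesis fD : forall j, finbdd mu (piece f (D j)) (M j) (D j).
Hypothesis gE : forall k, finbdd mu (piece g (E k)) (N k) (E k).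
Hypothesis tD : trivIset setT D.
Hypothesis tE : trivIset setT E.
Hypothesis mNf : measurable (Nf : set (borel G)).
Hypothesis mNg : measurable (Ng : set (borel G)).
Hypothesis Nf0 : mu Nf = 0%E.
Hypothesis Ng0 : mu Ng = 0%E.
Hypothesis covf : forall y, ~ Nf y -> f y != 0 -> exists j, D j y.
Hypothesis covg : forall y, ~ Ng y -> g y != 0 -> exists j, E j y.

Let T (x : int * int) z := stft mu (piece g (E x.2)) (piece f (D x.1)) z.
Let bet (x : int * int) : \bar R :=
  ((M x.1 * N x.2)%:E * Order.min (mu (D x.1)) (mu (E x.2)))%E.
Hypothesis bet_fin : (\esum_(x in [set: int * int]) bet x < +oo)%E.

Let mod z x y := modulated (piece f (D x.1)) (piece g (E x.2)) z y.

(** Off the null sets at most one product of pieces is nonzero at [y], and if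
the product of [f] with the translated [g] does not vanish at [y] it equals that
one. *)
Lemma modulated_pieces z y (X : seq (int * int)) : uniq X -> ~ Nf y -> ~ Ng (y - z.1) ->
  ((normc (modulated f g z y - \sum_(x <- X) mod z x y))%:E <=
   \esum_(x in ~` [set` X]) (normc (mod z x y))%:E)%E.
Proof.
move=> uX nNf nNg.
have es0 : (0 <= \esum_(x in ~` [set` X]) (normc (mod z x y))%:E)%E.
  by apply: esum_ge0 => x _; rewrite lee_fin normc_ge0.
have [f0|fn0] := eqVneq (f y) 0.
  have h0 x : mod z x y = 0 by apply: modulated_null; left; rewrite /piece f0 mul0r.
  by rewrite big1// modulated_null ?subr0 ?normc0//; left.
have [g0|gn0] := eqVneq (g (y - z.1)) 0.
  have h0 x : mod z x y = 0 by apply: modulated_null; right; rewrite /piece g0 mul0r.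
  by rewrite big1// modulated_null ?subr0 ?normc0//; right.
have [j Dj] := covf nNf fn0; have [k Ek] := covg nNg gn0.
have modjk : mod z (j, k) y = modulated f g z y.
  by rewrite /mod /modulated /windowed /translate/= !piece_in.
have mod0 x : x != (j, k) -> mod z x y = 0.
  move: x => [j' k']; rewrite xpair_eqE negb_and => /orP[jj|kk].
    apply: modulated_null; left; apply: piece_out => /= Dj'.
    by move/eqP: jj; apply; apply: tD => //; exists y.
  apply: modulated_null; right; apply: piece_out => /= Ek'.
  by move/eqP: kk; apply; apply: tE => //; exists (y - z.1).
have [XI|nXI] := boolP ((j, k) \in X).
  rewrite (bigD1_seq (j, k))//= big1 ?addr0 ?modjk ?subrr ?normc0//.
rewrite big_seq big1 ?subr0; last first.
  by move=> x xX; apply: mod0; apply: contraNneq nXI => <-.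
rewrite -modjk; apply: esum_ge; exists [set (j, k)]; last by rewrite fsbig_set1.
by split => // x /= ->; exact/negP.
Qed.

Lemma int_modulated_pieces z (X : seq (int * int)) : uniq X ->
  (\int[mu]_y (normc (modulated f g z y - \sum_(x <- X) mod z x y))%:E <=
   \esum_(x in ~` [set` X]) bet x)%E.
Proof.
move=> uX; have [mu_radon mu_n0 mu_inv] := mu_haar.
have mmod x : cmeasurable (mod z x).
  by apply: cmeasurable_modulated; [exact: fb_meas (fD _)|exact: fb_meas (gE _)].
have mdiff : cmeasurable (fun y => modulated f g z y - \sum_(x <- X) mod z x y).
  apply: cmeasurableB; first exact: cmeasurable_modulated.
  elim: (X) => [|x s IH].
    under [Z in cmeasurable Z]eq_fun do rewrite big_nil.
    exact: (cintegrable0 mu).1.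
  under [Z in cmeasurable Z]eq_fun do rewrite big_cons.
  exact: cmeasurableD.
pose Nul := Nf `|` shift z.1 Ng.
have mNul : measurable (Nul : set (borel G)).
  by apply: measurableU => //; exact: measurable_shift.
have Nul0 : mu Nul = 0%E.
  apply/eqP; rewrite eq_le measure_ge0 andbT.
  have h : (mu (shift z.1 Ng) = 0)%E by rewrite measure_shift.
  apply: le_trans (measureU2 _ _ _) _ => //; first exact: measurable_shift.
  have h2 : (mu Nf + mu (shift z.1 Ng) <= 0)%E by rewrite Nf0 h adde0.
  exact: h2.
rewrite (ge0_negligible_integral mNul measurableT _ _ Nul0); last 2 first.
- by apply/measurable_EFinP; exact: measurable_normc.
- by move=> y _; rewrite lee_fin normc_ge0.
apply: (@le_trans _ _ (\int[mu]_(y in setT `\` Nul)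
   (\esum_(x in ~` [set` X]) (normc (mod z x y))%:E))%E).
  apply: ge0_le_integral_nomeas => y [_ nN]; first by rewrite lee_fin normc_ge0.
  by apply: (modulated_pieces uX) => h; apply: nN; [left|right].
have mT : measurable (setT `\` Nul : set (borel G)) by exact: measurableD.
rewrite (@integral_esum _ _ _ mu _ _ (~` [set` X]) (fun x y => (normc (mod z x y))%:E))//; last 2 first.
- move=> x; apply: measurable_funTS; apply/measurable_EFinP; exact: measurable_normc.
- by move=> x y; rewrite lee_fin normc_ge0.
apply: le_esum => x _.
have fg := finbdd_windowed z.1 (fD x.1) (gE x.2).
apply: (@le_trans _ _ ((M x.1 * N x.2)%:E * mu (shift z.1 (E x.2) `&` D x.1))%E).
  apply: le_trans (finbdd_int fg).
  apply: (@le_trans _ _ (\int[mu]_y (normc (mod z x y))%:E)%E); last first.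
    by apply: ge0_le_integral_nomeas => y _; rewrite lee_fin ?normc_ge0// normc_modulated.
  rewrite [leLHS]integral_mkcond; apply: ge0_le_integral_nomeas => y _; rewrite /patch; case: ifP => // _;
   by rewrite lee_fin normc_ge0.
apply: lee_wpmul2l; first by rewrite lee_fin (fb_ge0 fg).
have mDx := fb_set (fD x.1); have mEx := fb_set (gE x.2).
rewrite le_min; apply/andP; split.
  by apply: le_measure => //; apply/mem_set => //; exact: (fb_set fg).
rewrite -(measure_shift mu_inv z.1 mEx).
by apply: le_measure => //; apply/mem_set; [exact: (fb_set fg)|exact: measurable_shift].
Qed.

Lemma bet_ge0 x : (0 <= bet x)%E.
Proof.
by rewrite /bet mule_ge0// ?lee_fin ?mulr_ge0 ?(fb_ge0 (fD _)) ?(fb_ge0 (gE _)).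
Qed.

(** Finite partial sums converge uniformly on the whole phase space, since
the sup bounds [bet] of the pieces are summable. Continuity passes to the limit,
and the modulus is bounded by the sum of those of the pieces. *)
Lemma stft_pieces_approx z (X : seq (int * int)) (e : R) : uniq X ->
  (\esum_(x in ~` [set` X]) bet x <= e%:E)%E ->
  normc (stft mu g f z - \sum_(x <- X) T x z) <= 2 * e.
Proof.
move=> uX Xe.
have iH : cintegrable mu (modulated f g z).
  split; first exact: cmeasurable_modulated.
  apply: le_lt_trans bet_fin; have := int_modulated_pieces z (isT : uniq [::]).
  under eq_integral do rewrite big_nil subr0.
  by rewrite (_ : ~` _ = setT)//; apply/seteqP; split => // x _ /=; rewrite inE.
have ix x : cintegrable mu (mod z x).
  split; first by apply: cmeasurable_modulated; [exact: fb_meas (fD _)|exact: fb_meas (gE _)].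
  under eq_integral do rewrite normc_modulated.
  by have [] := finbdd_integrable (finbdd_windowed z.1 (fD x.1) (gE x.2)).
have [iS sE] := cintegral_sum X ix.
rewrite /T; under eq_bigr do rewrite stftE.
rewrite -sE stftE -cintegralB//; apply: normc_cintegral_le.
  by apply: cmeasurableB; [exact: iH.1|exact: iS.1].
exact: le_trans (int_modulated_pieces z uX) Xe.
Qed.

Lemma stft_sum_continuous : continuous (stft mu g f : G * character R G -> R[i]).
Proof.
move=> z0; apply/cvg_complexP => e e0.
have e60 : 0 < e / 8 by rewrite divr_gt0.
have [X uX Xe] := esum_tail bet_ge0 bet_fin e60.
have cX : continuous (fun z : G * character R G => \sum_(x <- X) T x z).
  elim: (X) => [|x s IH].
    under [Z in continuous Z]eq_fun do rewrite big_nil.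
    by move=> z; exact: cvg_cst.
  under [Z in continuous Z]eq_fun do rewrite big_cons.
  move=> z; apply: (@cvgD R[i] R[i]^o); last exact: IH.
  exact: (stft_continuous hG mu_haar (fD x.1) (gE x.2)).
have /cvg_complexP/(_ (e / 4)) cXe := cX z0.
have e40 : 0 < e / 4 by rewrite divr_gt0.
apply: filterS (cXe e40) => z zX.
have h1 := stft_pieces_approx z uX Xe; have h0 := stft_pieces_approx z0 uX Xe.
have -> : stft mu g f z - stft mu g f z0 =
  (stft mu g f z - \sum_(x <- X) T x z) + ((\sum_(x <- X) T x z - \sum_(x <- X) T x z0)
   - (stft mu g f z0 - \sum_(x <- X) T x z0)) by ring.
apply: le_lt_trans (normc_triangle _ _) _.
have := normc_triangle (\sum_(x <- X) T x z - \sum_(x <- X) T x z0)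
  (- (stft mu g f z0 - \sum_(x <- X) T x z0)).
rewrite opprB [normc (_ - stft _ _ _ z0)]normc_sub; lra.
Qed.

Lemma stft_le_sum z :
  ((normc (stft mu g f z))%:E <= \esum_(x in [set: int * int]) (normc (T x z))%:E)%E.
Proof.
apply/lee_addgt0Pr => e e0; have e20 : 0 < e / 2 by rewrite divr_gt0.
have [X uX Xe] := esum_tail bet_ge0 bet_fin e20.
have h := stft_pieces_approx z uX Xe.
have hX : normc (\sum_(x <- X) T x z) <= \sum_(x <- X) normc (T x z).
  elim: (X) => [|x s IH]; first by rewrite !big_nil normc0.
  by rewrite !big_cons; apply: le_trans (normc_triangle _ _) _; rewrite lerD2l.
apply: (@le_trans _ _ ((\sum_(x <- X) normc (T x z))%:E + e%:E)%E).
  rewrite -EFinD lee_fin.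
  have := normc_triangle (stft mu g f z - \sum_(x <- X) T x z) (\sum_(x <- X) T x z).
  rewrite subrK; lra.
rewrite leeD2r// -sumEFin; apply: esum_ge; exists [set` X]; first by split.
by rewrite fsbig_seq.
Qed.

End stft_sum.

(** * Dyadic exponents *)

Section dyadic.
Variable R : realType.

(** For [k <= j] the minimum is [2 ^ (k + 1)] and for [j < k] it is
[2 ^ (j + 1)]; in both cases comparing the exponents is a linear inequality in
[j - k]. *)
Lemma dyadic_min_le (al1 al2 lam : R) (j k : int) :
  al1 + al2 = 1 -> 0 <= al2 -> lam <= al1 -> 0 <= lam ->
  Num.min (2 `^ (j + 1)%:~R) (2 `^ (k + 1)%:~R) <=
  2 * ((2 `^ j%:~R) `^ al1 * (2 `^ k%:~R) `^ al2) * 2 `^ (- (lam * (j - k)%:~R)) :> R.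
Proof.
move=> al12 al20 lam1 lam0.
have -> : 2 * ((2 `^ j%:~R) `^ al1 * (2 `^ k%:~R) `^ al2) * 2 `^ (- (lam * (j - k)%:~R)) =
  2 `^ (1 + j%:~R * al1 + k%:~R * al2 - lam * (j - k)%:~R) :> R.
  by rewrite !powR2D powRr1// -!powRrM; ring.
rewrite ge_min; have [kj|jk] := leP k j; apply/orP; [right|left];
  apply: ler_powR; rewrite ?ler1n// !intrD intrN.
  have h : 0 <= (j%:~R - k%:~R) * (al1 - lam) :> R.
    by apply: mulr_ge0; rewrite subr_ge0// ler_int.
  have -> : al2 = 1 - al1 by lra.
  by move: h; rewrite mulrBl !mulrBr; lra.
have h : 0 <= (k%:~R - j%:~R) * (al2 + lam) :> R.
  by apply: mulr_ge0; [rewrite subr_ge0 ler_int ltW|exact: addr_ge0].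
have -> : al1 = 1 - al2 by lra.
by move: h; rewrite mulrBl !mulrDr; lra.
Qed.

Lemma dyadic_sqrt (al1 al2 del : R) (j k : int) :
  al1 + al2 = 1 -> al2 = 1 / 2 + del ->
  2 `^ (j + 1)%:~R * 2 `^ (k + 1)%:~R =
  (2 * ((2 `^ j%:~R) `^ al1 * (2 `^ k%:~R) `^ al2) * 2 `^ (del * (j - k)%:~R)) ^+ 2 :> R.
Proof.
move=> al12 al2E.
have -> : 2 * ((2 `^ j%:~R) `^ al1 * (2 `^ k%:~R) `^ al2) * 2 `^ (del * (j - k)%:~R) =
  2 `^ (1 + j%:~R * al1 + k%:~R * al2 + del * (j - k)%:~R) :> R.
  by rewrite !powR2D powRr1// -!powRrM; ring.
rewrite -powR_mulrn ?powR_ge0// -powRrM -powR2D; congr (_ `^ _).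
rewrite !intrD intrN; have -> : al1 = 1 / 2 - del by lra.
by rewrite al2E; field.
Qed.

(** The pieces carry the index difference [j - k]; reversing the second
sequence turns it into the sum [j + k], that is, into a convolution. *)
Lemma dyadic_interpolation (Z : preTopologicalZmodType)
    (m : {measure set (borel Z) -> \bar R}) (F : Z -> R[i]) (T : int -> int -> Z -> R)
    (M1 M2 : int -> R) (al1 al2 q u v w lam del X Y k1 : R) :
  hausdorff_space Z -> radon_measure m -> continuous F ->
  (forall j k, measurable_fun [set: borel Z] (T j k : borel Z -> R)) ->
  (forall j k z, 0 <= T j k z) ->
  (forall z, (normc (F z))%:E <= \esum_(x in [set: int * int]) (T x.1 x.2 z)%:E)%E ->
  (forall j k z, T j k z <= 2 * (M1 j * M2 k) *
     Num.min (2 `^ (j + 1)%:~R) (2 `^ (k + 1)%:~R)) ->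
  (forall j k (C : set Z), compact C ->
    \int[m]_(z in (C : set (borel Z))) (T j k z ^+ 2)%:E <=
    ((M1 j * M2 k) ^+ 2 * (2 `^ (j + 1)%:~R * 2 `^ (k + 1)%:~R))%:E)%E ->
  (forall j, 0 <= M1 j) -> (forall k, 0 <= M2 k) ->
  al1 + al2 = 1 -> al2 = 1 / 2 + del -> lam <= al1 ->
  2 < q -> 0 < lam -> del = lam * (q - 2) / 2 ->
  1 <= u -> 1 <= v -> 1 <= w -> 1 + w^-1 <= u^-1 + v^-1 -> 0 < X -> 0 < Y ->
  (\esum_(j in [set: int]) (((2 `^ j%:~R) `^ al1 * M1 j) `^ u)%:E <= (X `^ u)%:E)%E ->
  (\esum_(j in [set: int]) (((2 `^ j%:~R) `^ al2 * M2 j) `^ v)%:E <= (Y `^ v)%:E)%E ->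
  0 < k1 -> (\esum_(i in [set: int]) (kernel del lam i)%:E <= k1%:E)%E ->
  (lorentz_norm m q%:E w%:E F <=
   ((2 `^ (lam * q)) `^ q^-1 * (2 `^ (lam * q) - 1) `^ w^-1 * (4 * (k1 * (X * Y))))%:E)%E.
Proof.
move=> hZ mR cF mT T0 FT Tsup TL2 M10 M20 al12 al2E lam1 q2 lam0 delE.
move=> u1 v1 w1 uvw X0 Y0 fX gY k10 kk.
have del0 : 0 < del by rewrite delE divr_gt0// mulr_gt0// subr_gt0.
pose f j := (2 `^ j%:~R) `^ al1 * M1 j.
pose g k := (2 `^ (- k)%:~R) `^ al2 * M2 (- k).
have f0 j : 0 <= f j by rewrite mulr_ge0 ?powR_ge0.
have g0 k : 0 <= g k by rewrite mulr_ge0 ?powR_ge0.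
have negb : set_bij [set: int] [set: int] (@GRing.opp int).
  split=> [//|i j _ _ /oppr_inj//|i _]; by exists (- i) => //; rewrite opprK.
apply: (@interpolation R Z m F (fun x => T x.1 (- x.2)) f g q u v w lam del 4 X Y k1) => //.
- move=> z; apply: le_trans (FT z) _; rewrite le_eqVlt; apply/orP; left; apply/eqP.
  rewrite (@reindex_esum _ _ _ [set: int * int] _ (fun x => (x.1, - x.2)))//.
  split => //; first by move=> [a b] [a' b'] _ _ /= [-> /oppr_inj ->].
  by move=> [a b] _; exists (a, - b) => //=; rewrite opprK.
- move=> [j k] z /=; apply: le_trans (Tsup _ _ _) _.
  have al20 : 0 <= al2 by lra.
  have h := dyadic_min_le j (- k) al12 al20 lam1 (ltW lam0).
  have MM : 0 <= 2 * (M1 j * M2 (- k)) by rewrite !mulr_ge0.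
  apply: le_trans (ler_wpM2l MM h) _; rewrite opprK /f /g.
  move: (2 `^ (- _)) (_ `^ al1) (_ `^ al2) (M1 j) (M2 (- k)) => x1 x2 x3 x4 x5.
  by rewrite le_eqVlt; apply/orP; left; apply/eqP; ring.
- move=> [j k] C cC /=; apply: le_trans (TL2 _ _ _ cC) _; rewrite lee_fin.
  rewrite (dyadic_sqrt _ _ al12 al2E) opprK -exprMn.
  rewrite lerXn2r ?nnegrE ?mulr_ge0 ?powR_ge0 ?M10 ?M20//.
  rewrite /f /g; set a := _ `^ al1; set b := _ `^ al2; set c := 2 `^ _.
  have : 0 <= M1 j * M2 (- k) * (a * b) * c by rewrite !mulr_ge0 ?powR_ge0.
  by lra.
by rewrite (@reindex_esum _ _ _ [set: int] _ (@GRing.opp int)) in gY.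
Qed.

(** The terms are at most those of a convolution with the kernel of decay
rates [al2] and [al1], evaluated at 0. *)
Lemma dyadic_min_summable (M1 M2 : int -> R) (al1 al2 u v w X Y : R) :
  (forall j, 0 <= M1 j) -> (forall k, 0 <= M2 k) ->
  al1 + al2 = 1 -> 0 < al1 -> 0 < al2 ->
  1 <= u -> 1 <= v -> 1 <= w -> 1 + w^-1 <= u^-1 + v^-1 -> 0 < X -> 0 < Y ->
  (\esum_(j in [set: int]) (((2 `^ j%:~R) `^ al1 * M1 j) `^ u)%:E <= (X `^ u)%:E)%E ->
  (\esum_(j in [set: int]) (((2 `^ j%:~R) `^ al2 * M2 j) `^ v)%:E <= (Y `^ v)%:E)%E ->
  (\esum_(x in [set: int * int]) (M1 x.1 * M2 x.2 *
     Num.min (2 `^ (x.1 + 1)%:~R) (2 `^ (x.2 + 1)%:~R))%:E < +oo)%E.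
Proof.
move=> M10 M20 al12 al10 al20 u1 v1 w1 uvw X0 Y0 fX gY.
pose f j := (2 `^ j%:~R) `^ al1 * M1 j.
pose g k := (2 `^ (- k)%:~R) `^ al2 * M2 (- k).
have f0 j : 0 <= f j by rewrite mulr_ge0 ?powR_ge0.
have g0 k : 0 <= g k by rewrite mulr_ge0 ?powR_ge0.
have negb : set_bij [set: int] [set: int] (@GRing.opp int).
  split=> [//|i j _ _ /oppr_inj//|i _]; by exists (- i) => //; rewrite opprK.
have gY' : (\esum_(j in [set: int]) (g j `^ v)%:E <= (Y `^ v)%:E)%E.
  by rewrite (@reindex_esum _ _ _ [set: int] _ (@GRing.opp int)) in gY.
have [k1 k10 kk] := kernel_summable al20 al10.
have [er [_ erE _]] := kernel_convolution u1 v1 w1 uvw f0 g0 X0 Y0 fX gY' k10 kk.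
rewrite (@reindex_esum _ _ _ [set: int * int] _ (fun x => (x.1, - x.2))); last first.
  split => //; first by move=> [a b] [a' b'] _ _ /= [-> /oppr_inj ->].
  by move=> [a b] _; exists (a, - b) => //=; rewrite opprK.
apply: (@le_lt_trans _ _ (2%:E * (er 0)%:E)%E); last by rewrite -EFinM ltry.
rewrite erE -esumZl//; last by move=> x _; rewrite lee_fin !mulr_ge0 ?kernel_ge0.
apply: le_esum => -[j k] _ /=; rewrite -EFinM lee_fin sub0r.
have -> : 2 * (kernel al2 al1 (- (j + k)) * (f j * g k)) =
  M1 j * M2 (- k) * (2 * (kernel al2 al1 (- (j + k)) *
    ((2 `^ j%:~R) `^ al1 * (2 `^ (- k)%:~R) `^ al2))).
  rewrite /f /g; move: (kernel _ _ _) (_ `^ al1) (_ `^ al2) (M1 j) (M2 (- k)).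
  by move=> x1 x2 x3 x4 x5; ring.
apply: ler_wpM2l; first by rewrite mulr_ge0.
have E1 (x : R) : 2 * (2 `^ x * ((2 `^ j%:~R) `^ al1 * (2 `^ (- k)%:~R) `^ al2)) =
   2 `^ (1 + x + j%:~R * al1 + (- k)%:~R * al2) :> R.
  by rewrite !powR2D powRr1// -!powRrM; ring.
rewrite /kernel ge_min; case: ifPn => jk; rewrite E1; apply/orP; [left|right];
  apply: ler_powR; rewrite ?ler1n// !(intrD, intrN).
  have -> : al1 = 1 - al2 by lra.
  by rewrite le_eqVlt; apply/orP; left; apply/eqP; ring.
have -> : al2 = 1 - al1 by lra.
by rewrite le_eqVlt; apply/orP; left; apply/eqP; ring.
Qed.

End dyadic.

(** * The bilinear estimate *)

Section final_bound.
Variables (R : realType) (G : topologicalZmodType).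
Variable mu : {measure set (borel G) -> \bar R}.
Variable mu_dual : {measure set (borel (character R G)) -> \bar R}.
Variable mu_prod : {measure set (borel (G * character R G)%type) -> \bar R}.
Hypothesis hG : hausdorff_space G.
Hypothesis mu_haar : haar_measure mu.
Hypothesis mu_dual_haar : haar_measure mu_dual.
Hypothesis mu_plancherel : plancherel mu mu_dual.
Hypothesis mu_radon_prod : radon_product mu mu_dual mu_prod.

(** The two alternatives on the exponents correspond to [p < 2] and [2 < p].
In the second one the slopes [lam] and [del] become positive after exchanging the
roles of [f] and [g]. *)
Lemma stft_lorentz_bound (p r q u v w lam del k1 X Y : R) (f g : G -> R[i]) :
  0 < p -> 0 < r -> r^-1 + p^-1 = 1 ->
  (p^-1 = 1 / 2 + del /\ lam <= r^-1 \/ r^-1 = 1 / 2 + del /\ lam <= p^-1) ->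
  2 < q -> 0 < lam -> del = lam * (q - 2) / 2 ->
  1 <= u -> 1 <= v -> 1 <= w -> 1 + w^-1 <= u^-1 + v^-1 -> 0 < X -> 0 < Y ->
  0 < k1 -> (\esum_(i in [set: int]) (kernel del lam i)%:E <= k1%:E)%E ->
  cmeasurable f -> cmeasurable g ->
  (lorentz_norm mu r%:E u%:E f <= X%:E)%E -> (lorentz_norm mu p%:E v%:E g <= Y%:E)%E ->
  continuous (stft mu g f : G * character R G -> R[i]) /\
  (lorentz_norm mu_prod q%:E w%:E (stft mu g f) <=
   ((2 `^ (lam * q)) `^ q^-1 * (2 `^ (lam * q) - 1) `^ w^-1 *
    (4 * (k1 * ((2 `^ u^-1 * 2 `^ r^-1 * X) * (2 `^ v^-1 * 2 `^ p^-1 * Y)))))%:E)%E.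
Proof.
move=> p0 r0 rp cases q2 lam0 delE u1 v1 w1 uvw X0 Y0 k10 kk mf mg fX gY.
have u0 : 0 < u by lra.
have v0 : 0 < v by lra.
have [M [D [Nf [[M0 mD Dt tD fM] [mNf Nf0 covf fs]]]]] :=
  lorentz_pieces r0 u0 (ltW X0) mf fX.
have [N [E [Ng [[N0 mE Et tE gN] [mNg Ng0 covg gs]]]]] :=
  lorentz_pieces p0 v0 (ltW Y0) mg gY.
have fD j : finbdd mu (piece f (D j)) (M j) (D j).
  by apply: finbdd_piece => //; [apply: le_lt_trans (Dt j) (ltry _)|exact: fM].
have gE k : finbdd mu (piece g (E k)) (N k) (E k).
  by apply: finbdd_piece => //; [apply: le_lt_trans (Et k) (ltry _)|exact: gN].
set X' := 2 `^ u^-1 * 2 `^ r^-1 * X in fs *.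
set Y' := 2 `^ v^-1 * 2 `^ p^-1 * Y in gs *.
have X'0 : 0 < X' by rewrite !mulr_gt0 ?powR_gt0.
have Y'0 : 0 < Y' by rewrite !mulr_gt0 ?powR_gt0.
have minDE j k : (Order.min (mu (D j)) (mu (E k)) <=
    (Num.min (2 `^ (j + 1)%:~R) (2 `^ (k + 1)%:~R))%:E)%E.
  rewrite EFin_min le_min; apply/andP; split.
    by apply: le_trans (Dt j); rewrite ge_min lexx.
  by apply: le_trans (Et k); rewrite ge_min lexx orbT.
have bet_fin : (\esum_(x in [set: int * int])
    ((M x.1 * N x.2)%:E * Order.min (mu (D x.1)) (mu (E x.2))) < +oo)%E.
  have r10 : 0 < r^-1 by rewrite invr_gt0.
  have p10 : 0 < p^-1 by rewrite invr_gt0.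
  apply: le_lt_trans (dyadic_min_summable M0 N0 rp r10 p10 u1 v1 w1 uvw X'0 Y'0 fs gs).
  apply: le_esum => x _; rewrite [leRHS]EFinM; apply: lee_wpmul2l => //.
  by rewrite lee_fin mulr_ge0.
have cF := stft_sum_continuous hG mu_haar mf mg fD gE tD tE mNf mNg Nf0 Ng0 covf covg bet_fin.
have FT := stft_le_sum mu_haar mf mg fD gE tD tE mNf mNg Nf0 Ng0 covf covg bet_fin.
split; first exact: cF.
pose T j k z := normc (stft mu (piece g (E k)) (piece f (D j)) z).
have mT j k : measurable_fun [set: borel (G * character R G)%type]
    (T j k : borel (G * character R G)%type -> R).
  apply: measurable_normc; apply: cmeasurable_continuous.
  exact: (stft_continuous hG mu_haar (fD j) (gE k)).
have T0 j k z : 0 <= T j k z by exact: normc_ge0.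
have Tsup j k z : T j k z <= 2 * (M j * N k) *
    Num.min (2 `^ (j + 1)%:~R) (2 `^ (k + 1)%:~R).
  rewrite -lee_fin; apply: le_trans (stft_le mu_haar z (fD j) (gE k)) _.
  rewrite -[(2%:E * _)%E]EFinM [leRHS]EFinM; apply: lee_wpmul2l => //.
  by rewrite lee_fin !mulr_ge0.
have TL2 j k (C : set (G * character R G)) : compact C ->
    (\int[mu_prod]_(z in (C : set (borel (G * character R G)%type))) (T j k z ^+ 2)%:E <=
    ((M j * N k) ^+ 2 * (2 `^ (j + 1)%:~R * 2 `^ (k + 1)%:~R))%:E)%E.
  move=> cC; apply: le_trans (stft_L2_compact hG mu_haar mu_dual_haar mu_plancherel
    mu_radon_prod (fD j) (gE k) cC) _.
  rewrite [leRHS]EFinM; apply: lee_wpmul2l; first by rewrite lee_fin sqr_ge0.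
  by rewrite [leRHS]EFinM; apply: lee_pmul.
have hZ : hausdorff_space (G * character R G)%type.
  exact: hausdorff_pair hG (@character_hausdorff R G).
have mR : radon_measure mu_prod by case: mu_radon_prod.
case: cases => [[pE lr]|[rE lp]].
  exact: (@dyadic_interpolation R _ mu_prod (stft mu g f) T M N r^-1 p^-1 q u v w lam del X' Y' k1 hZ mR cF mT T0 FT Tsup TL2 M0 N0 rp pE lr q2 lam0 delE u1 v1 w1 uvw X'0 Y'0 fs gs k10 kk).
rewrite [X' * Y']mulrC.
have FT' z : ((normc (stft mu g f z))%:E <=
    \esum_(x in [set: int * int]) (T x.2 x.1 z)%:E)%E.
  apply: le_trans (FT z) _; rewrite le_eqVlt; apply/orP; left; apply/eqP.
  apply: (@reindex_esum _ _ _ [set: int * int] _ (fun x => (x.2, x.1))).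
  split; first by move=> x _.
    by move=> [a b] [a' b'] _ _ /= [-> ->].
  by move=> [a b] _; exists (b, a).
have Tsup' j k z : T k j z <= 2 * (N j * M k) *
    Num.min (2 `^ (j + 1)%:~R) (2 `^ (k + 1)%:~R).
  by rewrite [N j * _]mulrC minC; exact: Tsup.
have TL2' j k (C : set (G * character R G)) : compact C ->
    (\int[mu_prod]_(z in (C : set (borel (G * character R G)%type))) (T k j z ^+ 2)%:E <=
    ((N j * M k) ^+ 2 * (2 `^ (j + 1)%:~R * 2 `^ (k + 1)%:~R))%:E)%E.
  by move=> cC; rewrite [N j * _]mulrC [X in _ * X]mulrC; exact: TL2.
have pr : p^-1 + r^-1 = 1 by rewrite addrC.
have vuw : 1 + w^-1 <= v^-1 + u^-1 by rewrite [v^-1 + _]addrC.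
exact: (@dyadic_interpolation R _ mu_prod (stft mu g f) (fun j k => T k j) N M p^-1 r^-1
  q v u w lam del Y' X' k1 hZ mR cF (fun j k => mT k j) (fun j k => T0 k j) FT' Tsup' TL2'
  N0 M0 pr rE lp q2 lam0 delE v1 u1 w1 vuw Y'0 X'0 gs fs k10 kk).
Qed.

End final_bound.

Lemma hoelder_conjugate_EFin (R : realType) (p : R) : 1 < p ->
  hoelder_conjugate p%:E = (p / (p - 1))%:E.
Proof.
move=> p1; rewrite /hoelder_conjugate/= eqe gt_eqF; last by lra.
by rewrite inver subr_eq0 gt_eqF// -EFinM.
Qed.

Theorem theorem2p4 (R : realType) (G : topologicalZmodType)
    (mu : {measure set (borel G) -> \bar R})
    (mu_dual : {measure set (borel (character R G)) -> \bar R})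
    (mu_prod : {measure set (borel (G * character R G)%type) -> \bar R})
    (q p u v w : R) :
  hausdorff_space G -> locally_compact [set: G] ->
  haar_measure mu -> haar_measure mu_dual -> plancherel mu mu_dual ->
  radon_product mu mu_dual mu_prod ->
  2 < q ->
  (hoelder_conjugate q%:E <= p%:E)%E -> p <= q -> p != 2 ->
  1 <= u -> 1 <= v -> 1 <= w ->
  u^-1 + v^-1 >= 1 + w^-1 ->
  exists2 C : R, 0 < C &
    forall f g : G -> R[i],
      lorentz_space mu (hoelder_conjugate p%:E) u%:E f ->
      lorentz_space mu p%:E v%:E g ->
      lorentz_space mu_prod q%:E w%:E (stft mu g f) /\
      (lorentz_norm mu_prod q%:E w%:E (stft mu g f) <=
       C%:E * lorentz_norm mu (hoelder_conjugate p%:E) u%:E f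
            * lorentz_norm mu p%:E v%:E g)%E.
Proof.
move=> hG _ haarG haarD pl rp q2 qp pq pn2 u1 v1 w1 uvw.
have q1 : 1 < q by lra.
have {}qp : q <= p * (q - 1).
  move: qp; rewrite hoelder_conjugate_EFin// lee_fin ler_pdivrMr//; lra.
have p1 : 1 < p by nra.
have p0 : 0 < p by lra.
rewrite hoelder_conjugate_EFin//.
set r := p / (p - 1).
have r0 : 0 < r by rewrite divr_gt0//; lra.
have rE : r^-1 = 1 - p^-1.
  by rewrite /r invf_div mulrBl divff ?gt_eqF// mul1r.
have rpE : r^-1 + p^-1 = 1 by rewrite rE; lra.
have i0 : 0 < p^-1 by rewrite invr_gt0.
have qi1 : 1 <= q * p^-1 by rewrite ler_pdivlMr// mul1r.
have qi2 : q * p^-1 <= q - 1 by rewrite ler_pdivrMr//; lra.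
(* At p = 2 both slopes would vanish; on either side one of them is positive. *)
have [del del0 cases0] : exists2 del : R, 0 < del &
    p^-1 = 1 / 2 + del \/ r^-1 = 1 / 2 + del.
  have [p2|p2] := ltP p 2.
    exists (p^-1 - 1 / 2); last by left; lra.
    by rewrite subr_gt0 div1r ltf_pV2 ?posrE.
  have {}p2 : 2 < p by rewrite lt_neqAle eq_sym pn2.
  exists (1 / 2 - p^-1); last by right; rewrite rE; lra.
  by rewrite subr_gt0 div1r ltf_pV2 ?posrE.
pose lam := 2 * del / (q - 2).
have lam0 : 0 < lam by rewrite divr_gt0 ?mulr_gt0//; lra.
have delE : del = lam * (q - 2) / 2 by rewrite /lam; field; rewrite gt_eqF//; lra.
have cases : p^-1 = 1 / 2 + del /\ lam <= r^-1 \/ r^-1 = 1 / 2 + del /\ lam <= p^-1.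
  have qm2 : 0 < q - 2 by lra.
  case: cases0 => e; [left|right]; split => //; rewrite /lam ler_pdivrMr//.
    have -> : r^-1 * (q - 2) = q - 2 - q * p^-1 + 2 * p^-1 by rewrite rE; ring.
    lra.
  have -> : p^-1 * (q - 2) = q * p^-1 - 2 * p^-1 by ring.
  lra.
have [k1 k10 kk] := kernel_summable del0 lam0.
pose C := (2 `^ (lam * q)) `^ q^-1 * (2 `^ (lam * q) - 1) `^ w^-1 *
    (4 * (k1 * ((2 `^ u^-1 * 2 `^ r^-1) * (2 `^ v^-1 * 2 `^ p^-1)))) : R.
have rho1 : 1 < 2 `^ (lam * q) :> R.
  by apply: powR2_gt1; apply: mulr_gt0 => //; lra.
have C0 : 0 < C by rewrite !mulr_gt0 ?powR_gt0// subr_gt0.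
exists C => // f g [mf fX] [mg gY].
have lnorm_ge0 (s t : R) (h : G -> R[i]) : (0 <= lorentz_norm mu s%:E t%:E h)%E.
  exact: poweR_ge0.
have ff : lorentz_norm mu r%:E u%:E f \is a fin_num by rewrite ge0_fin_numE.
have gf : lorentz_norm mu p%:E v%:E g \is a fin_num by rewrite ge0_fin_numE.
pose a := fine (lorentz_norm mu r%:E u%:E f).
pose b := fine (lorentz_norm mu p%:E v%:E g).
have a0 : 0 <= a by exact: fine_ge0.
have b0 : 0 <= b by exact: fine_ge0.
have aE : lorentz_norm mu r%:E u%:E f = a%:E by rewrite /a fineK.
have bE : lorentz_norm mu p%:E v%:E g = b%:E by rewrite /b fineK.
have bound e : 0 < e -> continuous (stft mu g f : G * character R G -> R[i]) /\
    (lorentz_norm mu_prod q%:E w%:E (stft mu g f) <= (C * ((a + e) * (b + e)))%:E)%E.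
  move=> e0.
  have X0 : 0 < a + e by rewrite ltr_wpDl.
  have Y0 : 0 < b + e by rewrite ltr_wpDl.
  have Xf : (lorentz_norm mu r%:E u%:E f <= (a + e)%:E)%E by rewrite aE lee_fin lerDl ltW.
  have Yg : (lorentz_norm mu p%:E v%:E g <= (b + e)%:E)%E by rewrite bE lee_fin lerDl ltW.
  have [cF] := stft_lorentz_bound hG haarG haarD pl rp p0 r0 rpE cases q2 lam0 delE
    u1 v1 w1 uvw X0 Y0 k10 kk mf mg Xf Yg.
  move=> h; split => //; apply: le_trans h _.
  by rewrite lee_fin le_eqVlt; apply/orP; left; apply/eqP; rewrite /C; ring.
have main : (lorentz_norm mu_prod q%:E w%:E (stft mu g f) <= (C * (a * b))%:E)%E.
  apply/lee_addgt0Pr => d d0.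
  pose e := Num.min 1 (d / (C * (a + b + 1))).
  have s0 : 0 < C * (a + b + 1) by rewrite mulr_gt0//; lra.
  have e0 : 0 < e by rewrite lt_min ltr01 divr_gt0.
  have e1 : e <= 1 by rewrite ge_min lexx.
  have ed : e * (C * (a + b + 1)) <= d.
    by rewrite -ler_pdivlMr// ge_min lexx orbT.
  have [_ h] := bound e e0; apply: le_trans h _; rewrite -EFinD lee_fin.
  have -> : C * ((a + e) * (b + e)) = C * (a * b) + e * (C * (a + b + e)) by ring.
  rewrite lerD2l; apply: le_trans ed; apply: ler_wpM2l; first exact: ltW.
  by apply: ler_wpM2l; [exact: ltW|lra].
split; last by rewrite aE bE -!EFinM -mulrA.
split; first by have [cF _] := bound 1 ltr01; exact: cmeasurable_continuous.
by apply: le_lt_trans main _; rewrite ltry.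
Qed.
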